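(* Let $\hat G^{SS}_N$ be the $H$-step predictor ($H\ge1$) obtained by autoregressive rollout of the single-step least-squares model learned from a dataset of size $N$ from the fully observed system $x_{t+1}=Ax_t+Bu_t+B_ww_t$, as defined in the context. Then $$\lim_{N\to\infty} N\,\mathbf{E}\left[\left\|(\hat G^{SS}_N-G^\star)\Sigma_z^{1/2}\right\|_F^2\right]=\operatorname{tr}\left(\Gamma_w\big((M_{SS}+d_uI_H)\otimes I_{d_x}\big)\Gamma_w^\top\right),$$ where $M_{SS}\in\mathbb{R}^{H\times H}$ is the matrix whose $(i,j)$ entry, $1\le i,j\le H$, is $$\operatorname{tr}\left(\Big(I-\Sigma_x^{-1}\sum_{\ell=0}^{\min\{i,j\}-2}A^\ell B_wB_w^\top(A^\ell)^\top\Big)(A^{|j-i|})^\top\right)$$ (an empty sum is $0$).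
   Context: System: $x_{t+1}=Ax_t+Bu_t+B_ww_t$ with $x_t\in\mathbb{R}^{d_x}$, $u_t\in\mathbb{R}^{d_u}$, $x_0=0$, $A\in\mathbb{R}^{d_x\times d_x}$, $B\in\mathbb{R}^{d_x\times d_u}$, $B_w\in\mathbb{R}^{d_x\times d_x}$. The state is fully observed ($y_t=x_t$). The noises $w_t\sim\mathcal N(0,I_{d_x})$ are i.i.d., the inputs $u_t\sim\mathcal N(0,I_{d_u})$ are i.i.d., and the two sequences are independent. Standing assumptions: the spectral radius satisfies $\rho(A)<1$ and the pair $(A,[B\ \ B_w])$ is controllable. Dataset: $\{(x_t,u_t)\}_{t=1}^N$ from one rollout of the system. For a sequence $a$, $a_{s:r}$ denotes the stacked vector of $a_s,\dots,a_r$. Put $z_t=\begin{bmatrix} x_t \\ u_{t:t+H-1} \end{bmatrix}\in\mathbb{R}^{d_x+Hd_u}$. Single-step predictor: $[\hat G_y\ \ \hat G_u]=\arg\min_{G_y\in\mathbb{R}^{d_x\times d_x},\,G_u\in\mathbb{R}^{d_x\times d_u}}\sum_{t=1}^{N-1}\left\|x_{t+1}-[G_y\ \ G_u]\begin{bmatrix} x_t \\ u_t \end{bmatrix}\right\|^2$ (the ordinary least-squares solution; $N$ is large enough that it is almost surely unique). Its rollout is the matrix $\hat G^{SS}_N\in\mathbb{R}^{Hd_x\times(d_x+Hd_u)}$ with $i$-th block row ($1\le i\le H$) equal to $[\hat G_y^i\ \ \hat G_y^{i-1}\hat G_u\ \ \hat G_y^{i-2}\hat G_u\ \cdots\ \hat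 G_u\ \ 0\ \cdots\ 0]$. $\Sigma_z=\lim_{T\to\infty}\mathbf{E}\frac1T\sum_{t=0}^{T}z_tz_t^\top$ is the stationary covariance of $z_t$, and $\Sigma_x$ is the stationary covariance of $x_t$ (the solution of $\Sigma_x=A\Sigma_xA^\top+BB^\top+B_wB_w^\top$). $G^\star\in\mathbb{R}^{Hd_x\times(d_x+Hd_u)}$ has $i$-th block row equal to $[A^i\ \ A^{i-1}B\ \ A^{i-2}B\ \cdots\ B\ \ 0\ \cdots\ 0]$. $\Gamma_w\in\mathbb{R}^{Hd_x\times Hd_x}$ is block lower triangular with $(i,j)$ block $A^{i-j}B_w$ for $i\ge j$ and $0$ for $i<j$. Thus $x_{t+1:t+H}=G^\star z_t+\Gamma_ww_{t:t+H-1}$. $\|\cdot\|_F$ is the Frobenius norm, $\otimes$ the Kronecker product, and $\mathbf{E}$ is over the dataset. *)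

(* Defs.v *)
From HB Require Import structures.
From mathcomp Require Import all_boot all_order all_algebra.
From mathcomp Require Import all_classical all_reals all_analysis.
From mathcomp Require Export complex mxtens.

Set Implicit Arguments.
Unset Strict Implicit.
Unset Printing Implicit Defensive.

Import Order.TTheory GRing.Theory Num.Theory numFieldNormedType.Exports.
Local Open Scope classical_set_scope.
Local Open Scope ring_scope.

Section Matrices.
Variable R : realType.

(* The Frobenius norm; on column vectors it is the Euclidean norm. *)
Definition normF m n (M : 'M[R]_(m, n)) : R :=
  Num.sqrt (\sum_(i < m) \sum_(j < n) M i j ^+ 2).

(* Block (i, _) occupies the rows i * p, ..., i * p + p - 1: this is the index
   convention of the Kronecker product [*t] of mxtens. *)
Definition blockcol m p n (F : 'I_m -> 'M[R]_(p, n)) : 'M[R]_(m * p, n) :=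
  \matrix_(k, l) F (mxtens_unindex k).1 (mxtens_unindex k).2 l.

Definition blockrow m p n (F : 'I_m -> 'M[R]_(n, p)) : 'M[R]_(n, m * p) :=
  \matrix_(k, l) F (mxtens_unindex l).1 k (mxtens_unindex l).2.

(* S is the positive semidefinite square root of M (unique when it exists). *)
Definition is_psd_sqrt n (S M : 'M[R]_n) : Prop :=
  [/\ S^T = S, forall v : 'cV[R]_n, 0 <= (v^T *m S *m v) 0 0 & S *m S = M].

(* The eigenvalues are the complex ones. *)
Definition spectral_radius n (A : 'M[R]_n) : R :=
  sup [set ComplexField.Normc.normc a | a in
        [set a : R[i] | eigenvalue (map_mx (real_complex R) A) a]].

End Matrices.

Section LinearSystem.
Variable R : realType.

Fixpoint lin_traj n (A : 'M[R]_n) (v : nat -> 'cV[R]_n) (x0 : 'cV[R]_n)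
    (t : nat) : 'cV[R]_n :=
  if t is t'.+1 then A *m lin_traj A v x0 t' + v t' else x0.

Definition controllable n m (A : 'M[R]_n) (B : 'M[R]_(n, m)) : Prop :=
  forall x0 x1 : 'cV[R]_n, exists (t : nat) (v : nat -> 'cV[R]_m),
    lin_traj A (fun s => B *m v s) x0 t = x1.

Variables dx du : nat.

Definition state (A : 'M[R]_dx) (B : 'M[R]_(dx, du)) (Bw : 'M[R]_dx)
    (u : nat -> 'cV[R]_du) (w : nat -> 'cV[R]_dx) : nat -> 'cV[R]_dx :=
  lin_traj A (fun t => B *m u t + Bw *m w t) 0.

(* z_t = [x_t; u_t; ...; u_{t+H-1}] *)
Definition zvec (H : nat) (x : nat -> 'cV[R]_dx) (u : nat -> 'cV[R]_du)
    (t : nat) : 'cV[R]_(dx + H * du) :=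
  col_mx (x t) (blockcol (fun k : 'I_H => u (t + k)%N)).

Definition ls_cost (x : nat -> 'cV[R]_dx) (u : nat -> 'cV[R]_du) (N : nat)
    (G : 'M[R]_(dx, dx + du)) : R :=
  \sum_(1 <= t < N) normF (x t.+1 - G *m col_mx (x t) (u t)) ^+ 2.

Definition is_least_squares (x : nat -> 'cV[R]_dx) (u : nat -> 'cV[R]_du)
    (N : nat) (G : 'M[R]_(dx, dx + du)) : Prop :=
  forall G' : 'M[R]_(dx, dx + du), ls_cost x u N G <= ls_cost x u N G'.

(* Blocks are numbered from 0, so block row i carries Gy ^ (i + 1). *)
Definition rollout (H : nat) (Gy : 'M[R]_dx) (Gu : 'M[R]_(dx, du)) :
    'M[R]_(H * dx, dx + H * du) :=
  blockcol (fun i : 'I_H =>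
    row_mx (Gy ^+ i.+1)
      (blockrow (fun j : 'I_H =>
         if (j <= i)%N then Gy ^+ (i - j) *m Gu else 0))).

Definition Gamma_w (H : nat) (A Bw : 'M[R]_dx) : 'M[R]_(H * dx) :=
  blockcol (fun i : 'I_H => blockrow (fun j : 'I_H =>
    if (j <= i)%N then A ^+ (i - j) *m Bw else 0)).

Definition is_stationary_cov (A : 'M[R]_dx) (B : 'M[R]_(dx, du))
    (Bw Sx : 'M[R]_dx) : Prop :=
  Sx = A *m Sx *m A^T + B *m B^T + Bw *m Bw^T.

(* With indices from 0, the upper summation limit min{i,j} - 2 of the 1-based
   formula becomes min(i, j) - 1. *)
Definition M_SS (H : nat) (A Bw Sx : 'M[R]_dx) : 'M[R]_H :=
  \matrix_(i < H, j < H)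
    \tr ((1%:M - invmx Sx *m
            \sum_(0 <= l < minn i j) (A ^+ l *m Bw *m Bw^T *m (A ^+ l)^T))
         *m (A ^+ (maxn i j - minn i j))^T).

End LinearSystem.

Section Probability.
Context d (T : measurableType d) (R : realType) (P : probability T R).

Definition measurable_mx m n (X : T -> 'M[R]_(m, n)) : Prop :=
  forall i j, measurable_fun [set: T] (fun om => X om i j).

Definition sigma_rv (f : T -> R) : set_system T :=
  preimage_set_system [set: T] f measurable.

Definition sigma_vec n (X : T -> 'cV[R]_n) : set_system T :=
  <<s \bigcup_(i in [set: 'I_n]) sigma_rv (fun om => X om i 0) >>.

Definition sigma_seq n (X : nat -> T -> 'cV[R]_n) : set_system T :=
  <<s \bigcup_(t in [set: nat]) sigma_vec (X t) >>.

Definition independent_family (I : eqType) (F : I -> set_system T) : Prop :=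
  forall (J : seq I) (E : I -> set T), uniq J ->
    (forall i, i \in J -> F i (E i)) ->
    P (\bigcap_(i in [set` J]) E i) = (\prod_(i <- J) P (E i))%E.

Definition independent_pair (F G : set_system T) : Prop :=
  forall E E', F E -> G E' -> P (E `&` E') = (P E * P E')%E.

(* X ~ N(0, I_n): the coordinates are independent standard normal variables. *)
Definition std_normal_vec n (X : T -> 'cV[R]_n) : Prop :=
  [/\ measurable_mx X,
      forall (i : 'I_n) (E : set R), measurable E ->
        P ((fun om => X om i 0) @^-1` E) = normal_prob 0 1 E
    & independent_family (fun i : 'I_n => sigma_rv (fun om => X om i 0))].

Definition iid_std_normal n (X : nat -> T -> 'cV[R]_n) : Prop :=
  (forall t, std_normal_vec (X t)) /\
  independent_family (fun t => sigma_vec (X t)).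

(* The average has S + 1 terms and weight 1/S, which does not affect the limit. *)
Definition Sigma_z n (z : T -> nat -> 'cV[R]_n) : 'M[R]_n :=
  \matrix_(i, j) lim ((fun S : nat => fine ('E_P[fun om =>
    ((S%:R^-1 *: \sum_(0 <= t < S.+1) (z om t *m (z om t)^T)) i j)%R])%E) @ \oo).

End Probability.

(* Main.v *)
Require Import Defs.
From HB Require Import structures.
From mathcomp Require Import all_boot all_order all_algebra.
From mathcomp Require Import all_classical all_reals all_analysis.
From mathcomp Require Import perm measurable_realfun ring lra zify.
Set Implicit Arguments.
Unset Strict Implicit.
Unset Printing Implicit Defensive.
Import Order.TTheory GRing.Theory Num.Theory numFieldNormedType.Exports.
Local Open Scope classical_set_scope.
Local Open Scope ring_scope.

(* Write [G - [A B] = D].  The normal equations give [D S = B_w M], where [S] is the Gram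
   matrix of the regressors [xi_t = (x_t, u_t)] and [M = sum w_t xi_t^T].  As [S / N] tends to
   [Sigma = diag (Sx, 1)], [D] is to leading order [B_w (M / N) Sigma^-1].  The products
   [w_t xi_t^T] form a martingale difference sequence, so
   [N^-1 E [M_ij M_kl] -> delta_ik Sigma_jl], and the part of the rollout error that is linear
   in [D] contributes exactly the stated trace.

   The expectations converge, and not only the laws, because every moment of [sqrt N D] is
   bounded.  Where [S] is close to [N Sigma] this follows from moment bounds for martingales.
   On the remaining event, of probability O (N^-m) for every m, one needs negative moments of
   [det S], uniform in [N].  They come from square matrices built from regressors at well
   separated times: given the past, each new column has by controllability a Gaussian
   component in every direction, so replacing the columns one at a time by basis vectors
   keeps [E |det|^(-1/2)] bounded. *)

(** * Gaussian integrals *)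

(** All randomness is carried by one independent family of scalar standard normals, indexed by time
    and coordinate. Conditioning on the past is replaced by integrating over a second, independent
    copy of the fresh coordinates. The power -1/2 is used because [|x| ^ (-1/2)] is integrable near
    0 against a bounded density, and because [E |a + s X| ^ (-1/2)] is at most a constant times
    [|s| ^ (-1/2)], uniformly in the shift [a]. No lower bound on [s] is required: when [s] is
    itself random, a cofactor that may be tiny, its own negative power is simply handed to the next
    step. The factor [Z] produced in this way has only a first moment. On the ill-conditioned event
    it therefore cannot be multiplied by other unbounded quantities; bounds on squares are used to
    turn the product into a sum. The empirical covariance of the state is not a martingale. It
    satisfies a Lyapunov equation driven by martingales, which transfers their moment bounds to
    it. *)

Section GaussianIntegrals.
Variable R : realType.
Local Notation mu := (@lebesgue_measure R).
Local Notation gam := (@normal_prob R 0 1).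
Local Notation pdf := (@normal_pdf R 0 1).
Local Open Scope ereal_scope.

Import HBNNSimple.

(** For indicators this is the definition of [normal_prob]; linearity gives simple functions and
    monotone convergence along [nnsfun_approx] the rest. *)
Lemma ge0_integral_normal_prob (f : measurableTypeR R -> \bar R) :
  measurable_fun setT f -> (forall x, 0 <= f x) ->
  \int[gam]_x f x = \int[mu]_x (f x * (pdf x)%:E).
Proof.
move=> mf f0.
have mpdf : measurable_fun [set: measurableTypeR R] (EFin \o pdf).
  by apply/measurable_EFinP; exact: measurable_normal_pdf.
have pdf0 x : 0 <= (pdf x)%:E by rewrite lee_fin normal_pdf_ge0.
have nnE (h : {nnsfun measurableTypeR R >-> R}) :
    \int[gam]_x (h x)%:E = \int[mu]_x ((h x)%:E * (pdf x)%:E).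
  under eq_integral do rewrite fimfunE -fsumEFin//.
  rewrite ge0_integral_fsum//; last 2 first.
  - by move=> r; exact/measurable_EFinP/measurable_funM.
  - by move=> r x _; rewrite EFinM nnfun_muleindic_ge0.
  under [RHS]eq_integral.
    move=> x _; rewrite fimfunE -fsumEFin// ge0_mule_fsuml; last first.
      by move=> r; rewrite EFinM nnfun_muleindic_ge0.
    over.
  rewrite ge0_integral_fsum//; last 2 first.
  - move=> r; apply: emeasurable_funM => //.
    exact/measurable_EFinP/measurable_funM.
  - by move=> r x _; rewrite mule_ge0// EFinM nnfun_muleindic_ge0.
  apply: eq_fsbigr => r _; rewrite integralZl_indic_nnsfun// integral_indic// setIT.
  have [r0|r0] := leP 0%R r; last first.
    rewrite preimage_nnfun0// measure0 mule0.
    under eq_integral do rewrite indicE in_set0 mulr0 mul0e.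
    by rewrite integral0.
  under eq_integral do rewrite EFinM -muleA.
  rewrite ge0_integralZl_EFin//; last 2 first.
  - by move=> x _; rewrite mule_ge0.
  - apply: emeasurable_funM => //; apply/measurable_EFinP.
    exact: measurable_indic.
  congr (_ * _); rewrite /normal_prob [LHS]integral_mkcond.
  apply: eq_integral => x _; rewrite patchE indicE.
  by case: ifPn => _; rewrite ?mul1e ?mul0e.
pose f_ := nnsfun_approx measurableT mf.
transitivity (limn (fun n => \int[gam]_x (f_ n x)%:E)).
  rewrite -monotone_convergence//.
  - apply: eq_integral => x /[!inE] xD; apply/esym/cvg_lim => //.
    exact: cvg_nnsfun_approx.
  - by move=> n; exact/measurable_EFinP/measurable_funTS.
  - by move=> n x _; rewrite lee_fin.
  - by move=> x _ m n mn; rewrite lee_fin; exact/lefP/nd_nnsfun_approx.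
under eq_fun do rewrite nnE.
rewrite -monotone_convergence//.
- apply: eq_integral => x _; apply/cvg_lim => //.
  by apply: cvgeZr => //; exact: cvg_nnsfun_approx.
- by move=> n; apply: emeasurable_funM => //; exact/measurable_EFinP/measurable_funTS.
- by move=> n x _; rewrite mule_ge0// lee_fin.
- move=> x _ m n mn; apply: lee_wpmul2r => //.
  by rewrite lee_fin; exact/lefP/nd_nnsfun_approx.
Qed.

Lemma normal_pdf1E x : pdf x = (normal_peak 1 * expR (- (x ^+ 2 / 2)))%R.
Proof. by rewrite normal_pdfE ?oner_neq0// /normal_fun subr0 mulNr expr1n. Qed.

(** The factor [s] cancels the one in the peak, so that Gaussian densities of different variances
    can be compared pointwise. *)
Lemma normal_pdfsE (s x : R) : (0 < s)%R ->
  (s * normal_pdf 0 s x = normal_peak 1 * expR (- (x ^+ 2 / 2 / s ^+ 2)))%R.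
Proof.
move=> s0; rewrite normal_pdfE ?gt_eqF// /normal_fun subr0 mulNr.
have -> : (normal_peak s = s^-1 * normal_peak 1)%R.
  rewrite /normal_peak expr1n mul1r -mulrnAr sqrtrM ?sqr_ge0// invfM.
  by rewrite sqrtr_sqr gtr0_norm.
rewrite !mulrA mulfV ?gt_eqF// mul1r; congr (_ * expR (- _))%R.
by rewrite -mulr_natr invfM mulrA mulrAC.
Qed.

(** Raising [y <= expR y] to the power [k], with [y = t ^+ 2 / (4 * k)], bounds [(t ^+ 2) ^+ k], and
    [a <= 1 + a ^+ 2] passes to [a = |t| ^+ k]. The exponent is half that of the Gaussian density,
    so the product with the density is still dominated by a Gaussian, of variance 2. *)
Lemma expr_le_expR k : exists2 C : R, (0 <= C)%R &
  forall t : R, (`|t| ^+ k <= C * expR (t ^+ 2 / 4))%R.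
Proof.
exists (1 + (4 * k%:R) ^+ k)%R; first by rewrite addr_ge0// exprn_ge0// mulr_ge0.
move=> x; have e1 : (1 <= expR (x ^+ 2 / 4))%R.
  by rewrite -expR0 ler_expR divr_ge0// sqr_ge0.
case: k => [|k]; first by rewrite !expr0; nra.
have : ((x ^+ 2 / 4 / k.+1%:R) ^+ k.+1 <= expR (x ^+ 2 / 4))%R.
  have -> : (expR (x ^+ 2 / 4) = expR (x ^+ 2 / 4 / k.+1%:R) ^+ k.+1)%R.
    by rewrite -expRM_natl [X in _ = expR X]mulrC divfK// pnatr_eq0.
  rewrite lerXn2r ?nnegrE ?expR_ge0//.
    by rewrite !divr_ge0// sqr_ge0.
  by rewrite (le_trans _ (expR_ge1Dx _))// lerDr.
rewrite -mulrA -invfM expr_div_n ler_pdivrMr ?exprn_gt0 ?mulr_gt0// => h.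
have h2 : (`|x| ^+ k.+1 <= 1 + (x ^+ 2) ^+ k.+1)%R.
  rewrite -(real_normK (num_real x)) exprAC; set a := (`|x| ^+ _)%R.
  by have : (0 <= (a - 2^-1) ^+ 2)%R; [exact: sqr_ge0|nra].
rewrite (le_trans h2)// mulrDl mul1r lerD// mulrC.
by rewrite mulrC [leRHS]mulrC.
Qed.

Lemma normal_prob_moment_lty k : \int[gam]_x (`|x| ^+ k)%:E < +oo.
Proof.
have [C C0 kC] := @expr_le_expR k.
rewrite ge0_integral_normal_prob//; last first.
  by apply/measurable_EFinP; apply: measurable_funX; exact: normr_measurable.
pose s : R := Num.sqrt 2.
have s0 : (0 < s)%R by rewrite sqrtr_gt0.
apply: (@le_lt_trans _ _ (\int[mu]_x ((C * s)%:E * (normal_pdf 0 s x)%:E))).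
  apply: ge0_le_integral => //.
  - by move=> x _; rewrite mule_ge0// lee_fin ?exprn_ge0 ?normal_pdf_ge0.
  - apply: emeasurable_funM; apply/measurable_EFinP.
      by apply: measurable_funX; exact: normr_measurable.
    exact: measurable_normal_pdf.
  - apply: emeasurable_funM => //; apply/measurable_EFinP.
    exact: measurable_normal_pdf.
  - move=> x _; rewrite -!EFinM lee_fin -mulrA normal_pdfsE// normal_pdf1E mulrCA [leRHS]mulrCA.
    rewrite ler_wpM2l ?normal_peak_ge0// sqr_sqrtr//.
    rewrite -ler_pdivlMr ?expR_gt0// -expRN -[leRHS]mulrA -expRD (le_trans (kC x))//.
    by rewrite ler_wpM2l// ler_expR; lra.
rewrite ge0_integralZl_EFin ?mulr_ge0 ?(ltW s0)//; last 2 first.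
- by move=> x _; rewrite lee_fin normal_pdf_ge0.
- by apply/measurable_EFinP; exact: measurable_normal_pdf.
by rewrite integral_normal_pdf mule1 ltry.
Qed.

End GaussianIntegrals.

(** The value at 0 is infinite so that a finite integral forces the argument to be nonzero almost
    surely; this is how invertibility of random matrices is obtained. *)
Definition invsqrt (R : realType) (x : R) : \bar R :=
  if x == 0 then +oo%E else ((Num.sqrt `|x|)^-1)%:E.

Section GaussianMoments.
Variable R : realType.
Local Notation mu := (@lebesgue_measure R).
Local Notation gam := (@normal_prob R 0 1).
Local Notation pdf := (@normal_pdf R 0 1).
Local Open Scope ereal_scope.

Lemma integrable_normal_prob_expr k :
  gam.-integrable setT (fun x => (x ^+ k)%:E).
Proof.
apply/integrableP; split.
  apply/measurable_EFinP; apply: measurable_funX; exact: measurable_id.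
under eq_integral do rewrite /= normrX.
exact: normal_prob_moment_lty.
Qed.

(** The law is invariant under reflection, so the mean, being finite, equals its own opposite. *)
Lemma normal_prob_mean : \int[gam]_x x%:E = 0.
Proof.
have intx : gam.-integrable setT (fun x : R => x%:E).
  by apply: eq_integrable (integrable_normal_prob_expr 1).
have mid : measurable_fun [set: R] (fun x : R => x%:E).
  by apply/measurable_EFinP; exact: measurable_id.
have intN : gam.-integrable setT (fun x : R => (- x)%:E).
  by have := integrableN intx; apply: eq_integrable => // x _.
have gamN (A : set R) : measurable A ->
    gam A = pushforward gam (-%R : R -> measurableTypeR R) A.
  move=> mA; rewrite /pushforward /normal_prob.
  have mNA : measurable (-%R @^-1` A : set R).
    by rewrite -[X in measurable X]setTI; exact: oppr_measurable.
  transitivity (\int[pushforward mu (-%R : R -> measurableTypeR R)]_(x in A) (pdf x)%:E).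
    by apply: eq_measure_integral => B mB _; exact/esym/lebesgue_measureN.
  rewrite ge0_integral_pushforward//.
  - apply: eq_integral => x _ /=.
    by rewrite !normal_pdfE ?oner_neq0// /normal_fun !subr0 sqrrN.
  - by apply/measurable_EFinP/measurable_funTS; exact: measurable_normal_pdf.
  - by move=> x _; rewrite lee_fin normal_pdf_ge0.
have finE : \int[gam]_x x%:E \is a fin_num.
  exact: (integrable_fin_num measurableT intx).
have : \int[gam]_x x%:E = - \int[gam]_x x%:E.
  rewrite -integralN; last first.
    by rewrite fin_num_adde_defl// fin_numN (integrable_neg_fin_num measurableT intx).
  rewrite [LHS](eq_measure_integral (pushforward gam (-%R : R -> measurableTypeR R))).
    by rewrite integral_pushforward//; exact: oppr_measurable.
  by move=> A mA _; exact: gamN.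
move: finE; case: (\int[gam]_x x%:E) => // r _ [] rN.
by congr (_%:E); lra.
Qed.

(* [expR] is convex, so [expR (- c y) >= (1 - (c - 1) y) expR (- y)] with
   [y = x ^+ 2 / 2]; integrating, and using the total mass of [normal_pdf 0 s]
   with [c = s ^- 2], the variance is squeezed as [s] tends to [1]. *)
Lemma normal_prob_variance : \int[gam]_x (x ^+ 2)%:E = 1.
Proof.
have mx2 : measurable_fun [set: R] (fun x : R => (x ^+ 2)%:E).
  by apply/measurable_EFinP; apply: measurable_funX; exact: measurable_id.
have mpdf s : measurable_fun [set: measurableTypeR R] (EFin \o normal_pdf 0 s).
  by apply/measurable_EFinP; exact: measurable_normal_pdf.
have p0 (s x : R) : 0 <= (normal_pdf 0 s x)%:E by rewrite lee_fin normal_pdf_ge0.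
have x20 (x : R) : 0 <= (x ^+ 2)%:E by rewrite lee_fin sqr_ge0.
have finE : \int[gam]_x (x ^+ 2)%:E \is a fin_num.
  exact: (integrable_fin_num measurableT (integrable_normal_prob_expr 2)).
have E2 := ge0_integral_normal_prob mx2 x20.
have m0 : 0 <= \int[gam]_x (x ^+ 2)%:E by exact: integral_ge0.
case: (\int[gam]_x (x ^+ 2)%:E) finE E2 m0 => // m _ E2 m0.
have cvx (s x : R) : (0 < s -> pdf x <=
   s * normal_pdf 0 s x + (s ^- 2 - 1) / 2 * (x ^+ 2 * pdf x))%R.
  move=> s0; rewrite normal_pdfsE// normal_pdf1E.
  have := expR_ge1Dx (x ^+ 2 / 2 - x ^+ 2 / 2 / s ^+ 2)%R.
  rewrite expRD => h.
  have := expR_gt0 (- (x ^+ 2 / 2)) => e0.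
  have e1 : (expR (x ^+ 2 / 2) * expR (- (x ^+ 2 / 2)) = 1)%R.
    by rewrite -expRD subrr expR0.
  have pk := normal_peak_ge0 (1 : R).
  have h2 := ler_wpM2r (ltW e0) h.
  rewrite [leRHS]mulrAC e1 mul1r in h2.
  have := ler_wpM2l pk h2.
  set q := (s ^- 2)%R; set p := normal_peak 1; lra.
have Zs (s : R) : (0 <= s)%R -> \int[mu]_x (s%:E * (normal_pdf 0 s x)%:E) = s%:E.
  by move=> s0; rewrite ge0_integralZl_EFin ?integral_normal_pdf ?mule1//; exact: mpdf.
have mm : measurable_fun [set: measurableTypeR R] (fun x => (x ^+ 2)%:E * (pdf x)%:E).
  by apply: emeasurable_funM => //; exact: mpdf.
have Zm (c : R) : (0 <= c)%R ->
    \int[mu]_x (c%:E * ((x ^+ 2)%:E * (pdf x)%:E)) = c%:E * m%:E.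
  by move=> c0; rewrite ge0_integralZl_EFin ?E2// => x _; rewrite mule_ge0.
have cge0 (c : R) x : (0 <= c)%R -> 0 <= c%:E * ((x ^+ 2)%:E * (pdf x)%:E).
  by move=> c0; rewrite !mule_ge0.
have sge0 (s x : R) : (0 <= s)%R -> 0 <= s%:E * (normal_pdf 0 s x)%:E.
  by move=> c0; rewrite !mule_ge0.
have msp (s : R) : measurable_fun [set: measurableTypeR R]
    (fun x => s%:E * (normal_pdf 0 s x)%:E) by apply: emeasurable_funM => //; exact: mpdf.
have msm (c : R) : measurable_fun [set: measurableTypeR R]
    (fun x => c%:E * ((x ^+ 2)%:E * (pdf x)%:E)) by exact: emeasurable_funM.
(* The sign of [s ^- 2 - 1] decides the direction of the estimate: [s = 1 - e] bounds [m] from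
   below, [s = 1 + e] from above. *)
have up (e : R) : (0 < e < 1 -> 1 - 2 * e <= m)%R.
  move=> /andP[e0 e1]; pose s := (1 - e)%R.
  have s0 : (0 < s)%R by rewrite subr_gt0.
  have c0 : (0 <= (s ^- 2 - 1) / 2)%R.
    rewrite divr_ge0// subr_ge0 -exprVn exprn_ege1// invf_ge1// /s; lra.
  have : 1 <= s%:E + ((s ^- 2 - 1) / 2)%:E * m%:E.
    have -> : s%:E + ((s ^- 2 - 1) / 2)%:E * m%:E = \int[mu]_x (s%:E *
        (normal_pdf 0 s x)%:E + ((s ^- 2 - 1) / 2)%:E * ((x ^+ 2)%:E * (pdf x)%:E)).
      rewrite ge0_integralD ?Zs ?Zm ?(ltW s0)//.
        by move=> x _; rewrite sge0 ?ltW.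
      by move=> x _; rewrite cge0.
    rewrite -(integral_normal_pdf (0 : R) 1).
    apply: ge0_le_integral => //.
    - exact: mpdf.
    - by apply: emeasurable_funD; [exact: msp|exact: msm].
    - by move=> x _; rewrite -!EFinM -EFinD lee_fin cvx.
  rewrite -EFinM -EFinD lee_fin => h.
  have : (1 - s <= (1 - s ^+ 2) / 2 / s ^+ 2 * m)%R.
    have -> : ((1 - s ^+ 2) / 2 / s ^+ 2 = (s ^- 2 - 1) / 2)%R by field; rewrite gt_eqF.
    lra.
  rewrite mulrAC ler_pdivlMr ?exprn_gt0// /s => {}h.
  have m0' : (0 <= m)%R by rewrite -lee_fin.
  have me : (0 <= m * e)%R by rewrite mulr_ge0// ltW.
  have : ((1 - e) ^+ 2 <= (1 - e / 2) * m)%R by rewrite -(ler_pM2l e0); lra.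
  have := sqr_ge0 e; lra.
have dn (e : R) : (0 < e < 1 -> m <= 1 + 3 * e)%R.
  move=> /andP[e0 e1]; pose s := (1 + e)%R.
  have s0 : (0 < s)%R by rewrite addr_gt0.
  have c0 : (0 <= (1 - s ^- 2) / 2)%R.
    rewrite divr_ge0// subr_ge0 -exprVn exprn_ile1// ?invr_ge0 ?(ltW s0)//.
    by rewrite invf_le1// /s; lra.
  have : 1 + ((1 - s ^- 2) / 2)%:E * m%:E <= s%:E.
    have -> : 1 + ((1 - s ^- 2) / 2)%:E * m%:E = \int[mu]_x (
        (pdf x)%:E + ((1 - s ^- 2) / 2)%:E * ((x ^+ 2)%:E * (pdf x)%:E)).
      rewrite ge0_integralD ?integral_normal_pdf ?Zm//.
        exact: mpdf.
      by move=> x _; rewrite cge0.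
    rewrite -[X in (_ <= X)%E]Zs ?(ltW s0)//.
    apply: ge0_le_integral => //.
    - by move=> x _; rewrite adde_ge0// cge0.
    - by apply: emeasurable_funD; [exact: mpdf|exact: msm].
    - move=> x _; rewrite -!EFinM -EFinD lee_fin; have := cvx s x s0; lra.
  rewrite -EFinM -EFinD lee_fin => h.
  have : ((s ^+ 2 - 1) / 2 / s ^+ 2 * m <= s - 1)%R.
    have -> : ((s ^+ 2 - 1) / 2 / s ^+ 2 = (1 - s ^- 2) / 2)%R by field; rewrite gt_eqF.
    lra.
  rewrite mulrAC ler_pdivrMr ?exprn_gt0// /s => {}h.
  have m0' : (0 <= m)%R by rewrite -lee_fin.
  have me : (0 <= m * e)%R by rewrite mulr_ge0// ltW.
  have : ((1 + e / 2) * m <= (1 + e) ^+ 2)%R by rewrite -(ler_pM2l e0); lra.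
  have : (e * e <= e)%R by rewrite ger_pMl// ltW.
  lra.
congr (_%:E); apply/eqP; rewrite eq_le; apply/andP; split.
  apply/ler_addgt0Pr => e e0; have [e1|e1] := ltP e 1%R.
    by have := dn (e / 3)%R; rewrite divr_gt0// => /(_ ltac:(lra)); lra.
  by have := dn (1 / 3)%R; lra.
apply/ler_addgt0Pr => e e0; have [e1|e1] := ltP e 1%R.
  by have := up (e / 2)%R; rewrite divr_gt0// => /(_ ltac:(lra)); lra.
by have := up (1 / 2)%R; lra.
Qed.

End GaussianMoments.

(** * Inverse square roots of shifted and scaled Gaussians *)

Section InverseSquareRoot.
Variable R : realType.
Local Notation mu := (@lebesgue_measure R).
Local Notation gam := (@normal_prob R 0 1).
Local Open Scope ereal_scope.

Lemma invsqrt_ge0 (x : R) : 0 <= invsqrt x.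
Proof. by rewrite /invsqrt; case: ifP => // _; rewrite lee_fin invr_ge0 sqrtr_ge0. Qed.

Lemma invsqrt1 : invsqrt (1 : R) = 1.
Proof. by rewrite /invsqrt oner_eq0 normr1 sqrtr1 invr1. Qed.

Lemma invsqrtM (x y : R) : invsqrt (x * y) = invsqrt x * invsqrt y.
Proof.
rewrite /invsqrt mulf_eq0; case Ex: (x == 0%R); case Ey: (y == 0%R) => /=.
- by rewrite mulyy.
- by rewrite gt0_mulye// lte_fin invr_gt0 sqrtr_gt0 normr_gt0 Ey.
- by rewrite gt0_muley// lte_fin invr_gt0 sqrtr_gt0 normr_gt0 Ex.
- by rewrite -EFinM normrM sqrtrM// invfM.
Qed.

Lemma invsqrt_le (x y : R) : (`|x| <= `|y|)%R -> invsqrt y <= invsqrt x.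
Proof.
have [->|x0 xy] := eqVneq x 0%R; first by rewrite /invsqrt eqxx leey.
rewrite /invsqrt (negbTE x0).
have y0 : y != 0%R.
  by apply: contra x0 => /eqP y0; move: xy; rewrite y0 normr0 normr_le0.
rewrite (negbTE y0) lee_fin lef_pV2 ?posrE ?sqrtr_gt0 ?normr_gt0//.
by rewrite ler_sqrt// normr_gt0.
Qed.

Lemma measurable_invsqrt : measurable_fun [set: R] (@invsqrt R).
Proof.
apply: measurable_fun_ifT.
- by apply: measurable_fun_eqr => //; exact: measurable_id.
- exact: measurable_cst.
- apply/measurable_EFinP.
  rewrite (_ : (fun x : R => _) = (@powR R ^~ (- 2^-1)%R) \o (fun x : R => `|x|%R)).
    apply: measurableT_comp; [exact: measurable_powR|exact: normr_measurable].
  by apply/funext => x /=; rewrite powRN powR12_sqrt.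
Qed.

(** Dyadic layers: if [4 ^- k.+1 < |t| <= 4 ^- k], the term of index [k] alone exceeds the left
    side. At [t = 0] every term is present and the series diverges, as it must. *)
Lemma invsqrt_layers (t : R) : invsqrt t <=
  1 + \sum_(k <oo) (2 ^+ k.+1 * \1_`[(- (4 ^- k))%R, (4 ^- k)%R] t)%:E.
Proof.
have u0 k : 0 <= (2 ^+ k.+1 * \1_`[(- (4 ^- k))%R, (4 ^- k)%R] t)%:E :> \bar R.
  by rewrite lee_fin mulr_ge0// exprn_ge0.
have termle k : (`|t| <= 4 ^- k)%R -> (2 ^+ k.+1)%:E <=
    \sum_(k <oo) (2 ^+ k.+1 * \1_`[(- (4 ^- k))%R, (4 ^- k)%R] t)%:E :> \bar R.
  move=> tk; apply: le_trans (@nneseries_lim_ge R _ xpredT 0 k.+1 _) => //.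
  rewrite big_nat_recr//= indicE mem_set ?mulr1 ?leeDr ?sume_ge0//.
  by rewrite /= in_itv/= -ler_norml.
have s0 : 0 <= \sum_(k <oo) (2 ^+ k.+1 * \1_`[(- (4 ^- k))%R, (4 ^- k)%R] t)%:E :> \bar R.
  by apply: nneseries_ge0.
have [t0|t0] := eqVneq t 0%R.
  rewrite [X in _ <= _ + X](_ : _ = +oo) ?addey ?leey//.
  apply/eqyP => A A0.
  have Ak : (A <= 2 ^+ (Num.bound A).+1)%R.
    rewrite (le_trans (ltW (archi_boundP (ltW A0))))//.
    by rewrite -natrX ler_nat (leq_trans (leqnSn _))// ltnW// ltn_expl.
  apply: le_trans (termle (Num.bound A) _); first by rewrite lee_fin.
  by rewrite t0 normr0 invr_ge0 exprn_ge0.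
rewrite /invsqrt (negbTE t0).
have [t1|t1] := leP 1%R `|t|%R.
  apply: le_trans (_ : 1 <= _); last by rewrite leeDl.
  by rewrite lee_fin invf_le1 ?sqrtr_gt0 ?normr_gt0// -(sqrtr1 R) ler_sqrt ?normr_gt0.
have ex : exists k, (4 ^- k < `|t|)%R.
  have t0' : (0 < `|t|)%R by rewrite normr_gt0.
  exists (Num.bound `|t|^-1); rewrite invf_plt ?posrE ?exprn_gt0//.
  rewrite (lt_le_trans (archi_boundP _))// ?invr_ge0//.
  by rewrite -natrX ler_nat ltnW// ltn_expl.
case: (ex_minnP ex) => -[|k] kt kmin.
  by move: kt; rewrite expr0 invr1 ltNge (ltW t1).
have tk : (`|t| <= 4 ^- k)%R.
  by rewrite leNgt; apply/negP => /kmin; rewrite ltnn.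
apply: (@le_trans _ _ (2 ^+ k.+1)%:E); last first.
  by rewrite (le_trans (termle _ tk))// leeDr.
have -> : (2 ^+ k.+1 = (Num.sqrt (4 ^- k.+1))^-1 :> R)%R.
  have -> : (4 ^- k.+1 = (2 ^- k.+1) ^+ 2 :> R)%R.
    have -> : (4 = 2 ^+ 2 :> R)%R by rewrite -natrX.
    by rewrite -!exprVn -!exprM mulnC.
  by rewrite sqrtr_sqr ger0_norm ?invrK// invr_ge0 exprn_ge0.
rewrite lee_fin lef_pV2 ?posrE ?sqrtr_gt0 ?invr_gt0 ?exprn_gt0 ?normr_gt0//.
by rewrite ler_sqrt ?normr_gt0// ltW.
Qed.

(** The density is bounded by its peak, which is at most 1, so the probability is at most the
    length. *)
Lemma normal_prob_itv_le (a r : R) : (0 <= r)%R ->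
  gam `[(a - r)%R, (a + r)%R] <= (2 * r)%:E.
Proof.
move=> r0; rewrite /normal_prob.
apply: (@le_trans _ _ (\int[mu]_(x in `[(a - r)%R, (a + r)%R]) (cst 1 x))).
  apply: ge0_le_integral => //.
  - by move=> x _; rewrite lee_fin normal_pdf_ge0.
  - apply/measurable_EFinP/measurable_funTS; exact: measurable_normal_pdf.
  - move=> x _; rewrite lee_fin (le_trans (normal_pdf_ub _ _ (oner_neq0 _)))//.
    rewrite /normal_peak expr1n mul1r invf_le1.
      by rewrite -(sqrtr1 R) ler_sqrt ?mulrn_wgt0 ?pi_gt0//; have := @pi_ge2 R; lra.
    by rewrite sqrtr_gt0 mulrn_wgt0 ?pi_gt0.
rewrite integral_cst//= mul1e lebesgue_measure_itv/= lte_fin.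
case: ifPn => [_|_]; last by rewrite lee_fin mulr_ge0.
by rewrite -EFinB lee_fin; lra.
Qed.

(** After factoring out [s], each layer is an interval of length [2 * 4 ^- k] around a shifted
    centre and has weight [2 ^+ k.+1]. It contributes at most [4 * 2 ^- k] wherever the centre lies;
    the sum is 8, and [9 = 1 + 8]. *)
Lemma invsqrt_normal_prob (a s : R) :
  \int[gam]_y invsqrt (a + s * y) <= 9%:E * invsqrt s.
Proof.
have [->|s0] := eqVneq s 0%R.
  by rewrite /invsqrt eqxx gt0_muley ?leey// lte_fin.
have st y : invsqrt (a + s * y) = invsqrt s * invsqrt (y + a / s).
  by rewrite -invsqrtM; congr invsqrt; field.
have ma : measurable_fun [set: R] (fun y : R => y + a / s)%R.
  by apply: measurable_funD => //; exact: measurable_id.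
under eq_integral do rewrite st.
pose b := (- (a / s))%R.
pose E k := `[(b - 4 ^- k)%R, (b + 4 ^- k)%R]%classic : set R.
have layer y : invsqrt (y + a / s) <= 1 + \sum_(k <oo) (2 ^+ k.+1 * \1_(E k) y)%:E.
  rewrite (le_trans (invsqrt_layers _))// leeD2l//.
  apply: lee_nneseries => [k _|k _]; first by rewrite lee_fin mulr_ge0 ?exprn_ge0.
  rewrite lee_fin ler_wpM2l ?exprn_ge0// !indicE ler_nat.
  case: (boolP (_ \in `[_, _]%classic)) => //.
  rewrite inE/= in_itv/= => /andP[h1 h2].
  have -> // : y \in E k.
  by rewrite inE /E /= in_itv/= /b; apply/andP; split; lra.
have m1 k : measurable_fun [set: measurableTypeR R] (fun y => (2 ^+ k.+1 * \1_(E k) y)%:E).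
  apply/measurable_EFinP; apply: measurable_funM => //.
  by apply: measurable_indic; exact: measurable_itv.
have p1 k y : 0 <= (2 ^+ k.+1 * \1_(E k) y)%:E :> \bar R.
  by rewrite lee_fin mulr_ge0 ?exprn_ge0.
have sr : (0 <= (Num.sqrt `|s|)^-1)%R by rewrite invr_ge0 sqrtr_ge0.
have -> : invsqrt s = ((Num.sqrt `|s|)^-1)%:E by rewrite /invsqrt (negbTE s0).
rewrite ge0_integralZl_EFin//; last 2 first.
- by move=> y _; exact: invsqrt_ge0.
- by apply: measurableT_comp ma; exact: measurable_invsqrt.
rewrite muleC; apply: lee_wpmul2r; first by rewrite lee_fin.
apply: (@le_trans _ _ (\int[gam]_y (1 + \sum_(k <oo) (2 ^+ k.+1 * \1_(E k) y)%:E))).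
  apply: ge0_le_integral => //.
  - by move=> y _; exact: invsqrt_ge0.
  - by apply: measurableT_comp ma; exact: measurable_invsqrt.
  - by apply: emeasurable_funD => //; apply: ge0_emeasurable_sum.
rewrite ge0_integralD//; last 2 first.
- by move=> y _; apply: nneseries_ge0.
- by apply: ge0_emeasurable_sum.
rewrite integral_cst//= mul1e integral_nneseries//.
have -> : gam setT = 1 by exact: (@probability_setT _ _ _ gam).
rewrite (_ : 9%:E = 1 + 8%:E); last by rewrite -EFinD; congr (_%:E); lra.
rewrite leeD2l//.
apply: (@le_trans _ _ (\sum_(k <oo) (4 * 2^-1 ^+ k)%:E)).
  apply: lee_nneseries => k _.
    by move=> *; apply: integral_ge0 => y _; exact: p1.
  rewrite (_ : \int[gam]_x _ = (2 ^+ k.+1)%:E * gam (E k)).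
    apply: le_trans (_ : (2 ^+ k.+1)%:E * (2 * 4 ^- k)%:E <= _).
      by rewrite lee_wpmul2l ?lee_fin ?exprn_ge0// normal_prob_itv_le// invr_ge0 exprn_ge0.
    rewrite -EFinM lee_fin exprS.
    have -> : (4 ^- k = 2^-1 ^+ k * 2^-1 ^+ k :> R)%R.
      by rewrite -exprMn -invfM -natrM exprVn.
    have : (2 ^+ k * 2^-1 ^+ k = 1 :> R)%R by rewrite -exprMn mulfV ?expr1n.
    move: (2 ^+ k)%R (2^-1 ^+ k)%R => x y xy.
    by have := congr1 (fun z => z * y)%R xy; lra.
  under eq_integral do rewrite EFinM.
  rewrite ge0_integralZl_EFin ?exprn_ge0//.
    rewrite integral_indic//; last exact: measurable_itv.
    by rewrite setIT.
  by apply/measurable_EFinP; apply: measurable_indic; exact: measurable_itv.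
apply: lime_le => /=.
  by apply: is_cvg_nneseries => k _ _; rewrite lee_fin mulr_ge0 ?exprn_ge0.
apply: nearW => n; rewrite sumEFin lee_fin.
have : (\sum_(0 <= k < n) 4 * 2^-1 ^+ k = 8 - 8 * 2^-1 ^+ n :> R)%R.
  elim: n => [|n IH]; first by rewrite big_geq// expr0; lra.
  by rewrite big_nat_recr//= IH exprS; lra.
by move=> ->; rewrite lerBlDr lerDl mulr_ge0// exprn_ge0.
Qed.

End InverseSquareRoot.

(** * Decoupling of independent families *)

Section IndependentVariables.
Context d (T : measurableType d) (R : realType) (P : probability T R).
Variables (I : choiceType) (g : I -> T -> R).

(** Finite rectangles in the coordinates of [J]: a pi-system generating the sigma-algebra of the
    variables [g i] with [i] in [J]. *)
Definition rect_system (J : set I) : set_system T :=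
  [set A | exists (s : seq I) (E : I -> set R),
    [/\ forall i, i \in s -> J i, forall i, measurable (E i)
      & A = \bigcap_(i in [set` s]) (g i @^-1` E i)]].

(** The same points with a smaller sigma-algebra: measurability on [subT J] expresses dependence on
    the coordinates of [J] only. *)
Definition subT (J : set I) := g_sigma_algebraType (rect_system J).

Definition to_subT (J : set I) (om : T) : subT J := om.

Hypothesis mg : forall i, measurable_fun [set: T] (g i).
Hypothesis indep_g : forall (s : seq I) (E : I -> set R), uniq s ->
  (forall i, measurable (E i)) ->
  P (\bigcap_(i in [set` s]) (g i @^-1` E i)) =
  (\prod_(i <- s) P (g i @^-1` E i))%E.

Lemma rect_systemI J : setI_closed (rect_system J).
Proof.
move=> A B [s1 [E1 [J1 mE1 ->]]] [s2 [E2 [J2 mE2 ->]]].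
exists (s1 ++ s2), (fun i => (if i \in s1 then E1 i else setT) `&`
                             (if i \in s2 then E2 i else setT)).
split.
- by move=> i; rewrite mem_cat => /orP[/J1|/J2].
- by move=> i; apply: measurableI; case: ifP.
- apply/seteqP; split => [om [h1 h2] i /= |om h].
    move=> _; split; case: ifP => // iS; [exact: h1|exact: h2].
  split=> i /= iS.
    have := h i; rewrite /= mem_cat iS => /(_ isT)[+ _].
    by rewrite ?iS.
  have := h i; rewrite /= mem_cat iS orbT => /(_ isT)[_ +].
  by rewrite ?iS.
Qed.

Lemma rect_system_measurable J : rect_system J `<=` measurable.
Proof.
move=> A [s [E [_ mE ->]]]; apply: fin_bigcap_measurable.
  exact: finite_seq.
by move=> i _; rewrite -[X in measurable X]setTI; exact: mg.
Qed.

Lemma rect_systemT J : rect_system J setT.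
Proof.
by exists [::], (fun=> setT); split => //; rewrite set_nil bigcap_set0.
Qed.

Lemma subT_measurable J (A : set (subT J)) : measurable A ->
  d.-measurable (A : set T).
Proof.
move=> mA; have : <<s rect_system J >> A by [].
apply: smallest_sub; last exact: rect_system_measurable.
exact: sigma_algebra_measurable.
Qed.

Lemma measurable_to_subT J : measurable_fun [set: T] (to_subT J).
Proof. by move=> _ A mA; rewrite setTI; exact: subT_measurable mA. Qed.

Lemma measurable_subT J d' (U : measurableType d') (f : T -> U) :
  measurable_fun [set: subT J] (f : subT J -> U) -> measurable_fun [set: T] f.
Proof.
by move=> mf _ A mA; apply: (@subT_measurable J); exact: mf.
Qed.

Lemma measurable_subTS J1 J2 d' (U : measurableType d') (f : T -> U) :
  J1 `<=` J2 ->
  measurable_fun [set: subT J1] (f : subT J1 -> U) ->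
  measurable_fun [set: subT J2] (f : subT J2 -> U).
Proof.
move=> J12 mf _ A mA; have := mf measurableT A mA; rewrite !setTI.
apply: sub_smallest2r; first exact: smallest_sigma_algebra.
move=> B [s [E [Js mE ->]]]; exists s, E; split => // i /Js; exact: J12.
Qed.

Lemma measurable_subT_g (J : set I) i : J i ->
  measurable_fun [set: subT J] (g i : subT J -> R).
Proof.
move=> Ji _ A mA; rewrite setTI; apply: sub_sigma_algebra.
exists [:: i], (fun=> A); split => //.
  by move=> j; rewrite inE => /eqP ->.
apply/seteqP; split => [om Ao j|om]; last by apply; rewrite /= inE.
by rewrite /= inE => /eqP ->.
Qed.

Lemma rect_system_indep J1 J2 A B : J1 `&` J2 = set0 ->
  rect_system J1 A -> rect_system J2 B -> P (A `&` B) = (P A * P B)%E.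
Proof.
move=> J12 [s1 [E1 [Js1 mE1 ->]]] [s2 [E2 [Js2 mE2 ->]]].
(* The product formula is available for duplicate-free lists only. *)
have undE (s : seq I) E : \bigcap_(i in [set` s]) (g i @^-1` E i) =
    \bigcap_(i in [set` undup s]) (g i @^-1` E i).
  by congr (bigcap _ _); apply/seteqP; split => i /=; rewrite mem_undup.
rewrite (undE s1) (undE s2).
set t1 := undup s1; set t2 := undup s2.
have t12 i : i \in t2 -> (i \in t1) = false.
  rewrite !mem_undup => is2; apply/negP => is1.
  by have : (J1 `&` J2) i; [split; [exact: Js1|exact: Js2]|rewrite J12].
pose E i := if i \in t1 then E1 i else E2 i.
have -> : \bigcap_(i in [set` t1]) (g i @^-1` E1 i) `&`
          \bigcap_(i in [set` t2]) (g i @^-1` E2 i) =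
          \bigcap_(i in [set` t1 ++ t2]) (g i @^-1` E i).
  apply/seteqP; split => [om [h1 h2] i /=|om h].
    rewrite mem_cat /E; case: ifP => /= it1 it2; first exact: h1.
    exact: h2.
  split=> i /= it.
    by have := h i; rewrite /= mem_cat /E it => /(_ isT).
  by have := h i; rewrite /= mem_cat /E it orbT t12// => /(_ isT).
rewrite !indep_g ?undup_uniq//.
- rewrite big_cat/=; congr (_ * _)%E; apply: eq_big_seq => i it; rewrite /E.
    by rewrite it.
  by rewrite t12.
- rewrite cat_uniq !undup_uniq andbT/=; apply/hasPn => i it.
  by apply/negP => /= it1; move: (t12 _ it); rewrite it1.
- by move=> i; rewrite /E; case: ifP.
Qed.

(** Uniqueness of measures on a pi-system, applied twice: for a fixed [C], the measures [P (D & C)]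
    and [P D * P C] of [D] agree on rectangles; first [C] is a rectangle, then an arbitrary set of
    the other sigma-algebra. *)
Lemma subT_indep J1 J2 A B : J1 `&` J2 = set0 ->
  <<s rect_system J1 >> A -> <<s rect_system J2 >> B ->
  P (A `&` B) = (P A * P B)%E.
Proof.
move=> J12.
have mS J C : <<s rect_system J >> C -> d.-measurable C.
  by move=> ?; exact: (@subT_measurable J).
have fin C : d.-measurable C -> (0 <= fine (P C))%R by move=> mC; rewrite fine_ge0.
have finK C : d.-measurable C -> ((fine (P C))%:E = P C)%E.
  by move=> mC; rewrite fineK// fin_num_measure.
have uniq1 (J : set I) C : d.-measurable C ->
    (forall D, rect_system J D -> P (D `&` C) = (P D * P C)%E) ->
    forall D, <<s rect_system J >> D -> P (D `&` C) = (P D * P C)%E.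
  move=> mC h D sD.
  pose c := NngNum (fin C mC).
  have := @g_sigma_algebra_measure_unique _ R T (rect_system J)
    (@rect_system_measurable J) (fun=> setT) (fun=> rect_systemT J) _
    (mrestr P mC) (mscale c P) (@rect_systemI J).
  have mscE E : mscale c P E = (P E * P C)%E by rewrite /mscale /= finK// muleC.
  move=> H; rewrite -mscE; apply: H => //.
  - by rewrite bigcup_const.
  - by move=> E /h hE; exact: etrans hE (esym (mscE E)).
  - by move=> _; exact: le_lt_trans (probability_le1 P (measurableI _ _ measurableT mC)) (ltry 1).
move=> sA sB; rewrite setIC muleC; apply: (uniq1 J2) => //; first exact: mS sA.
move=> D rD; rewrite setIC muleC; apply: (uniq1 J1) => //.
  exact: (rect_system_measurable rD).
by move=> C rC; exact: (rect_system_indep J12).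
Qed.

HB.instance Definition _ (J : set I) :=
  isMeasurableFun.Build _ _ T (subT J) (@to_subT J) (@measurable_to_subT J).

Section Decouple.
Variables J1 J2 : set I.
Hypothesis J12 : J1 `&` J2 = set0.

Let diag (om : T) : subT J1 * subT J2 := (to_subT J1 om, to_subT J2 om).

Let mdiag : measurable_fun [set: T] diag.
Proof. by apply: measurable_fun_pair; exact: measurable_to_subT. Qed.

HB.instance Definition _ :=
  isMeasurableFun.Build _ _ T (subT J1 * subT J2)%type diag mdiag.

(** By independence the law of the diagonal map into [subT J1 * subT J2] is the product of its
    marginals, and Tonelli applies. The inner integral, with [om] frozen, plays the part of a
    conditional expectation. *)
Lemma decouple (F : subT J1 * subT J2 -> \bar R) :
  measurable_fun [set: subT J1 * subT J2] F -> (forall z, 0 <= F z)%E ->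
  (\int[P]_om F (om, om) = \int[P]_om \int[P]_om' F (om, om'))%E.
Proof.
move=> mF F0.
pose m1 := distribution P (@to_subT J1 : {mfun T >-> subT J1}).
pose m2 := distribution P (@to_subT J2 : {mfun T >-> subT J2}).
pose m := distribution P (diag : {mfun T >-> (subT J1 * subT J2)%type}).
transitivity (\int[m]_z F z)%E; first by rewrite ge0_integral_distribution.
transitivity (\int[m1 \x m2]_z F z)%E.
  apply: eq_measure_integral => X mX _; apply/esym.
  apply: (@product_measure_unique _ _ _ _ _ m1 m2 m) => // A B mA mB.
  exact: (subT_indep J12).
rewrite fubini_tonelli1// ge0_integral_distribution//.
- apply: eq_integral => om _ /=; rewrite /fubini_F ge0_integral_distribution//.
  exact: measurableT_comp.
- exact: measurable_fun_fubini_tonelli_F.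
- by move=> om; apply: integral_ge0.
Qed.

(** A bound that holds for each frozen value of the [J1] coordinates may be integrated. *)
Lemma decouple_le (F : subT J1 * subT J2 -> \bar R) (H : T -> \bar R) :
  measurable_fun [set: subT J1 * subT J2] F -> (forall z, 0 <= F z)%E ->
  measurable_fun [set: T] H ->
  (forall om, \int[P]_om' F (om, om') <= H om)%E ->
  (\int[P]_om F (om, om) <= \int[P]_om H om)%E.
Proof.
move=> mF F0 mH FH; rewrite decouple//.
apply: ge0_le_integral => //; first by move=> om _; exact: integral_ge0.
pose m2 := distribution P (@to_subT J2 : {mfun T >-> subT J2}).
apply: (@measurable_subT J1).
rewrite (_ : (fun _ => _) = fubini_F m2 F); first exact: measurable_fun_fubini_tonelli_F.
apply/funext => om; rewrite /fubini_F ge0_integral_distribution//.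
exact: measurableT_comp.
Qed.

End Decouple.

End IndependentVariables.

(** * Sequences with bounded moments *)

Lemma normrD_expr_le (R : realDomainType) k (a b : R) :
  `|a + b| ^+ k <= 2 ^+ k * (`|a| ^+ k + `|b| ^+ k).
Proof.
apply: (@le_trans _ _ ((2 * Num.max `|a| `|b|) ^+ k)).
  rewrite lerXn2r ?nnegrE ?mulr_ge0 ?le_max ?normr_ge0//.
  by rewrite (le_trans (ler_normD _ _))//; case: (leP `|a| `|b|); lra.
rewrite exprMn ler_wpM2l ?exprn_ge0//.
by case: (leP `|a| `|b|) => _; rewrite ?lerDl ?lerDr exprn_ge0.
Qed.

Lemma normrM_expr_le (R : realFieldType) k (a b : R) :
  `|a * b| ^+ k <= `|a| ^+ (2 * k) + `|b| ^+ (2 * k).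
Proof.
rewrite normrM exprMn mulnC !exprM.
have a0 := exprn_ge0 k (normr_ge0 a); have b0 := exprn_ge0 k (normr_ge0 b).
have := sqr_ge0 (`|a| ^+ k - `|b| ^+ k); have := mulr_ge0 a0 b0; lra.
Qed.

Section BoundedMoments.
Context d (T : measurableType d) (R : realType) (P : probability T R).

(** The threshold depends on the exponent: the least-squares error is controlled only from a sample
    size that depends on the moment considered. *)
Definition bdd_moments (X : nat -> T -> R) : Prop :=
  (forall N, measurable_fun [set: T] (X N)) /\
  forall k : nat, exists C : R, exists N0 : nat, forall N, (N0 <= N)%N ->
    (\int[P]_om (`|X N om| ^+ k)%:E <= C%:E)%E.

(** Taking a constant sequence makes every closure property of [bdd_moments] apply to single
    variables by conversion. *)
Definition all_moments (X : T -> R) : Prop := bdd_moments (fun=> X).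

Lemma measurable_moment (X : T -> R) k : measurable_fun [set: T] X ->
  measurable_fun [set: T] (fun om => (`|X om| ^+ k)%:E).
Proof.
move=> mX; apply/measurable_EFinP; apply: measurable_funX.
by apply: measurableT_comp mX; exact: normr_measurable.
Qed.

Lemma le_bdd_moments (X Y : nat -> T -> R) (N1 : nat) :
  bdd_moments X -> (forall N, measurable_fun [set: T] (Y N)) ->
  (forall N, (N1 <= N)%N -> {ae P, forall om, `|Y N om| <= `|X N om|}) ->
  bdd_moments Y.
Proof.
move=> [mX bX] mY YX; split => // k; have [C [N0 h]] := bX k.
exists C, (maxn N0 N1) => N; rewrite geq_max => /andP[/h NC /YX XY].
apply: le_trans NC; apply: ae_ge0_le_integral => //.
- exact: measurable_moment.
- exact: measurable_moment.
- apply: filterS XY => om h1 _; rewrite lee_fin lerXn2r ?nnegrE//.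
Qed.

Lemma bdd_momentsD (X Y : nat -> T -> R) : bdd_moments X -> bdd_moments Y ->
  bdd_moments (fun N om => X N om + Y N om).
Proof.
move=> [mX bX] [mY bY]; split=> [N|k]; first exact: measurable_funD.
have [C [N0 hC]] := bX k; have [D [N1 hD]] := bY k.
exists (2 ^+ k * (C + D)), (maxn N0 N1) => N.
rewrite geq_max => /andP[/hC NC /hD ND].
apply: (@le_trans _ _ (\int[P]_om ((2 ^+ k)%:E *
    ((`|X N om| ^+ k)%:E + (`|Y N om| ^+ k)%:E)))%E).
  apply: ge0_le_integral => //.
  - by apply: measurable_moment; exact: measurable_funD.
  - apply: emeasurable_funM => //.
    by apply: emeasurable_funD; exact: measurable_moment.
  - move=> om _; rewrite -EFinD -EFinM lee_fin.
    exact: normrD_expr_le.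
rewrite ge0_integralZl_EFin ?exprn_ge0//; last 2 first.
- by move=> om _; rewrite -EFinD lee_fin addr_ge0 ?exprn_ge0.
- by apply: emeasurable_funD; exact: measurable_moment.
rewrite EFinM lee_wpmul2l ?lee_fin ?exprn_ge0//.
rewrite ge0_integralD//; last 2 first.
- exact: measurable_moment.
- exact: measurable_moment.
by rewrite EFinD leeD.
Qed.

Lemma bdd_momentsM (X Y : nat -> T -> R) : bdd_moments X -> bdd_moments Y ->
  bdd_moments (fun N om => X N om * Y N om).
Proof.
move=> [mX bX] [mY bY]; split=> [N|k]; first exact: measurable_funM.
have [C [N0 hC]] := bX (2 * k)%N; have [D [N1 hD]] := bY (2 * k)%N.
exists (C + D), (maxn N0 N1) => N.
rewrite geq_max => /andP[/hC NC /hD ND].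
apply: (@le_trans _ _ (\int[P]_om
    ((`|X N om| ^+ (2 * k))%:E + (`|Y N om| ^+ (2 * k))%:E))%E).
  apply: ge0_le_integral => //.
  - by apply: measurable_moment; exact: measurable_funM.
  - by apply: emeasurable_funD; exact: measurable_moment.
  - by move=> om _; rewrite -EFinD lee_fin; exact: normrM_expr_le.
rewrite ge0_integralD//; last 2 first.
- exact: measurable_moment.
- exact: measurable_moment.
by rewrite EFinD leeD.
Qed.

Lemma bdd_moments_cst (c : nat -> R) (B : R) :
  (forall N, `|c N| <= B) -> bdd_moments (fun N _ => c N).
Proof.
move=> cB; split=> [N|k]; first exact: measurable_cst.
exists (B ^+ k), 0%N => N _; rewrite integral_cst//=.
rewrite probability_setT mule1 lee_fin lerXn2r ?nnegrE//.
exact: le_trans (cB N).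
Qed.

Lemma bdd_momentsZ (c : R) (X : nat -> T -> R) : bdd_moments X ->
  bdd_moments (fun N om => c * X N om).
Proof.
by move=> bX; apply: bdd_momentsM => //; exact: (@bdd_moments_cst (fun=> c) `|c|).
Qed.

Lemma bdd_momentsN (X : nat -> T -> R) : bdd_moments X ->
  bdd_moments (fun N om => - X N om).
Proof.
move=> /(bdd_momentsZ (-1)); congr bdd_moments.
by apply/funext => N; apply/funext => om; rewrite mulN1r.
Qed.

Lemma bdd_momentsX (X : nat -> T -> R) n : bdd_moments X ->
  bdd_moments (fun N om => X N om ^+ n).
Proof.
move=> bX; elim: n => [|n IH].
  by apply: (@bdd_moments_cst (fun=> 1) 1) => _; rewrite normr1.
rewrite (_ : (fun _ _ => _) = (fun N om => X N om * X N om ^+ n)).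
  exact: bdd_momentsM.
by apply/funext => N; apply/funext => om; rewrite exprS.
Qed.

Lemma bdd_moments_sum (J : Type) (s : seq J) (Q : pred J) (X : J -> nat -> T -> R) :
  (forall j, Q j -> bdd_moments (X j)) ->
  bdd_moments (fun N om => \sum_(j <- s | Q j) X j N om).
Proof.
move=> bX; elim: s => [|j s IH].
  rewrite (_ : (fun _ _ => _) = (fun _ _ => 0)).
    by apply: (@bdd_moments_cst (fun=> 0) 0) => _; rewrite normr0.
  by apply/funext => N; apply/funext => om; rewrite big_nil.
case Qj : (Q j).
  rewrite (_ : (fun _ _ => _) =
      (fun N om => X j N om + \sum_(j <- s | Q j) X j N om)).
    by apply: bdd_momentsD => //; exact: bX.
  by apply/funext => N; apply/funext => om; rewrite big_cons Qj.
rewrite (_ : (fun _ _ => _) = (fun N om => \sum_(j <- s | Q j) X j N om))//.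
by apply/funext => N; apply/funext => om; rewrite big_cons Qj.
Qed.

Lemma bdd_moments_norm (X : nat -> T -> R) : bdd_moments X ->
  bdd_moments (fun N om => `|X N om|).
Proof.
move=> bX; apply: (@le_bdd_moments X _ 0%N) => //.
  by move=> N; apply: measurableT_comp; [exact: normr_measurable|case: bX].
by move=> N _; apply: aeW => om; rewrite normr_id.
Qed.

Lemma all_moments_integrable X : all_moments X ->
  P.-integrable setT (fun om => (X om)%:E).
Proof.
move=> [mX /(_ 1%N)[C [N0 /(_ N0 (leqnn _)) h]]]; apply/integrableP; split.
  by apply/measurable_EFinP; exact: (mX 0%N).
apply: le_lt_trans (ltry C); apply: le_trans h.
by under eq_integral do rewrite /= -[`|X _|]expr1.
Qed.

End BoundedMoments.

Section RealExpectation.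
Context d (T : measurableType d) (R : realType) (P : probability T R).
Implicit Types X Y : T -> R.

Definition Ex X : R := \int[P]_om X om.

Lemma ExE X : all_moments P X -> (\int[P]_om (X om)%:E = (Ex X)%:E)%E.
Proof.
move=> /all_moments_integrable iX; rewrite /Ex /Rintegral fineK//.
exact: integrable_fin_num.
Qed.

Lemma ExD X Y : all_moments P X -> all_moments P Y ->
  Ex (fun om => X om + Y om) = Ex X + Ex Y.
Proof.
move=> /all_moments_integrable iX /all_moments_integrable iY.
by rewrite /Ex RintegralD.
Qed.

Lemma ExZ c X : all_moments P X -> Ex (fun om => c * X om) = c * Ex X.
Proof. by move=> /all_moments_integrable iX; rewrite /Ex RintegralZl. Qed.

Lemma ExN X : all_moments P X -> Ex (fun om => - X om) = - Ex X.
Proof.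
move=> aX; rewrite -mulN1r -ExZ//; congr Ex.
by apply/funext => om; rewrite mulN1r.
Qed.

Lemma Ex_cst c : Ex (fun=> c) = c.
Proof.
by rewrite /Ex Rintegral_cst//= probability_setT/= mulr1.
Qed.

Lemma all_moments_cst c : all_moments P (fun=> c).
Proof. exact: (@bdd_moments_cst _ _ _ P (fun=> c) `|c|). Qed.

Lemma all_momentsD X Y : all_moments P X -> all_moments P Y ->
  all_moments P (fun om => X om + Y om).
Proof. exact: bdd_momentsD. Qed.

Lemma all_momentsM X Y : all_moments P X -> all_moments P Y ->
  all_moments P (fun om => X om * Y om).
Proof. exact: bdd_momentsM. Qed.

Lemma all_momentsN X : all_moments P X -> all_moments P (fun om => - X om).
Proof. exact: bdd_momentsN. Qed.

Lemma all_momentsZ c X : all_moments P X -> all_moments P (fun om => c * X om).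
Proof. exact: bdd_momentsZ. Qed.

Lemma all_momentsX X n : all_moments P X -> all_moments P (fun om => X om ^+ n).
Proof. exact: bdd_momentsX. Qed.

Lemma all_moments_sum (J : Type) (s : seq J) (Q : pred J) (X : J -> T -> R) :
  (forall j, Q j -> all_moments P (X j)) ->
  all_moments P (fun om => \sum_(j <- s | Q j) X j om).
Proof. exact: bdd_moments_sum. Qed.

Lemma Ex_sum (J : Type) (s : seq J) (Q : pred J) (X : J -> T -> R) :
  (forall j, Q j -> all_moments P (X j)) ->
  Ex (fun om => \sum_(j <- s | Q j) X j om) = \sum_(j <- s | Q j) Ex (X j).
Proof.
move=> aX; elim: s => [|j s IH].
  rewrite big_nil -[RHS](Ex_cst 0); congr Ex.
  by apply/funext => om; rewrite big_nil.
rewrite big_cons; case Qj : (Q j); last first.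
  by rewrite -IH; congr Ex; apply/funext => om; rewrite big_cons Qj.
rewrite -IH -ExD; [|exact: aX|exact: bdd_moments_sum].
by congr Ex; apply/funext => om; rewrite big_cons Qj.
Qed.

Lemma Ex_le X Y : all_moments P X -> all_moments P Y ->
  (forall om, X om <= Y om) -> Ex X <= Ex Y.
Proof.
move=> /all_moments_integrable iX /all_moments_integrable iY XY.
by rewrite /Ex; apply: le_Rintegral.
Qed.

Lemma Ex_ge0 X : (forall om, 0 <= X om) -> 0 <= Ex X.
Proof. by move=> X0; apply: Rintegral_ge0. Qed.

Lemma all_momentsP X : measurable_fun [set: T] X ->
  (forall k, (\int[P]_om (`|X om| ^+ k)%:E < +oo)%E) -> all_moments P X.
Proof.
move=> mX fX; split=> [_//|k].
exists (fine (\int[P]_om (`|X om| ^+ k)%:E)%E), 0%N => _ _.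
rewrite fineK// ge0_fin_numE ?fX//.
by apply: integral_ge0.
Qed.

End RealExpectation.

Section IndependentProducts.
Context d (T : measurableType d) (R : realType) (P : probability T R).
Variables (I : choiceType) (g : I -> T -> R).
Hypothesis mg : forall i, measurable_fun [set: T] (g i).
Hypothesis indep_g : forall (s : seq I) (E : I -> set R), uniq s ->
  (forall i, measurable (E i)) ->
  P (\bigcap_(i in [set` s]) (g i @^-1` E i)) =
  (\prod_(i <- s) P (g i @^-1` E i))%E.

Definition measurable_wrt (J : set I) (X : T -> R) : Prop :=
  measurable_fun [set: subT g J] (X : subT g J -> R).

Section MeasurableWrt.
Variable J : set I.

Lemma measurable_wrt_cst c : measurable_wrt J (fun=> c).
Proof. exact: measurable_cst. Qed.

Lemma measurable_wrtD X Y : measurable_wrt J X -> measurable_wrt J Y ->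
  measurable_wrt J (fun om => X om + Y om).
Proof. exact: measurable_funD. Qed.

Lemma measurable_wrtM X Y : measurable_wrt J X -> measurable_wrt J Y ->
  measurable_wrt J (fun om => X om * Y om).
Proof. exact: measurable_funM. Qed.

Lemma measurable_wrtX X n : measurable_wrt J X ->
  measurable_wrt J (fun om => X om ^+ n).
Proof. exact: measurable_funX. Qed.

Lemma measurable_wrt_sum (K : Type) (s : seq K) (Q : pred K) (X : K -> T -> R) :
  (forall k, measurable_wrt J (X k)) ->
  measurable_wrt J (fun om => \sum_(k <- s | Q k) X k om).
Proof.
move=> mX; elim: s => [|k s IH].
  rewrite (_ : (fun _ => _) = fun=> 0); first exact: measurable_wrt_cst.
  by apply/funext => om; rewrite big_nil.
case Qk : (Q k); last first.
  rewrite (_ : (fun _ => _) = (fun om => \sum_(k <- s | Q k) X k om))//.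
  by apply/funext => om; rewrite big_cons Qk.
rewrite (_ : (fun _ => _) = (fun om => X k om + \sum_(k <- s | Q k) X k om)).
  exact: measurable_wrtD.
by apply/funext => om; rewrite big_cons Qk.
Qed.

Lemma measurable_wrt_g i : J i -> measurable_wrt J (g i).
Proof. exact: measurable_subT_g. Qed.

End MeasurableWrt.

Lemma measurable_wrtS (J1 J2 : set I) X : J1 `<=` J2 ->
  measurable_wrt J1 X -> measurable_wrt J2 X.
Proof. exact: measurable_subTS. Qed.

Variables J1 J2 : set I.
Hypothesis J12 : J1 `&` J2 = set0.

Let ge0_indep X Y : measurable_wrt J1 X -> measurable_wrt J2 Y ->
  (forall om, 0 <= X om) -> (forall om, 0 <= Y om) ->
  (\int[P]_om (X om * Y om)%:E =
   \int[P]_om (X om)%:E * \int[P]_om (Y om)%:E)%E.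
Proof.
move=> mX mY X0 Y0.
pose F (z : subT g J1 * subT g J2) : \bar R := ((X z.1)%:E * (Y z.2)%:E)%E.
have mF : measurable_fun setT F.
  apply: emeasurable_funM; apply/measurable_EFinP.
    exact: (measurableT_comp mX measurable_fst).
  exact: (measurableT_comp mY measurable_snd).
have F0 z : (0 <= F z)%E by rewrite mule_ge0// lee_fin.
have := decouple mg indep_g J12 mF F0.
rewrite /F /=; under eq_integral do rewrite -EFinM.
move=> ->.
have mX' : measurable_fun [set: T] (fun om => (X om)%:E).
  by apply/measurable_EFinP; exact: (measurable_subT mg mX).
have mY' : measurable_fun [set: T] (fun om => (Y om)%:E).
  by apply/measurable_EFinP; exact: (measurable_subT mg mY).
have X0' om : (0 <= (X om)%:E)%E by rewrite lee_fin.
have Y0' om : (0 <= (Y om)%:E)%E by rewrite lee_fin.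
transitivity (\int[P]_om ((X om)%:E * \int[P]_om' (Y om')%:E))%E.
  by apply: eq_integral => om _; rewrite ge0_integralZl_EFin.
by rewrite ge0_integralZr//; exact: integral_ge0.
Qed.

(** Decoupling handles nonnegative integrands, so both variables are split into positive and
    negative parts and the four products are recombined. *)
Lemma Ex_indep X Y : measurable_wrt J1 X -> measurable_wrt J2 Y ->
  all_moments P X -> all_moments P Y ->
  Ex P (fun om => X om * Y om) = Ex P X * Ex P Y.
Proof.
have pos Z : all_moments P Z -> all_moments P (fun om => (`|Z om| + Z om) / 2).
  move=> aZ; rewrite (_ : (fun _ => _) = (fun om => 2^-1 * (`|Z om| + Z om))).
    by apply: bdd_momentsZ; apply: bdd_momentsD => //; exact: bdd_moments_norm.
  by apply/funext => om; rewrite mulrC.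
have neg Z : all_moments P Z -> all_moments P (fun om => (`|Z om| - Z om) / 2).
  move=> aZ; rewrite (_ : (fun _ => _) = (fun om => 2^-1 * (`|Z om| + - Z om))).
    apply: bdd_momentsZ; apply: bdd_momentsD; first exact: bdd_moments_norm.
    exact: bdd_momentsN.
  by apply/funext => om; rewrite mulrC.
have mpos J Z : measurable_wrt J Z -> measurable_wrt J (fun om => (`|Z om| + Z om) / 2).
  move=> mZ; apply: measurable_funM => //; apply: measurable_funD => //.
  by apply: (measurableT_comp _ mZ); exact: normr_measurable.
have mneg J Z : measurable_wrt J Z -> measurable_wrt J (fun om => (`|Z om| - Z om) / 2).
  move=> mZ; apply: measurable_funM => //; apply: measurable_funB => //.
  by apply: (measurableT_comp _ mZ); exact: normr_measurable.
have pos0 Z (om : T) : 0 <= (`|Z om| + Z om) / 2 :> R.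
  by rewrite divr_ge0//; have := ler_norm (- Z om); rewrite normrN; lra.
have neg0 Z (om : T) : 0 <= (`|Z om| - Z om) / 2 :> R.
  by rewrite divr_ge0//; have := ler_norm (Z om); lra.
have key X' Y' : measurable_wrt J1 X' -> measurable_wrt J2 Y' ->
    all_moments P X' -> all_moments P Y' ->
    (forall om, 0 <= X' om) -> (forall om, 0 <= Y' om) ->
    Ex P (fun om => X' om * Y' om) = Ex P X' * Ex P Y'.
  move=> mX mY aX aY X0 Y0; apply: EFin_inj.
  by rewrite EFinM -!ExE//; [exact: ge0_indep|exact: bdd_momentsM].
move=> mX mY aX aY.
set Xp := (fun om => (`|X om| + X om) / 2); set Xn := (fun om => (`|X om| - X om) / 2).
set Yp := (fun om => (`|Y om| + Y om) / 2); set Yn := (fun om => (`|Y om| - Y om) / 2).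
have aXp : all_moments P Xp by exact: pos.
have aXn : all_moments P Xn by exact: neg.
have aYp : all_moments P Yp by exact: pos.
have aYn : all_moments P Yn by exact: neg.
have -> : X = (fun om => Xp om + - Xn om).
  by apply/funext => om; rewrite /Xp /Xn; field.
have -> : Y = (fun om => Yp om + - Yn om).
  by apply/funext => om; rewrite /Yp /Yn; field.
rewrite [in RHS]ExD ?[in RHS]ExD ?ExN//; try exact: bdd_momentsN.
have -> : (fun om => (Xp om + - Xn om) * (Yp om + - Yn om)) =
    (fun om => (Xp om * Yp om + Xn om * Yn om) +
               - (Xp om * Yn om + Xn om * Yp om)).
  by apply/funext => om; ring.
have aM U V : all_moments P U -> all_moments P V ->
  all_moments P (fun om => U om * V om) by exact: bdd_momentsM.
have kpp := key _ _ (mpos _ _ mX) (mpos _ _ mY) aXp aYp (pos0 X) (pos0 Y).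
have kpn := key _ _ (mpos _ _ mX) (mneg _ _ mY) aXp aYn (pos0 X) (neg0 Y).
have knp := key _ _ (mneg _ _ mX) (mpos _ _ mY) aXn aYp (neg0 X) (pos0 Y).
have knn := key _ _ (mneg _ _ mX) (mneg _ _ mY) aXn aYn (neg0 X) (neg0 Y).
rewrite -/Xp -/Xn -/Yp -/Yn in kpp kpn knp knn.
rewrite (ExD (bdd_momentsD (aM _ _ aXp aYp) (aM _ _ aXn aYn))
  (bdd_momentsN (bdd_momentsD (aM _ _ aXp aYn) (aM _ _ aXn aYp)))).
rewrite (ExN (bdd_momentsD (aM _ _ aXp aYn) (aM _ _ aXn aYp))).
rewrite (ExD (aM _ _ aXp aYp) (aM _ _ aXn aYn)).
rewrite (ExD (aM _ _ aXp aYn) (aM _ _ aXn aYp)).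
rewrite kpp kpn knp knn; ring.
Qed.

End IndependentProducts.

(** * Moment bounds for martingales *)

Lemma exprD_taylor (R : realDomainType) m (a b : R) :
  `|(a + b) ^+ m.+2 - a ^+ m.+2 - m.+2%:R * (a ^+ m.+1 * b)| <=
  2 ^+ m.+2 * (b ^+ 2 * (`|a| + `|b|) ^+ m).
Proof.
have b20 := sqr_ge0 b.
elim: m => [|m IH].
  rewrite expr0 mulr1 (_ : _ - _ = b ^+ 2); last by ring.
  by rewrite ger0_norm// ler_peMl// -natrX ler1n.
set r := _ - _ - _ in IH; set s := `|a| + `|b| in IH *.
have s0 : 0 <= s by rewrite addr_ge0.
(* The old remainder is multiplied by [a + b] and one new second-order term appears; each is within
   the old constant, which therefore doubles. *)
rewrite (_ : _ - _ = (a + b) * r + m.+2%:R * (a ^+ m.+1 * b ^+ 2)); last first.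
  by rewrite /r [(a + b) ^+ m.+3]exprS -[in LHS](natr1 m.+2) [a ^+ m.+3]exprS [a ^+ m.+2]exprS;
    ring.
have k1 : `|(a + b) * r| <= 2 ^+ m.+2 * (b ^+ 2 * s ^+ m.+1).
  have -> : 2 ^+ m.+2 * (b ^+ 2 * s ^+ m.+1) = s * (2 ^+ m.+2 * (b ^+ 2 * s ^+ m)).
    by rewrite (exprS s m); ring.
  by rewrite normrM ler_pM// ler_normD.
have k2 : `|m.+2%:R * (a ^+ m.+1 * b ^+ 2)| <= 2 ^+ m.+2 * (b ^+ 2 * s ^+ m.+1).
  rewrite !normrM normr_nat ler_pM ?mulr_ge0//.
    by rewrite -natrX ler_nat ltnW// ltn_expl.
  rewrite -(normrM b b) -expr2 (ger0_norm b20) mulrC ler_wpM2l// normrX lerXn2r ?nnegrE//.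
  by rewrite lerDl.
rewrite (le_trans (ler_normD _ _))// (le_trans (lerD k1 k2))//.
by rewrite (exprS _ m.+2) -mulrA mulr_natl.
Qed.

(** The Taylor remainder [b ^+ 2 * (|a| + |b|) ^+ (2 * p)] is split according to whether
    [n * b ^+ 2 <= a ^+ 2]. The weight [1 / n] on the power of [a] keeps [n] successive uses within
    a bounded factor. *)
Lemma even_exprD_le (R : realFieldType) p (n a b : R) : 1 <= n ->
  (a + b) ^+ (2 * p).+2 <= a ^+ (2 * p).+2 + (2 * p).+2%:R * (a ^+ (2 * p).+1 * b)
    + 2 ^+ (4 * p).+2 * (a ^+ (2 * p).+2 / n + n ^+ p * b ^+ (2 * p).+2).
Proof.
move=> n1; have n0 : 0 < n by exact: lt_le_trans n1.
have := exprD_taylor (2 * p) a b; rewrite ler_norml => /andP[_].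
set r := _ - _ => hr.
suff : 2 ^+ (2 * p).+2 * (b ^+ 2 * (`|a| + `|b|) ^+ (2 * p)) <=
   2 ^+ (4 * p).+2 * (a ^+ (2 * p).+2 / n + n ^+ p * b ^+ (2 * p).+2).
  by move=> /(le_trans hr); rewrite /r; lra.
have -> : 2 ^+ (4 * p).+2 = 2 ^+ (2 * p).+2 * 4 ^+ p :> R.
  have -> : 4 = 2 ^+ 2 :> R by rewrite -natrX.
  by rewrite -exprM -exprD; congr (_ ^+ _); lia.
rewrite -mulrA ler_wpM2l ?exprn_ge0//.
have ee x : x ^+ (2 * p).+2 = x ^+ 2 * (x ^+ 2) ^+ p :> R.
  by rewrite -exprM -exprD; congr (_ ^+ _); lia.
rewrite exprM !ee; set A := a ^+ 2; set B := b ^+ 2.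
have A0 : 0 <= A by exact: sqr_ge0.
have B0 : 0 <= B by exact: sqr_ge0.
have sq : (`|a| + `|b|) ^+ 2 <= 2 * (A + B).
  rewrite /A /B -(real_normK (num_real a)) -(real_normK (num_real b)).
  by have := sqr_ge0 (`|a| - `|b|); lra.
clearbody A B.
have [BA|AB] := leP (n * B) A.
  have BA' : B <= A / n by rewrite ler_pdivlMr// mulrC.
  have BA2 : B <= A by rewrite (le_trans _ BA)// ler_peMl.
  apply: (@le_trans _ _ (A / n * (4 * A) ^+ p)).
    apply: ler_pM => //.
    have A4 : 0 <= 4 * A by lra.
    rewrite lerXn2r ?nnegrE ?sqr_ge0//.
    by rewrite (le_trans sq)//; lra.
  rewrite exprMn (mulrCA _ (4 ^+ p)) ler_wpM2l ?exprn_ge0// mulrAC lerDl.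
  by rewrite !mulr_ge0 ?exprn_ge0 ?(ltW n0).
have An : A <= n * B by exact: ltW.
have Bn : B <= n * B by rewrite ler_peMl.
apply: (@le_trans _ _ (B * (4 * (n * B)) ^+ p)).
  have B4 : 0 <= 4 * (n * B) by lra.
  rewrite ler_wpM2l// lerXn2r ?nnegrE ?sqr_ge0//.
  by rewrite (le_trans sq)//; lra.
rewrite !exprMn (mulrCA B) (mulrCA B) ler_wpM2l ?exprn_ge0// lerDr.
by rewrite !mulr_ge0 ?exprn_ge0 ?invr_ge0 ?(ltW n0).
Qed.

Section Martingales.
Context d (T : measurableType d) (R : realType) (P : probability T R).
Variables (I : choiceType) (g : I -> T -> R).
Hypothesis mg : forall i, measurable_fun [set: T] (g i).
Hypothesis indep_g : forall (s : seq I) (E : I -> set R), uniq s ->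
  (forall i, measurable (E i)) ->
  P (\bigcap_(i in [set` s]) (g i @^-1` E i)) =
  (\prod_(i <- s) P (g i @^-1` E i))%E.
Local Notation Ex := (Ex P).

Variables (J1 J2 : nat -> set I) (h xi : nat -> T -> R).
Hypothesis J12 : forall t, J1 t `&` J2 t = set0.
Let M N om := \sum_(0 <= t < N) h t om * xi t om.
Hypothesis mM : forall t,
  measurable_wrt g (J1 t) (fun om => \sum_(0 <= s < t) h s om * xi s om).
Hypothesis mxi : forall t, measurable_wrt g (J1 t) (xi t).
Hypothesis mh : forall t, measurable_wrt g (J2 t) (h t).
Hypothesis ah : forall t, all_moments P (h t).
Hypothesis axi : forall t, all_moments P (xi t).
Hypothesis Eh : forall t, Ex (h t) = 0.

Let MS t : M t.+1 = (fun om => M t om + h t om * xi t om).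
Proof. by apply/funext => om; rewrite /M big_nat_recr. Qed.

Let ahxi t : all_moments P (fun om => h t om * xi t om).
Proof. exact: all_momentsM. Qed.

Let aM t : all_moments P (M t).
Proof. exact: all_moments_sum. Qed.

(** The first-order term of the expansion has mean zero, since [h t] is centred and independent of
    [M t] and [xi t]. What remains is [m' <= (1 + K / n) * m + K * n ^+ p * C] for consecutive
    moments, and [n] steps give the factor [(1 + K / n) ^+ n <= expR K]. *)
Lemma martingale_moment_le p (C : R) :
  (forall t, Ex (fun om => (h t om * xi t om) ^+ (2 * p).+2) <= C) ->
  forall N, Ex (fun om =>
      (\sum_(0 <= t < N) h t om * xi t om) ^+ (2 * p).+2) <=
    expR (2 ^+ (4 * p).+2) * (2 ^+ (4 * p).+2 * C) * N%:R ^+ p.+1.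
Proof.
move=> hC N.
change (Ex (fun om => M N om ^+ (2 * p).+2) <=
    expR (2 ^+ (4 * p).+2) * (2 ^+ (4 * p).+2 * C) * N%:R ^+ p.+1).
set K := 2 ^+ (4 * p).+2 : R.
have K0 : 0 <= K by rewrite exprn_ge0.
have C0 : 0 <= C.
  apply: le_trans (hC 0%N); apply: Ex_ge0 => om.
  by rewrite exprn_even_ge0//=; lia.
case: N => [|N'].
  rewrite expr0n/= mulr0 (_ : (fun _ => _) = fun=> 0) ?Ex_cst//.
  by apply/funext => om; rewrite /M big_geq// expr0n.
(* The weight in the recursion is the final horizon, the same at every step. *)
set n := N'.+1%:R : R.
have n1 : 1 <= n by rewrite ler1n.
have n0 : 0 < n by rewrite ltr0n.
have Kn0 : 0 <= K * n ^+ p := mulr_ge0 K0 (exprn_ge0 p (ltW n0)).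
have KnC0 : 0 <= K * n ^+ p * C := mulr_ge0 Kn0 C0.
set q := (2 * p).+2.
have step t : Ex (fun om => M t.+1 om ^+ q) <=
    (1 + K / n) * Ex (fun om => M t om ^+ q) + K * n ^+ p * C.
  have aMq : all_moments P (fun om => M t om ^+ q) by exact: all_momentsX.
  have ahx : all_moments P (fun om => (h t om * xi t om) ^+ q).
    by apply: all_momentsX; exact: all_momentsM.
  have aMx : all_moments P (fun om => M t om ^+ q.-1 * xi t om).
    by apply: all_momentsM => //; exact: all_momentsX.
  have acr : all_moments P (fun om => (M t om ^+ q.-1 * xi t om) * h t om).
    exact: all_momentsM.
  have cr0 : Ex (fun om => (M t om ^+ q.-1 * xi t om) * h t om) = 0.
    rewrite (Ex_indep mg indep_g (J12 t)) ?Eh ?mulr0//.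
    by apply: measurable_wrtM => //; exact: measurable_wrtX.
  apply: (@le_trans _ _ (Ex (fun om => (1 + K / n) * M t om ^+ q +
     (q%:R * ((M t om ^+ q.-1 * xi t om) * h t om) +
      K * n ^+ p * (h t om * xi t om) ^+ q)))).
    apply: Ex_le.
    - exact: all_momentsX.
    - apply: all_momentsD; first exact: all_momentsZ.
      by apply: all_momentsD; exact: all_momentsZ.
    - move=> om; rewrite MS.
      apply: le_trans (@even_exprD_le R p n (M t om) (h t om * xi t om) n1) _.
      rewrite -/K -/q (_ : (2 * p).+1 = q.-1)// le_eqVlt; apply/orP; left.
      have expand (a b c e y k m x r : R) : a + r * (b * (y * x)) +
          k * (a / m + e * c) = (1 + k / m) * a + (r * (b * x * y) + k * e * c).
        by ring.
      by apply/eqP; exact: expand.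
  rewrite ExD ?ExD ?ExZ ?cr0 ?mulr0 ?add0r//; try exact: all_momentsZ.
  - by rewrite lerD2l ler_wpM2l.
  - by apply: all_momentsD; exact: all_momentsZ.
have K1 : 1 <= 1 + K / n by rewrite lerDl divr_ge0// ltW.
have grow t : Ex (fun om => M t om ^+ q) <= (1 + K / n) ^+ t * (t%:R * (K * n ^+ p * C)).
  elim: t => [|t IH].
    rewrite mul0r mulr0 (_ : (fun _ => _) = fun=> 0) ?Ex_cst//.
    by apply/funext => om; rewrite /M big_geq// expr0n.
  rewrite (le_trans (step t))// -[t.+1%:R]natr1 (mulrDl t%:R) mulrDr mul1r lerD//.
    by rewrite exprS -mulrA ler_wpM2l// (le_trans _ K1).
  by rewrite ler_peMl ?exprn_ege1.
rewrite (le_trans (grow _))// -/n (exprS n p).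
have -> : expR K * (K * C) * (n * n ^+ p) = expR K * (n * (K * n ^+ p * C)).
  by move: (expR K) (n ^+ p) => x y; ring.
rewrite ler_wpM2r//; first exact: (mulr_ge0 (ltW n0) KnC0).
have -> : expR K = expR (K / n) ^+ N'.+1.
  by rewrite -expRM_natl mulrC divfK// gt_eqF.
by rewrite lerXn2r ?nnegrE ?expR_ge0 ?expR_ge1Dx// (le_trans _ K1).
Qed.

(** An arbitrary exponent [k] is reduced to an even one by [|x| ^+ k <= 1 + x ^+ (2 * k).+2]. *)
Lemma martingale_bdd_moments :
  bdd_moments P (fun t om => h t om * xi t om) ->
  bdd_moments P (fun N om =>
    (Num.sqrt N%:R)^-1 * \sum_(0 <= t < N) h t om * xi t om).
Proof.
move=> [_ bhx].
change (bdd_moments P (fun N om => (Num.sqrt N%:R)^-1 * M N om)).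
have enorm k (y : R) : `|y| ^+ (2 * k).+2 = y ^+ (2 * k).+2.
  by rewrite -normrX ger0_norm// exprn_even_ge0//=; lia.
split=> [N|k].
  by apply: measurable_funM => //; case: (aM N) => /(_ 0%N).
have [C hC] : exists C : R, forall t,
    Ex (fun om => (h t om * xi t om) ^+ (2 * k).+2) <= C.
  have [C [N0 hC]] := bhx (2 * k).+2.
  have ahx t : all_moments P (fun om => (h t om * xi t om) ^+ (2 * k).+2).
    by apply: all_momentsX; exact: ahxi.
  have e0 t : 0 <= Ex (fun om => (h t om * xi t om) ^+ (2 * k).+2).
    by apply: Ex_ge0 => om; rewrite exprn_even_ge0//=; lia.
  (* The hypothesis bounds the increments from [N0] on; the finitely many earlier moments are added
     to the constant. *)
  exists (`|C| + \sum_(t < N0) Ex (fun om => (h t om * xi t om) ^+ (2 * k).+2)) => t.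
  have [tN|Nt] := ltnP t N0.
    rewrite (bigD1 (Ordinal tN))//= addrA addrAC lerDr addr_ge0//.
    by rewrite sumr_ge0.
  apply: (@le_trans _ _ C); last first.
    by rewrite (le_trans (ler_norm C))// lerDl sumr_ge0.
  rewrite -lee_fin -ExE//; apply: le_trans (hC _ Nt).
  by under [X in (_ <= X)%E]eq_integral do rewrite enorm.
have := martingale_moment_le hC; set D := expR _ * _ => hD'.
have hD N : Ex (fun om => M N om ^+ (2 * k).+2) <= D * N%:R ^+ k.+1 by exact: hD'.
clear hD'.
have D0 : 0 <= D.
  have C0 : 0 <= C.
    apply: le_trans (hC 0%N); apply: Ex_ge0 => om.
    by rewrite exprn_even_ge0//=; lia.
  apply: mulr_ge0; first exact: expR_ge0.
  by apply: mulr_ge0 => //; exact: exprn_ge0.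
exists (1 + D), 0%N => N _.
have aN : all_moments P (fun om => (Num.sqrt N%:R)^-1 * M N om) by exact: all_momentsZ.
apply: (@le_trans _ _ (\int[P]_om (1 + ((Num.sqrt N%:R)^-1 * M N om) ^+ (2 * k).+2)%:E)%E).
  apply: ge0_le_integral => //.
  - by apply: measurable_moment; case: aN => /(_ 0%N).
  - apply/measurable_EFinP; apply: measurable_funD => //; apply: measurable_funX.
    by case: aN => /(_ 0%N).
  - move=> om _; rewrite lee_fin; set x := _ * _.
    have -> : x ^+ (2 * k).+2 = (`|x| ^+ k.+1) ^+ 2.
      by rewrite -exprM -enorm; congr (_ ^+ _); lia.
    have [x1|x1] := leP `|x| 1.
      by rewrite (le_trans (exprn_ile1 k (normr_ge0 x) x1))// lerDl sqr_ge0.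
    rewrite (@le_trans _ _ ((`|x| ^+ k.+1) ^+ 2)) ?lerDr//.
    by rewrite -exprM ler_weXn2l ?(ltW x1)//; lia.
have aq : all_moments P (fun om => ((Num.sqrt N%:R)^-1 * M N om) ^+ (2 * k).+2).
  exact: all_momentsX.
rewrite ExE; last by apply: all_momentsD => //; exact: all_moments_cst.
rewrite lee_fin ExD//; last exact: all_moments_cst.
rewrite Ex_cst lerD2l.
under [X in Ex X]eq_fun do rewrite exprMn.
rewrite ExZ; last exact: all_momentsX.
have -> : (Num.sqrt N%:R)^-1 ^+ (2 * k).+2 = N%:R ^- k.+1 :> R.
  rewrite (_ : (2 * k).+2 = (2 * k.+1)%N); last by lia.
  by rewrite exprM exprVn sqr_sqrtr// exprVn.
case: N hD {aN aq} => [|N] hD.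
  by rewrite expr0n/= invr0 mul0r.
by rewrite mulrC ler_pdivrMr ?exprn_gt0.
Qed.

End Martingales.

Section StandardNormal.
Context d (T : measurableType d) (R : realType) (P : probability T R).
Variable X : T -> R.
Hypothesis mX : measurable_fun [set: T] X.
Hypothesis lawX : forall E : set R, measurable E ->
  P (X @^-1` E) = normal_prob 0 1 E.

Lemma ge0_integral_std_normal (f : R -> \bar R) :
  measurable_fun [set: measurableTypeR R] f -> (forall x, 0 <= f x)%E ->
  (\int[P]_om f (X om) = \int[normal_prob 0 1]_x f x)%E.
Proof.
move=> mf f0.
transitivity (\int[pushforward P (X : T -> measurableTypeR R)]_x f x)%E.
  by rewrite ge0_integral_pushforward.
by apply: eq_measure_integral => E mE _; exact: lawX.
Qed.

Lemma all_moments_std_normal : all_moments P X.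
Proof.
apply: all_momentsP => // k.
rewrite (@ge0_integral_std_normal (fun x => (`|x| ^+ k)%:E)).
- exact: normal_prob_moment_lty.
- apply/measurable_EFinP; apply: measurable_funX; exact: normr_measurable.
- by move=> x; rewrite lee_fin exprn_ge0.
Qed.

Lemma Ex_std_normal : Ex P X = 0.
Proof.
apply: EFin_inj; rewrite -ExE; last exact: all_moments_std_normal.
rewrite -[RHS]normal_prob_mean.
transitivity (\int[pushforward P (X : T -> measurableTypeR R)]_x x%:E)%E.
  rewrite integral_pushforward//.
    exact: (all_moments_integrable all_moments_std_normal).
by apply: eq_measure_integral => E mE _; exact: lawX.
Qed.

Lemma Ex_sqr_std_normal : Ex P (fun om => X om ^+ 2) = 1.
Proof.
apply: EFin_inj; rewrite -ExE; last first.
  exact: all_momentsX all_moments_std_normal.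
rewrite -[RHS]normal_prob_variance.
rewrite (@ge0_integral_std_normal (fun x => (x ^+ 2)%:E))//.
  by apply/measurable_EFinP; apply: measurable_funX; exact: measurable_id.
by move=> x; rewrite lee_fin sqr_ge0.
Qed.

Lemma invsqrt_std_normal (a s : R) :
  (\int[P]_om invsqrt (a + s * X om) <= 9%:E * invsqrt s)%E.
Proof.
rewrite (@ge0_integral_std_normal (fun x => invsqrt (a + s * x))).
- exact: invsqrt_normal_prob.
- apply: measurableT_comp; first exact: measurable_invsqrt.
  by apply: measurable_funD => //; apply: measurable_funM => //.
- by move=> x; exact: invsqrt_ge0.
Qed.

End StandardNormal.

(** * Matrix norms and the spectral radius *)

Section EntrywiseNorm.
Variable R : realType.

(** The entrywise sum is submultiplicative for rectangular matrices too, and entrywise moment bounds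
    pass to it directly. *)
Definition nm m n (M : 'M[R]_(m, n)) : R := \sum_i \sum_j `|M i j|.

Definition sqF m n (M : 'M[R]_(m, n)) : R := \sum_i \sum_j M i j ^+ 2.

Lemma nm_ge0 m n (M : 'M[R]_(m, n)) : 0 <= nm M.
Proof. by apply: sumr_ge0 => i _; apply: sumr_ge0. Qed.

Lemma sqF_ge0 m n (M : 'M[R]_(m, n)) : 0 <= sqF M.
Proof. by apply: sumr_ge0 => i _; apply: sumr_ge0 => j _; exact: sqr_ge0. Qed.

Lemma normF_sqr m n (M : 'M[R]_(m, n)) : normF M ^+ 2 = sqF M.
Proof. by rewrite /normF sqr_sqrtr// sqF_ge0. Qed.

Lemma le_nm_entry m n (M : 'M[R]_(m, n)) i j : `|M i j| <= nm M.
Proof.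
rewrite /nm (bigD1 i)//= (bigD1 j)//= -addrA lerDl addr_ge0//.
  by apply: sumr_ge0.
by apply: sumr_ge0 => k _; apply: sumr_ge0.
Qed.

Lemma nm0 m n : nm (0 : 'M[R]_(m, n)) = 0.
Proof. by rewrite /nm big1// => i _; rewrite big1// => j _; rewrite mxE normr0. Qed.

Lemma nmD m n (M N : 'M[R]_(m, n)) : nm (M + N) <= nm M + nm N.
Proof.
rewrite /nm -big_split/=; apply: ler_sum => i _.
rewrite -big_split/=; apply: ler_sum => j _.
by rewrite mxE ler_normD.
Qed.

Lemma nmN m n (M : 'M[R]_(m, n)) : nm (- M) = nm M.
Proof. by apply: eq_bigr => i _; apply: eq_bigr => j _; rewrite mxE normrN. Qed.

Lemma nmB m n (M N : 'M[R]_(m, n)) : nm (M - N) <= nm M + nm N.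
Proof. by rewrite -(nmN N); exact: nmD. Qed.

Lemma nmZ m n c (M : 'M[R]_(m, n)) : nm (c *: M) = `|c| * nm M.
Proof.
rewrite /nm mulr_sumr; apply: eq_bigr => i _; rewrite mulr_sumr.
by apply: eq_bigr => j _; rewrite mxE normrM.
Qed.

Lemma nm_tr m n (M : 'M[R]_(m, n)) : nm M^T = nm M.
Proof.
rewrite /nm exchange_big/=; apply: eq_bigr => i _; apply: eq_bigr => j _.
by rewrite mxE.
Qed.

Lemma nmM m n p (M : 'M[R]_(m, n)) (N : 'M[R]_(n, p)) :
  nm (M *m N) <= nm M * nm N.
Proof.
rewrite /nm mulr_suml; apply: ler_sum => i _.
apply: (@le_trans _ _ (\sum_k \sum_j `|M i j| * `|N j k|)).
  apply: ler_sum => k _; rewrite mxE (le_trans (ler_norm_sum _ _ _))//.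
  by apply: ler_sum => j _; rewrite normrM.
rewrite exchange_big/= mulr_suml; apply: ler_sum => j _.
rewrite -mulr_sumr ler_wpM2l// (bigD1 j)//= lerDl.
by apply: sumr_ge0 => k _; apply: sumr_ge0.
Qed.

Lemma nm_sum m n (I : Type) (s : seq I) (Q : pred I) (F : I -> 'M[R]_(m, n)) :
  nm (\sum_(i <- s | Q i) F i) <= \sum_(i <- s | Q i) nm (F i).
Proof.
apply: (big_ind2 (fun M x => nm M <= x)) => //; first by rewrite nm0.
by move=> M x N y hM hN; rewrite (le_trans (nmD _ _))// lerD.
Qed.

Lemma sqFE m n (M : 'M[R]_(m, n)) : sqF M = \tr (M *m M^T).
Proof.
rewrite /sqF /mxtrace; apply: eq_bigr => i _; rewrite mxE.
by apply: eq_bigr => j _; rewrite mxE expr2.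
Qed.

Lemma normr_mxtrace_le m n (M : 'M[R]_(m, n)) (N : 'M[R]_(n, m)) :
  `|\tr (M *m N)| <= nm M * nm N.
Proof.
rewrite (le_trans _ (nmM M N))// /mxtrace (le_trans (ler_norm_sum _ _ _))//.
apply: ler_sum => i _; rewrite (bigD1 i)//= lerDl.
by apply: sumr_ge0.
Qed.

Lemma sqF_le m n (M : 'M[R]_(m, n)) : sqF M <= nm M ^+ 2.
Proof.
by rewrite sqFE expr2 (le_trans (ler_norm _))// -[X in _ <= _ * X]nm_tr normr_mxtrace_le.
Qed.

Lemma sqr_sum_normr_le (J : finType) (a : J -> R) :
  (\sum_j `|a j|) ^+ 2 <= #|J|%:R * \sum_j a j ^+ 2.
Proof.
set S := \sum_j a j ^+ 2.
rewrite expr2 mulr_suml.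
apply: (@le_trans _ _ (\sum_p \sum_q (a p ^+ 2 / 2 + a q ^+ 2 / 2))).
  apply: ler_sum => p _; rewrite mulr_sumr; apply: ler_sum => q _.
  rewrite -(real_normK (num_real (a p))) -(real_normK (num_real (a q))).
  by have := sqr_ge0 (`|a p| - `|a q|); lra.
have inner p : \sum_q (a p ^+ 2 / 2 + a q ^+ 2 / 2) =
    #|J|%:R * (a p ^+ 2 / 2) + S / 2.
  by rewrite big_split/= sumr_const -mulr_suml mulr_natl.
under eq_bigr do rewrite inner.
rewrite big_split/= sumr_const -mulr_sumr -mulr_suml -/S -[X in _ + X]mulr_natl.
by rewrite -mulrDr -splitr.
Qed.

Lemma nm_sqr_le m n (M : 'M[R]_(m, n)) : nm M ^+ 2 <= (m * n)%:R * sqF M.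
Proof.
rewrite /nm /sqF !pair_bigA/=.
have := @sqr_sum_normr_le ('I_m * 'I_n)%type (fun p => M p.1 p.2).
by rewrite card_prod !card_ord.
Qed.

Lemma sqFD_dist m n (M N : 'M[R]_(m, n)) :
  `|sqF (M + N) - sqF M| <= 2 * (nm M * nm N) + nm N ^+ 2.
Proof.
have -> : sqF (M + N) - sqF M = 2 * \tr (M *m N^T) + sqF N.
  rewrite !sqFE raddfD/= mulmxDl !mulmxDr !raddfD/=.
  by rewrite -(mxtrace_tr (N *m M^T)) trmx_mul trmxK; ring.
rewrite (le_trans (ler_normD _ _))// lerD//.
  by rewrite normrM ger0_norm// ler_wpM2l// -(nm_tr N) normr_mxtrace_le.
by rewrite ger0_norm ?sqF_ge0// sqF_le.
Qed.

Lemma sqF_eq0 m n (M : 'M[R]_(m, n)) : sqF M = 0 -> M = 0.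
Proof.
move=> M0; have n0 : nm M = 0.
  apply/eqP; rewrite -sqrf_eq0 eq_le sqr_ge0 andbT.
  by rewrite (le_trans (nm_sqr_le _))// M0 mulr0.
apply/matrixP => i j; rewrite [RHS]mxE; apply/eqP.
by rewrite -normr_le0 -n0 le_nm_entry.
Qed.

End EntrywiseNorm.

Section SpectralRadius.
Variable R : realType.
Import ComplexField.

(** The gap [rho - r] absorbs the forcing term: [C'] is chosen with [|C| <= C' * (rho - r)], so no
    polynomial factor in [k] appears. *)
Lemma geometric_recursion (a : nat -> R) (C r rho : R) : 0 <= r -> r < rho ->
  (forall k, 0 <= a k) -> (forall k, a k.+1 <= r * a k + C * rho ^+ k) ->
  exists C', forall k, a k <= C' * rho ^+ k.
Proof.
move=> r0 rrho a0 aS; have rho0 : 0 < rho by exact: le_lt_trans rrho.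
have d0 : 0 < rho - r by rewrite subr_gt0.
exists (a 0%N + `|C| / (rho - r)); set C' := _ + _.
have C'1 : `|C| <= C' * (rho - r).
  by rewrite /C' mulrDl divfK ?gt_eqF// lerDr mulr_ge0// ltW.
elim=> [|k IH]; first by rewrite expr0 mulr1 lerDl divr_ge0// ltW.
have rk0 : 0 <= rho ^+ k by rewrite exprn_ge0// ltW.
apply: le_trans (aS k) _.
apply: (@le_trans _ _ (r * (C' * rho ^+ k) + C' * (rho - r) * rho ^+ k)).
  rewrite lerD ?ler_wpM2l// ler_wpM2r//.
  exact: le_trans (ler_norm C) C'1.
by rewrite exprS le_eqVlt; apply/orP; left; apply/eqP; ring.
Qed.

(** Cayley-Hamilton in place of the Jordan form: the product of all factors [Ac - z] vanishes, and
    the factors are removed one at a time. The rate [rho] lies strictly between the spectral radius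
    and 1. *)
Lemma spectral_radius_geometric n (A : 'M[R]_n) : spectral_radius A < 1 ->
  exists C rho, [/\ 0 <= rho, rho < 1 & forall k, nm (A ^+ k) <= C * rho ^+ k].
Proof.
case: n A => [|n] A srA.
  exists 0, 0; split=> // k; rewrite mul0r.
  by rewrite /nm big_ord0.
pose Ac := map_mx (real_complex R) A.
have [rs rsE] := closed_field_poly_normal (char_poly Ac).
move: rsE; rewrite (monicP (char_poly_monic _)) scale1r => rsE.
have ub z : z \in rs -> Normc.normc z <= spectral_radius A.
  move=> zrs; apply: ub_le_sup; last first.
    exists z => //=; rewrite eigenvalue_root_char -/Ac rsE root_prod_XsubC//.
  exists (\sum_(y <- rs) Normc.normc y) => _ [y /= yA <-].
  have : y \in rs by rewrite -root_prod_XsubC -rsE -eigenvalue_root_char.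
  move=> /(big_rem _) ->/=; rewrite lerDl; apply: sumr_ge0 => w _.
  by case: w => ? ?; rewrite sqrtr_ge0.
pose r := Num.max 0 (spectral_radius A).
have r1 : r < 1 by rewrite /r gt_max ltr01.
pose rho := (1 + r) / 2.
have r0 : 0 <= r by rewrite /r le_max lexx.
have rrho : r < rho by rewrite /rho; lra.
have rho1 : rho < 1 by rewrite /rho; lra.
have normc0 (w : R[i]) : 0 <= Normc.normc w by case: w => ? ?; rewrite sqrtr_ge0.
(* If [Ac ^+ k * (Ac - z) * Y] decays like [rho ^+ k], the entries of [Ac ^+ k * Y] satisfy a scalar
   recursion with multiplier [z] and that forcing term, to which [geometric_recursion] applies. *)
have peel (s : seq R[i]) (B : 'M[R[i]]_n.+1) : (forall z, z \in s -> Normc.normc z <= r) ->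
    (forall i j, exists C, forall k, Normc.normc ((Ac ^+ k *
       (horner_mx Ac (\prod_(z <- s) ('X - z%:P)) * B)) i j) <= C * rho ^+ k) ->
    forall i j, exists C, forall k, Normc.normc ((Ac ^+ k * B) i j) <= C * rho ^+ k.
  elim: s B => [|z s IH] B sr hB i j.
    have [C hC] := hB i j; exists C => k; have := hC k.
    by rewrite big_nil rmorph1 mul1r.
  apply: IH => [w ws|i' j']; first by apply: sr; rewrite inE ws orbT.
  have [C hC] := hB i' j'.
  apply: (geometric_recursion (r := Normc.normc z) (C := C)) => //.
    by apply: le_lt_trans rrho; apply: sr; rewrite inE eqxx.
  move=> k; have := hC k.
  set Bs := horner_mx Ac (\prod_(y <- s) ('X - y%:P)) * B.
  rewrite big_cons rmorphM/= -mulrA rmorphB/= horner_mx_X horner_mx_C -/Bs.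
  have zE : Ac ^+ k * (z%:M * Bs) = z *: (Ac ^+ k * Bs).
    by rewrite -!mulmxE mul_scalar_mx -scalemxAr.
  rewrite mulrBl mulrBr mulrA -exprSr zE.
  move: (Ac ^+ k.+1 * Bs) (Ac ^+ k * Bs) => X Y h.
  have -> : X i' j' = z * Y i' j' + (X - z *: Y) i' j'.
    have -> : (X - z *: Y) i' j' = X i' j' - z * Y i' j' by rewrite !mxE.
    ring.
  by apply: le_trans (@le_normcD R _ _) _; rewrite Normc.normcM lerD.
have ent i j : exists C, forall k, Normc.normc ((Ac ^+ k * 1) i j) <= C * rho ^+ k.
  apply: (peel rs) => [z zrs|i' j']; first by rewrite /r le_max ub// orbT.
  exists 0 => k; rewrite -rsE Cayley_Hamilton mul0r mulr0 mxE Normc.normc0 mul0r//.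
have entA i j : exists C, forall k, `|(A ^+ k) i j| <= C * rho ^+ k.
  have [C hC] := ent i j; exists C => k; have := hC k.
  have -> : Ac ^+ k = map_mx (real_complex R) (A ^+ k) by rewrite rmorphXn.
  rewrite mulr1 mxE /=.
  by rewrite expr0n/= addr0 sqrtr_sqr.
pose CC i j := xget 0 [set C | forall k, `|(A ^+ k) i j| <= C * rho ^+ k].
have hCC i j k : `|(A ^+ k) i j| <= CC i j * rho ^+ k.
  rewrite /CC; case: xgetP => [C _ //|none]; exfalso.
  by have [C hC] := entA i j; apply: (none C).
exists (\sum_i \sum_j CC i j), rho; split => //; first by rewrite ltW// (le_lt_trans r0).
move=> k; rewrite /nm mulr_suml; apply: ler_sum => i _; rewrite mulr_suml.
by apply: ler_sum => j _.
Qed.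

Lemma spectral_radius_expr_small n (A : 'M[R]_n) : spectral_radius A < 1 ->
  forall e : R, 0 < e -> exists N, forall k, (N <= k)%N -> nm (A ^+ k) <= e.
Proof.
move=> /spectral_radius_geometric[C [rho [rho0 rho1 hC]]] e e0.
have : (fun k => C * rho ^+ k) @ \oo --> C * 0.
  by apply: cvgMr; apply: cvg_expr; rewrite ger0_norm.
rewrite mulr0 => /cvgrPdist_le/(_ _ e0)[N _ hN]; exists N => k Nk.
rewrite (le_trans (hC _))// (le_trans (ler_norm _))//.
by have := hN _ Nk; rewrite sub0r normrN.
Qed.

Lemma spectral_radius_pow_small n (A : 'M[R]_n) : spectral_radius A < 1 ->
  forall e : R, 0 < e -> exists m, nm (A ^+ m.+1) <= e.
Proof.
by move=> rhoA e /(spectral_radius_expr_small rhoA)[N hN]; exists N; exact: hN.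
Qed.

End SpectralRadius.

(** * Moments of the state and of the empirical covariances *)

Section UniformMoments.
Context d (T : measurableType d) (R : realType) (P : probability T R).

Lemma bdd_moments_unif (X : nat -> T -> R) k : bdd_moments P X ->
  (forall t, all_moments P (X t)) ->
  exists C, forall t, Ex P (fun om => `|X t om| ^+ k) <= C.
Proof.
move=> [_ /(_ k)[C [N0 hC]]] aX.
have aXk t : all_moments P (fun om => `|X t om| ^+ k).
  by apply: all_momentsX; apply: bdd_moments_norm; exact: aX.
have e0 t : 0 <= Ex P (fun om => `|X t om| ^+ k).
  by apply: Ex_ge0 => om; exact: exprn_ge0.
exists (`|C| + \sum_(t < N0) Ex P (fun om => `|X t om| ^+ k)) => t.
have [tN|Nt] := ltnP t N0.
  by rewrite (bigD1 (Ordinal tN))//= addrA addrAC lerDr addr_ge0// sumr_ge0.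
apply: (@le_trans _ _ C); first by rewrite -lee_fin -ExE// hC.
by rewrite (le_trans (ler_norm C))// lerDl sumr_ge0.
Qed.

Lemma bdd_moments_shift (X : nat -> T -> R) k : bdd_moments P X ->
  bdd_moments P (fun t => X (t + k)%N).
Proof.
move=> [mX bX]; split=> [N//|p]; have [C [N0 hC]] := bX p.
by exists C, N0 => N NN; apply: hC; rewrite (leq_trans NN)// leq_addr.
Qed.

End UniformMoments.

Section SigmaClosure.
Context (T : pointedType).

Lemma g_sigma_fin_bigcap (G : set_system T) (J : choiceType) (s : seq J)
    (F : J -> set T) : (forall j, j \in s -> <<s G >> (F j)) ->
  <<s G >> (\bigcap_(j in [set` s]) F j).
Proof.
move=> sF.
have := @fin_bigcap_measurable _ (g_sigma_algebraType G) J [set` s] F.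
by apply; [exact: finite_seq|move=> j js; exact: sF].
Qed.

End SigmaClosure.

(** * The noises and inputs as one independent family of scalars *)

Section Noise.
Context d (T : measurableType d) (R : realType) (P : probability T R).
Variables (dx du : nat).
Variables (w : nat -> T -> 'cV[R]_dx) (u : nat -> T -> 'cV[R]_du).

Definition noise (i : nat * 'I_(dx + du)) (om : T) : R :=
  col_mx (w i.1 om) (u i.1 om) i.2 0.

Hypothesis iidw : iid_std_normal P w.
Hypothesis iidu : iid_std_normal P u.
Hypothesis indep_wu : independent_pair P (sigma_seq w) (sigma_seq u).

Lemma noise_l t i : noise (t, lshift du i) = fun om => w t om i 0.
Proof. by apply/funext => om; rewrite /noise col_mxEu. Qed.

Lemma noise_r t j : noise (t, rshift dx j) = fun om => u t om j 0.
Proof. by apply/funext => om; rewrite /noise col_mxEd. Qed.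

Lemma measurable_noise i : measurable_fun [set: T] (noise i).
Proof.
case: i => t e; rewrite -(splitK e); case: (fintype.split e) => [i|j] /=.
  by rewrite noise_l; have [mw _ _] := iidw.1 t; exact: mw.
by rewrite noise_r; have [mu _ _] := iidu.1 t; exact: mu.
Qed.

Lemma noise_law i (E : set R) : measurable E ->
  P (noise i @^-1` E) = normal_prob 0 1 E.
Proof.
case: i => t e mE; rewrite -(splitK e); case: (fintype.split e) => [i|j] /=.
  by rewrite noise_l; have [_ lw _] := iidw.1 t; exact: lw.
by rewrite noise_r; have [_ lu _] := iidu.1 t; exact: lu.
Qed.

Let iid_rect n (v : nat -> T -> 'cV[R]_n) (m : nat) (F : nat -> 'I_n -> set R) :
  iid_std_normal P v -> (forall t i, measurable (F t i)) ->
  let W := \bigcap_(t in [set` iota 0 m]) \bigcap_(i in [set` enum 'I_n])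
      ((fun om => v t om i 0) @^-1` F t i) in
  sigma_seq v W /\
  P W = (\prod_(t <- iota 0 m) \prod_(i <- enum 'I_n)
           P ((fun om => v t om i 0%R) @^-1` F t i))%E.
Proof.
move=> [stdv indv] mF W.
have s1 t i : sigma_rv (fun om => v t om i 0) ((fun om => v t om i 0) @^-1` F t i).
  by exists (F t i) => //; rewrite setTI.
have s2 t : sigma_vec (v t) (\bigcap_(i in [set` enum 'I_n])
      ((fun om => v t om i 0) @^-1` F t i)).
  apply: g_sigma_fin_bigcap => i _; apply: sub_sigma_algebra.
  by exists i => //; exact: s1.
split.
  apply: g_sigma_fin_bigcap => t _; apply: sub_sigma_algebra.
  by exists t => //; exact: s2.
rewrite /W indv ?iota_uniq//; apply: eq_bigr => t _.
by have [_ _ ->//] := stdv t; exact: enum_uniq.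
Qed.

(** Coordinates outside [s] receive the full set, which turns the event into a complete rectangle
    over all times below [m]. It factors into a [w] part and a [u] part, then over times, then over
    coordinates; the added factors are 1. *)
Lemma noise_indep (s : seq (nat * 'I_(dx + du))) (E : _ -> set R) : uniq s ->
  (forall i, measurable (E i)) ->
  P (\bigcap_(i in [set` s]) (noise i @^-1` E i)) =
  (\prod_(i <- s) P (noise i @^-1` E i))%E.
Proof.
move=> us mE; pose F i := if i \in s then E i else setT.
have mF i : measurable (F i) by rewrite /F; case: ifP.
pose m := (\sum_(i <- s) i.1).+1%N.
have sm i : i \in s -> (i.1 < m)%N.
  by move=> si; rewrite /m ltnS (big_rem i si)/= leq_addr.
have [sW PW] := @iid_rect dx w m (fun t i => F (t, lshift du i)) iidw
  (fun t i => mF _).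
have [sU PU] := @iid_rect du u m (fun t i => F (t, rshift dx i)) iidu
  (fun t i => mF _).
set W := \bigcap_(t in _) _ in sW PW; set U := \bigcap_(t in _) _ in sU PU.
have -> : \bigcap_(i in [set` s]) (noise i @^-1` E i) = W `&` U.
  apply/seteqP; split => [om h|om [hW hU]].
    split=> t /= _ i /= _; rewrite /F; case: ifP => // si.
      by have := h _ si; rewrite /= noise_l.
    by have := h _ si; rewrite /= noise_r.
  move=> [t e] /= si; have := sm _ si => /= tm.
  have ti : t \in iota 0 m by rewrite mem_iota.
  move: si; rewrite -(splitK e); case: (fintype.split e) => [i|j] /= si.
    by have := hW t ti i; rewrite /= mem_enum /F si noise_l; apply.
  by have := hU t ti j; rewrite /= mem_enum /F si noise_r; apply.
rewrite indep_wu// PW PU -big_split/=.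
pose r := [seq (t, e) | t <- iota 0 m, e <- enum 'I_(dx + du)].
have ur : uniq r.
  apply: allpairs_uniq; [exact: iota_uniq|exact: enum_uniq|].
  by move=> [a b] [c e] _ _ [-> ->].
transitivity (\prod_(i <- r) P (noise i @^-1` F i))%E.
  rewrite big_allpairs; apply: eq_bigr => t _.
  rewrite !big_enum/= big_split_ord/=; congr (_ * _)%E; apply: eq_bigr => i _.
    by rewrite noise_l.
  by rewrite noise_r.
transitivity (\prod_(i <- r | i \in s) P (noise i @^-1` F i))%E.
  apply/esym; apply: big_rmcond_in => i _ /negbTE si.
  by rewrite /F si preimage_setT probability_setT.
rewrite -[LHS]big_filter (perm_big s)/=.
  by apply: eq_big_seq => i si; rewrite /F si.
apply: uniq_perm => //; first exact: filter_uniq.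
move=> i; rewrite mem_filter andbC; case si : (i \in s); last by rewrite andbF.
rewrite andbT; apply/allpairsP; exists i; rewrite mem_iota mem_enum; split=> //.
  exact: (sm _ si).
by case: (i).
Qed.

End Noise.

Section NoisySystem.
Context d (T : measurableType d) (R : realType) (P : probability T R).
Variables (n p : nat) (A : 'M[R]_n) (F : 'M[R]_(n, p)).
Variable g : nat * 'I_p -> T -> R.
Hypothesis mg : forall i, measurable_fun [set: T] (g i).
Hypothesis lawg : forall i (E : set R), measurable E ->
  P (g i @^-1` E) = normal_prob 0 1 E.
Hypothesis indep_g : forall (s : seq (nat * 'I_p)) (E : _ -> set R), uniq s ->
  (forall i, measurable (E i)) ->
  P (\bigcap_(i in [set` s]) (g i @^-1` E i)) =
  (\prod_(i <- s) P (g i @^-1` E i))%E.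

Definition noise_vec t om : 'cV[R]_p := \col_e g (t, e) om.
Local Notation nu := noise_vec.

Definition traj om t : 'cV[R]_n := lin_traj A (fun s => F *m nu s om) 0 t.

Definition past t : set (nat * 'I_p) := [set i | (i.1 < t)%N].

Lemma all_moments_g i : all_moments P (g i).
Proof. exact: all_moments_std_normal (mg i) (lawg i). Qed.

Lemma bdd_moments_g e : bdd_moments P (fun t => g (t, e)).
Proof.
split=> [t|k]; first exact: mg.
have [_ /(_ k)[C [N0 /(_ N0 (leqnn _)) hC]]] := all_moments_g (0%N, e).
have mk : measurable_fun [set: measurableTypeR R] (fun x : R => (`|x| ^+ k)%:E).
  by apply/measurable_EFinP; apply: measurable_funX; exact: normr_measurable.
have k0 (x : R) : (0 <= (`|x| ^+ k)%:E :> \bar R)%E by rewrite lee_fin exprn_ge0.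
exists C, 0%N => N _; apply: le_trans hC; rewrite le_eqVlt; apply/orP; left.
apply/eqP; rewrite (ge0_integral_std_normal (mg _) (lawg _) mk k0).
by rewrite (ge0_integral_std_normal (mg _) (lawg _) mk k0).
Qed.

Lemma traj_wrt t i : measurable_wrt g (past t) (fun om => traj om t i 0).
Proof.
elim: t i => [|t IH] i.
  rewrite (_ : (fun _ => _) = fun=> 0); first exact: measurable_wrt_cst.
  by apply/funext => om; rewrite mxE.
rewrite (_ : (fun _ => _) = (fun om => \sum_j A i j * traj om t j 0 +
    \sum_e F i e * g (t, e) om)); last first.
  apply/funext => om; rewrite /traj /= mxE !mxE; congr (_ + _).
  by apply: eq_bigr => e _; rewrite mxE.
apply: measurable_wrtD; apply: measurable_wrt_sum => j.
- apply: measurable_wrtM; first exact: measurable_wrt_cst.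
  by apply: measurable_wrtS (IH j) => -[s e] /=; rewrite /past/= => /ltnW.
- apply: measurable_wrtM; first exact: measurable_wrt_cst.
  by apply: measurable_wrt_g; rewrite /past/=.
Qed.

Lemma all_moments_traj t i : all_moments P (fun om => traj om t i 0).
Proof.
elim: t i => [|t IH] i.
  rewrite (_ : (fun _ => _) = fun=> 0); first exact: all_moments_cst.
  by apply/funext => om; rewrite mxE.
rewrite (_ : (fun _ => _) = (fun om => \sum_j A i j * traj om t j 0 +
    \sum_e F i e * g (t, e) om)); last first.
  apply/funext => om; rewrite /traj /= mxE !mxE; congr (_ + _).
  by apply: eq_bigr => e _; rewrite mxE.
apply: all_momentsD; apply: all_moments_sum => j _; apply: all_momentsZ => //.
exact: all_moments_g.
Qed.

Lemma bdd_moments_nm m q (X : nat -> T -> 'M[R]_(m, q)) :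
  (forall i j, bdd_moments P (fun t om => X t om i j)) ->
  bdd_moments P (fun t om => nm (X t om)).
Proof.
move=> bX; apply: bdd_moments_sum => i _; apply: bdd_moments_sum => j _.
exact: bdd_moments_norm.
Qed.

Lemma bdd_moments_nm_noise : bdd_moments P (fun t om => nm (nu t om)).
Proof.
apply: bdd_moments_nm => i j; rewrite (_ : (fun _ _ => _) = (fun t => g (t, i))).
  exact: bdd_moments_g.
by apply/funext => t; apply/funext => om; rewrite mxE.
Qed.

Lemma all_moments_nm_traj t : all_moments P (fun om => nm (traj om t)).
Proof.
apply: (@bdd_moments_nm _ _ (fun=> (traj^~ t))) => i j; rewrite ord1.
exact: all_moments_traj.
Qed.

Lemma traj_shift om t k : traj om (t + k) =
  A ^+ k *m traj om t + lin_traj A (fun s => F *m nu (t + s)%N om) 0 k.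
Proof.
elim: k => [|k IH]; first by rewrite addn0 expr0 mul1mx addr0.
rewrite addnS {1}/traj /= -/(traj om (t + k)) IH mulmxDr -addrA.
by rewrite exprS mulmxA.
Qed.

Lemma nm_lin_traj_le (v : nat -> 'cV[R]_n) k :
  nm (lin_traj A v 0 k) <= (1 + nm A) ^+ k * \sum_(s < k) nm (v s).
Proof.
have A0 := nm_ge0 A.
elim: k => [|k IH]; first by rewrite big_ord0 mulr0 /= nm0.
rewrite big_ord_recr/= (le_trans (nmD _ _))// mulrDr lerD//.
  rewrite (le_trans (nmM _ _))// exprS -mulrA.
  apply: (@le_trans _ _ (nm A * ((1 + nm A) ^+ k * \sum_(s < k) nm (v s)))).
    by rewrite ler_wpM2l.
  rewrite ler_wpM2r ?lerDr// mulr_ge0 ?exprn_ge0 ?addr_ge0// sumr_ge0// => s _.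
  exact: nm_ge0.
by rewrite ler_peMl ?nm_ge0// exprn_ege1// lerDl.
Qed.

Hypothesis A_stable : forall e : R, 0 < e -> exists m, nm (A ^+ m.+1) <= e.

(** Convexity of the power at the midpoint of [a] and [2 * b]. Unlike the crude bound on powers of
    sums, it keeps the contraction factor 1/2 on [a ^+ k]. *)
Lemma expr_half_le k (a b : R) : 0 <= a -> 0 <= b ->
  (a / 2 + b) ^+ k <= a ^+ k / 2 + (2 * b) ^+ k.
Proof.
move=> a0 b0; have b2 : 0 <= 2 * b by lra.
suff : (a / 2 + b) ^+ k <= a ^+ k / 2 + (2 * b) ^+ k / 2.
  by have := exprn_ge0 k b2; lra.
elim: k => [|k IH]; first by rewrite !expr0; lra.
have same_sign : 0 <= (a - 2 * b) * (a ^+ k - (2 * b) ^+ k).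
  have [ab|ba] := leP a (2 * b).
    by rewrite mulr_le0// subr_le0// lerXn2r ?nnegrE.
  by rewrite mulr_ge0// subr_ge0 ?lerXn2r ?nnegrE// ltW.
move: IH same_sign; rewrite !exprS.
move: (_ ^+ k) ((2 * b) ^+ k) (a ^+ k) => z y x zxy xy.
apply: (@le_trans _ _ ((a / 2 + b) * (x / 2 + y / 2))).
  by rewrite ler_wpM2l//; lra.
lra.
Qed.

(** Over [K] steps, with [K] such that [A ^+ K] has norm at most 1/2, the state is halved up to a
    noise term with bounded moments. The moments then satisfy [m' <= m / 2 + D], and [C0 + 2 * D],
    where [C0] covers the first [K] times, is preserved. *)
Lemma bdd_moments_traj i : bdd_moments P (fun t om => traj om t i 0).
Proof.
suff bx : bdd_moments P (fun t om => nm (traj om t)).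
  apply: (@le_bdd_moments _ _ _ _ _ _ 0%N bx).
    by move=> N; case: (all_moments_traj N i) => /(_ 0%N).
  move=> N _; apply: aeW => om /=; rewrite (ger0_norm (nm_ge0 _)).
  exact: le_nm_entry.
have mnx t : measurable_fun [set: T] (fun om => nm (traj om t)).
  by case: (all_moments_nm_traj t) => /(_ 0%N).
have [m Am] : exists m, nm (A ^+ m.+1) <= 2^-1 by apply: A_stable; lra.
pose K := m.+1.
pose c := (1 + nm A) ^+ K * nm F.
have c0 : 0 <= c by rewrite mulr_ge0 ?nm_ge0// exprn_ge0// addr_ge0// nm_ge0.
pose b t om := c * \sum_(s < K) nm (nu (t + s)%N om).
have b0 t om : 0 <= b t om.
  by rewrite mulr_ge0// sumr_ge0// => s _; exact: nm_ge0.
have bb : bdd_moments P b.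
  apply: bdd_momentsZ; apply: bdd_moments_sum => s _.
  exact: (bdd_moments_shift s bdd_moments_nm_noise).
have ab t : all_moments P (b t).
  apply: all_momentsZ; apply: all_moments_sum => s _.
  apply: (@bdd_moments_nm _ _ (fun=> nu (t + s))) => i' j'.
  rewrite (_ : (fun _ _ => _) = (fun _ => g ((t + s)%N, i'))); first exact: all_moments_g.
  by apply/funext => ?; apply/funext => om; rewrite mxE.
have recur t om : nm (traj om (t + K)) <= nm (traj om t) / 2 + b t om.
  rewrite traj_shift (le_trans (nmD _ _))// lerD//.
    rewrite (le_trans (nmM _ _))// mulrC ler_wpM2l ?nm_ge0//.
  rewrite (le_trans (nm_lin_traj_le _ _))// /b /c -mulrA.
  rewrite ler_wpM2l ?exprn_ge0 ?addr_ge0 ?nm_ge0// mulr_sumr.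
  by apply: ler_sum => s _; exact: nmM.
split=> // k.
have [D hD] := bdd_moments_unif k (bdd_momentsZ 2 bb) (fun t => all_momentsZ 2 (ab t)).
have D0 : 0 <= D by apply: le_trans (hD 0%N); apply: Ex_ge0 => om; exact: exprn_ge0.
have axk t : all_moments P (fun om => nm (traj om t) ^+ k).
  exact: all_momentsX (all_moments_nm_traj t).
have abk t : all_moments P (fun om => `|2 * b t om| ^+ k).
  by apply: all_momentsX; apply: bdd_moments_norm; exact: all_momentsZ.
pose C0 := \sum_(s < K) Ex P (fun om => nm (traj om s) ^+ k).
have e0 t : 0 <= Ex P (fun om => nm (traj om t) ^+ k).
  by apply: Ex_ge0 => om; rewrite exprn_ge0// nm_ge0.
have bnd t : Ex P (fun om => nm (traj om t) ^+ k) <= C0 + 2 * D.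
  elim/ltn_ind: t => t IH; have [tK|Kt] := ltnP t K.
    rewrite /C0 (bigD1 (Ordinal tK))//= -addrA lerDl addr_ge0//.
      by rewrite sumr_ge0.
    by rewrite mulr_ge0.
  have tE : (t - K + K)%N = t by rewrite subnK.
  have ltK : (t - K < t)%N by rewrite ltn_subrL (leq_trans _ Kt).
  apply: (@le_trans _ _ (2^-1 * Ex P (fun om => nm (traj om (t - K)%N) ^+ k) + D)).
    apply: (@le_trans _ _ (Ex P (fun om => 2^-1 * nm (traj om (t - K)%N) ^+ k
        + `|2 * b (t - K)%N om| ^+ k))).
      apply: Ex_le => //; first by apply: all_momentsD => //; exact: all_momentsZ.
      move=> om; rewrite -{1}tE (le_trans _ (le_trans (expr_half_le k
          (nm_ge0 (traj om (t - K)%N)) (b0 (t - K)%N om)) _))//.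
        by rewrite lerXn2r ?nnegrE ?nm_ge0// addr_ge0// divr_ge0// nm_ge0.
      by rewrite mulrC ger0_norm// mulr_ge0.
    by rewrite ExD ?ExZ ?lerD2l//; exact: all_momentsZ.
  have := IH _ ltK; have : 0 <= C0 by rewrite sumr_ge0.
  lra.
exists (C0 + 2 * D), 0%N => N _.
under eq_integral do rewrite ger0_norm ?nm_ge0//.
by rewrite ExE// lee_fin.
Qed.

End NoisySystem.

Section EmpiricalCovariance.
Context d (T : measurableType d) (R : realType) (P : probability T R).
Variables (n p : nat) (A : 'M[R]_n) (F : 'M[R]_(n, p)).
Variable g : nat * 'I_p -> T -> R.
Hypothesis mg : forall i, measurable_fun [set: T] (g i).
Hypothesis lawg : forall i (E : set R), measurable E ->
  P (g i @^-1` E) = normal_prob 0 1 E.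
Hypothesis indep_g : forall (s : seq (nat * 'I_p)) (E : _ -> set R), uniq s ->
  (forall i, measurable (E i)) ->
  P (\bigcap_(i in [set` s]) (g i @^-1` E i)) =
  (\prod_(i <- s) P (g i @^-1` E i))%E.
Hypothesis A_stable : forall e : R, 0 < e -> exists m, nm (A ^+ m.+1) <= e.
Local Notation nu := (noise_vec g).
Local Notation x := (traj A F g).

Definition cross_sum N om : 'M[R]_(n, p) := \sum_(0 <= t < N) x om t *m (nu t om)^T.

Definition noise_dev N om : 'M[R]_p := \sum_(0 <= t < N) (nu t om *m (nu t om)^T - 1%:M).

Let aG := all_moments_g mg lawg.

Let bdd_nm_scaled m q (X : nat -> T -> 'M[R]_(m, q)) :
  (forall i j, bdd_moments P (fun N om => (Num.sqrt N%:R)^-1 * X N om i j)) ->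
  bdd_moments P (fun N om => (Num.sqrt N%:R)^-1 * nm (X N om)).
Proof.
move=> bX; rewrite (_ : (fun _ _ => _) =
    (fun N om => nm ((Num.sqrt N%:R)^-1 *: X N om))).
  apply: bdd_moments_nm => i j.
  rewrite (_ : (fun _ _ => _) = (fun N om => (Num.sqrt N%:R)^-1 * X N om i j))//.
  by apply/funext => N; apply/funext => om; rewrite mxE.
by apply/funext => N; apply/funext => om; rewrite nmZ ger0_norm// invr_ge0 sqrtr_ge0.
Qed.

Lemma bdd_moments_cross_sum :
  bdd_moments P (fun N om => (Num.sqrt N%:R)^-1 * nm (cross_sum N om)).
Proof.
apply: bdd_nm_scaled => i e.
rewrite (_ : (fun _ _ => _) = (fun N om => (Num.sqrt N%:R)^-1 *
    \sum_(0 <= t < N) g (t, e) om * x om t i 0)); last first.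
  apply/funext => N; apply/funext => om; congr (_ * _).
  rewrite /cross_sum summxE; apply: eq_bigr => t _.
  by rewrite !mxE big_ord1 !mxE mulrC.
apply: (martingale_bdd_moments mg indep_g (J1 := @past p) (J2 := fun t => [set (t, e)])
  (xi := fun t om => x om t i 0) (h := fun t => g (t, e))).
- move=> t; apply/seteqP; split => // -[s e'] [/= + [st _]].
  by rewrite /past/= st ltnn.
- move=> t; rewrite (_ : (fun _ => _) =
      (fun om => \sum_(s < t) g (val s, e) om * x om (val s) i 0)); last first.
    by apply/funext => om; rewrite big_mkord.
  apply: measurable_wrt_sum => s; apply: measurable_wrtM.
    by apply: measurable_wrt_g; rewrite /past/=.
  have : measurable_wrt g (past (val s)) (fun om => x om (val s) i 0) by exact: traj_wrt.
  apply: measurable_wrtS => -[s0 e0].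
  rewrite /past/= => h.
  exact: ltn_trans h (ltn_ord s).
- by move=> t; exact: traj_wrt.
- by move=> t; exact: measurable_wrt_g.
- by move=> t; exact: aG.
- by move=> t; exact: all_moments_traj.
- by move=> t; exact: Ex_std_normal (mg _) (lawg _).
- apply: bdd_momentsM; first exact: bdd_moments_g.
  exact: bdd_moments_traj.
Qed.

Lemma bdd_moments_noise_dev :
  bdd_moments P (fun N om => (Num.sqrt N%:R)^-1 * nm (noise_dev N om)).
Proof.
apply: bdd_nm_scaled => i j.
(* The other coordinates of time [t] count as past, so that an off-diagonal product
   [g (t, i) * g (t, j)] is a martingale increment with fresh factor [g (t, i)]. *)
pose J1 t : set (nat * 'I_p) := [set q | (q.1 < t)%N \/ q.1 = t /\ q.2 <> i].
have J12 t : J1 t `&` [set (t, i)] = set0.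
  apply/seteqP; split => // -[s e'] [/= + [st ei]].
  by rewrite /J1/= st ei ltnn => -[|[_ /(_ erefl)]].
have gwrt s t e : (s < t)%N -> measurable_wrt g (J1 t) (g (s, e)).
  by move=> st; apply: measurable_wrt_g; left.
have [<-|ij] := eqVneq i j.
  rewrite (_ : (fun _ _ => _) = (fun N om => (Num.sqrt N%:R)^-1 *
      \sum_(0 <= t < N) (g (t, i) om ^+ 2 + (- 1)) * 1)); last first.
    apply/funext => N; apply/funext => om; congr (_ * _).
    rewrite /noise_dev summxE; apply: eq_bigr => t _.
    by rewrite !mxE big_ord1 !mxE eqxx mulr1 expr2.
  have ah t : all_moments P (fun om => g (t, i) om ^+ 2 + (- 1)).
    by apply: all_momentsD; [apply: all_momentsX; exact: aG|exact: all_moments_cst].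
  apply: (martingale_bdd_moments mg indep_g (J1 := J1) (J2 := fun t => [set (t, i)])
    (xi := fun _ _ => 1) (h := fun t om => g (t, i) om ^+ 2 + (- 1))) => // [t|t|t|t|t|].
  + rewrite (_ : (fun _ => _) =
        (fun om => \sum_(s < t) (g (val s, i) om ^+ 2 + (- 1)) * 1)); last first.
      by apply/funext => om; rewrite big_mkord.
    apply: measurable_wrt_sum => s; apply: measurable_wrtM; last exact: measurable_wrt_cst.
    apply: measurable_wrtD; last exact: measurable_wrt_cst.
    by apply: measurable_wrtX; (apply: gwrt; exact: ltn_ord).
  + exact: measurable_wrt_cst.
  + apply: measurable_wrtD; last exact: measurable_wrt_cst.
    by apply: measurable_wrtX; exact: measurable_wrt_g.
  + exact: all_moments_cst.
  + rewrite ExD; [|by apply: all_momentsX; exact: aG|exact: all_moments_cst].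
    by rewrite Ex_cst (Ex_sqr_std_normal (mg _) (lawg _)) subrr.
  + apply: bdd_momentsM; last exact: all_moments_cst.
    apply: bdd_momentsD; last exact: all_moments_cst.
    by apply: bdd_momentsX; exact: bdd_moments_g.
rewrite (_ : (fun _ _ => _) = (fun N om => (Num.sqrt N%:R)^-1 *
    \sum_(0 <= t < N) g (t, i) om * g (t, j) om)); last first.
  apply/funext => N; apply/funext => om; congr (_ * _).
  rewrite /noise_dev summxE; apply: eq_bigr => t _.
  by rewrite !mxE big_ord1 !mxE (negbTE ij) subr0.
apply: (martingale_bdd_moments mg indep_g (J1 := J1) (J2 := fun t => [set (t, i)])
  (xi := fun t => g (t, j)) (h := fun t => g (t, i))) => // [t|t|t|t|].
- rewrite (_ : (fun _ => _) =
      (fun om => \sum_(s < t) g (val s, i) om * g (val s, j) om)); last first.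
    by apply/funext => om; rewrite big_mkord.
  by apply: measurable_wrt_sum => s; apply: measurable_wrtM; (apply: gwrt; exact: ltn_ord).
- by apply: measurable_wrt_g; right; split => //= ji; rewrite ji eqxx in ij.
- exact: measurable_wrt_g.
- exact: Ex_std_normal (mg _) (lawg _).
- by apply: bdd_momentsM; exact: bdd_moments_g.
Qed.

Variable Sx : 'M[R]_n.
Hypothesis Sx_stationary : Sx = A *m Sx *m A^T + F *m F^T.

Definition state_dev N om : 'M[R]_n :=
  \sum_(0 <= t < N) x om t *m (x om t)^T - N%:R *: Sx.

(** Summing [x_{t+1} x_{t+1}^T] over [t < N] shifts the window by one. As the initial state is 0,
    only the end term is extra, and subtracting the stationary equation leaves a Lyapunov equation
    driven by [cross_sum] and [noise_dev], both of which are martingales. *)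
Lemma state_dev_rec N om :
  state_dev N om + x om N *m (x om N)^T = A *m state_dev N om *m A^T
    + (A *m cross_sum N om *m F^T + (A *m cross_sum N om *m F^T)^T)
    + F *m noise_dev N om *m F^T.
Proof.
elim: N => [|N IH].
  rewrite /state_dev /cross_sum /noise_dev !big_geq// scale0r subr0.
  by rewrite /traj /= trmx0 !(mulmx0, mul0mx) trmx0 !addr0.
have -> : state_dev N.+1 om = state_dev N om + x om N *m (x om N)^T - Sx.
  by rewrite /state_dev big_nat_recr//= -natr1 scalerDl scale1r opprD addrACA addrA.
have -> : cross_sum N.+1 om = cross_sum N om + x om N *m (nu N om)^T.
  by rewrite /cross_sum big_nat_recr.
have -> : noise_dev N.+1 om = noise_dev N om + (nu N om *m (nu N om)^T - 1%:M).
  by rewrite /noise_dev big_nat_recr.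
rewrite {1}IH.
have -> : x om N.+1 = A *m x om N + F *m nu N om by [].
move: (state_dev N om) (cross_sum N om) (noise_dev N om) (x om N) (nu N om) => D X V y v.
rewrite [X in _ - X + _]Sx_stationary.
have trD a b (Y Z : 'M[R]_(a, b)) : (Y + Z)^T = Y^T + Z^T by exact: linearD.
rewrite !(mulmxDl, mulmxDr) !(trD, trmx_mul, trmxK) ?(mulmxDl, mulmxDr).
rewrite ?(mulmxN, mulNmx) ?mulmxA ?mulmx1.
move: (A *m D *m A^T) (A *m X *m F^T) (F *m X^T *m A^T) (F *m V *m F^T)
  (A *m Sx *m A^T) (F *m F^T) (A *m y *m y^T *m A^T) (A *m y *m v^T *m F^T)
  (F *m v *m y^T *m A^T) (F *m v *m v^T *m F^T) => a b c e f h k l m o.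
by apply/matrixP => i j; rewrite !mxE; ring.
Qed.

(** The Lyapunov equation is unrolled until the power of [A] is small enough for the term containing
    the deviation itself to be absorbed on the left. *)
Lemma nm_state_dev_le : exists2 C : R, 0 <= C & forall N om,
  nm (state_dev N om) <=
    C * (nm (x om N) ^+ 2 + nm (cross_sum N om) + nm (noise_dev N om)).
Proof.
have [m Am] : exists m, nm (A ^+ m.+1) <= 2^-1 by apply: A_stable; lra.
pose c := \sum_(k < m.+1) nm (A ^+ k) ^+ 2.
have c0 : 0 <= c by rewrite sumr_ge0// => k _; exact: sqr_ge0.
pose b := 1 + 2 * (nm A * nm F) + nm F ^+ 2.
have nA := nm_ge0 A; have nF := nm_ge0 F.
have nAF : 0 <= nm A * nm F by exact: mulr_ge0.
have b0 : 0 <= b by rewrite /b; have := sqr_ge0 (nm F); lra.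
exists (2 * c * b); first by rewrite !mulr_ge0.
move=> N om; set D := state_dev N om.
pose E := (A *m cross_sum N om *m F^T + (A *m cross_sum N om *m F^T)^T)
    + F *m noise_dev N om *m F^T - x om N *m (x om N)^T.
have DE : D = A *m D *m A^T + E.
  have := state_dev_rec N om; rewrite -/D /E => h.
  by rewrite addrA addrA -h addrK.
have unroll k : D = A ^+ k *m D *m (A ^+ k)^T +
    \sum_(s < k) A ^+ s *m E *m (A ^+ s)^T.
  elim: k => [|k IH]; first by rewrite big_ord0 addr0 expr0 trmx1 mul1mx mulmx1.
  rewrite big_ord_recr/= [LHS]IH {1}DE mulmxDr mulmxDl -addrA [E in RHS]lock.
  rewrite -lock [X in _ + X = _]addrC; congr (_ + _).
  by rewrite exprSr trmx_mul !mulmxA.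
have nmE : nm E <= b * (nm (x om N) ^+ 2 + nm (cross_sum N om) + nm (noise_dev N om)).
  have nx := nm_ge0 (x om N); have nX := nm_ge0 (cross_sum N om).
  have nV := nm_ge0 (noise_dev N om).
  have e1 : nm (A *m cross_sum N om *m F^T) <= nm A * nm F * nm (cross_sum N om).
    rewrite (le_trans (nmM _ _))// nm_tr [leRHS]mulrAC ler_wpM2r//.
    exact: nmM.
  have e2 : nm (F *m noise_dev N om *m F^T) <= nm F ^+ 2 * nm (noise_dev N om).
    rewrite (le_trans (nmM _ _))// nm_tr expr2 [leRHS]mulrAC ler_wpM2r//.
    exact: nmM.
  have e3 : nm (x om N *m (x om N)^T) <= nm (x om N) ^+ 2.
    by rewrite (le_trans (nmM _ _))// nm_tr expr2.
  rewrite /E (le_trans (nmB _ _))// (le_trans (lerD (nmD _ _) e3))//.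
  apply: (@le_trans _ _ (nm A * nm F * nm (cross_sum N om) +
      nm A * nm F * nm (cross_sum N om) + nm F ^+ 2 * nm (noise_dev N om) +
      nm (x om N) ^+ 2)).
    by rewrite !lerD// (le_trans (nmD _ _))// nm_tr lerD.
  rewrite /b; move: (nm A * nm F) nAF (sqr_ge0 (nm F)) (sqr_ge0 (nm (x om N))).
  move: (nm F ^+ 2) (nm (x om N) ^+ 2) => f y a a0 f0 y0.
  have := mulr_ge0 a0 nX; have := mulr_ge0 a0 nV; have := mulr_ge0 f0 nX.
  have := mulr_ge0 f0 nV; have := mulr_ge0 a0 y0; have := mulr_ge0 f0 y0.
  lra.
have nD := nm_ge0 D.
have q : nm (A ^+ m.+1 *m D *m (A ^+ m.+1)^T) <= 2^-1 * nm D.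
  rewrite (le_trans (nmM _ _))// nm_tr.
  apply: (@le_trans _ _ ((2^-1 * nm D) * 1)); last by rewrite mulr1.
  apply: ler_pM; rewrite ?nm_ge0//; last by lra.
  by rewrite (le_trans (nmM _ _))// ler_wpM2r.
have s : nm (\sum_(k < m.+1) A ^+ k *m E *m (A ^+ k)^T) <= c * nm E.
  rewrite (le_trans (nm_sum _ _ _))// /c mulr_suml; apply: ler_sum => k _.
  rewrite (le_trans (nmM _ _))// nm_tr expr2 [leRHS]mulrAC ler_wpM2r ?nm_ge0//.
  exact: nmM.
have : nm D <= 2^-1 * nm D + c * nm E.
  by rewrite {1}(unroll m.+1) (le_trans (nmD _ _))// lerD.
have := ler_wpM2l c0 nmE; rewrite mulrA -mulrA [2 * c * b]mulrAC.
move: (nm (x om N) ^+ 2 + _ + _) => W; rewrite -!mulrA; lra.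
Qed.

End EmpiricalCovariance.

(** * Negative moments of the Gram matrix *)

(** The predicate [Q] is abstract because determinants and cofactors are treated twice: for
    measurability with respect to the past and for finiteness of all moments. *)
Lemma closed_prod (T : Type) (R : comPzRingType) (Q : (T -> R) -> Prop) :
  (forall c, Q (fun=> c)) ->
  (forall X Y, Q X -> Q Y -> Q (fun om => X om * Y om)) ->
  forall (I : Type) (s : seq I) (p : pred I) (F : I -> T -> R),
  (forall i, Q (F i)) -> Q (fun om => \prod_(i <- s | p i) F i om).
Proof.
move=> Qc QM I s p F QF; elim: s => [|i s IH].
  by rewrite (_ : (fun _ => _) = fun=> 1)//; apply/funext => om; rewrite big_nil.
rewrite (_ : (fun _ => _) = (fun om => (if p i then F i om else 1) *
    \prod_(i <- s | p i) F i om)).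
  by apply: QM => //; case: (p i).
by apply/funext => om; rewrite big_cons; case: (p i); rewrite ?mul1r.
Qed.

Lemma closed_det (T : Type) (R : comPzRingType) (Q : (T -> R) -> Prop) :
  (forall c, Q (fun=> c)) ->
  (forall X Y, Q X -> Q Y -> Q (fun om => X om + Y om)) ->
  (forall X Y, Q X -> Q Y -> Q (fun om => X om * Y om)) ->
  forall m (X : T -> 'M[R]_m), (forall i j, Q (fun om => X om i j)) ->
  Q (fun om => \det (X om)).
Proof.
move=> Qc QD QM m X QX.
have Qsum (I : Type) (s : seq I) (F : I -> T -> R) : (forall i, Q (F i)) ->
    Q (fun om => \sum_(i <- s) F i om).
  move=> QF; elim: s => [|i s IH].
    by rewrite (_ : (fun _ => _) = fun=> 0)//; apply/funext => om; rewrite big_nil.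
  rewrite (_ : (fun _ => _) = (fun om => F i om + \sum_(i <- s) F i om)).
    exact: QD.
  by apply/funext => om; rewrite big_cons.
apply: (Qsum _ _ (fun (s : {perm 'I_m}) om => (-1) ^+ s * \prod_i X om i (s i))) => s.
by apply: (QM (fun=> (-1) ^+ s) (fun om => \prod_i X om i (s i))) => //; exact: closed_prod.
Qed.

Lemma closed_cofactor (T : Type) (R : comPzRingType) (Q : (T -> R) -> Prop) :
  (forall c, Q (fun=> c)) ->
  (forall X Y, Q X -> Q Y -> Q (fun om => X om + Y om)) ->
  (forall X Y, Q X -> Q Y -> Q (fun om => X om * Y om)) ->
  forall m (X : T -> 'M[R]_m), (forall i j, Q (fun om => X om i j)) ->
  forall i j, Q (fun om => cofactor (X om) i j).
Proof.
move=> Qc QD QM m X QX i j.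
rewrite /cofactor; apply: (QM (fun=> (-1) ^+ (i + j)) (fun om => \det (row' i (col' j (X
  om))))) => //.
apply: (closed_det Qc QD QM) => k l.
rewrite (_ : (fun _ => _) = (fun om => X om (lift i k) (lift j l)))//.
by apply/funext => om; rewrite !mxE.
Qed.

Lemma sum_subseq_le (R : numDomainType) (I : eqType) (s r : seq I) (f : I -> R) :
  uniq s -> uniq r -> {subset s <= r} -> (forall i, 0 <= f i) ->
  \sum_(i <- s) f i <= \sum_(i <- r) f i.
Proof.
move=> us ur sr f0; rewrite [leRHS](bigID (mem s))/= -[\sum_(i <- r | i \in s) _]big_filter.
suff sE : perm_eq s [seq i <- r | i \in s] by rewrite -(perm_big _ sE)/= lerDl sumr_ge0.
apply: uniq_perm => //; first exact: filter_uniq.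
by move=> i; rewrite mem_filter; apply/esym/andb_idr => /sr.
Qed.

Section DeterminantBound.
Variable R : realType.

(** The Gram matrix is never inverted. The trace of [Y *m D^T] equals the sum of all [|D xi_t| ^ 2],
    hence dominates the part coming from the chosen columns, which is [sqF (D *m X)]; and [D *m X]
    controls [\det X *: D] through the adjugate. One factor [nm D] then cancels. *)
Lemma gram_bound q r (xi : nat -> 'cV[R]_q) (N : nat) (tau : 'I_q -> nat)
    (D Y : 'M[R]_(r, q)) (X : 'M[R]_q) :
  injective tau -> (forall c, 1 <= tau c < N)%N ->
  D *m \sum_(1 <= t < N) xi t *m (xi t)^T = Y ->
  (forall i c, X i c = xi (tau c) i 0) ->
  \det X ^+ 2 * nm D <= nm Y * ((r * q)%:R * nm (\adj X) ^+ 2 + 1).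
Proof.
move=> tau_inj tauN DS XE.
have nD := nm_ge0 D; have nY := nm_ge0 Y; have nX := nm_ge0 (\adj X).
have sq0 : 0 <= (r * q)%:R * nm (\adj X) ^+ 2 by rewrite mulr_ge0// sqr_ge0.
have [D0|D0] := eqVneq (nm D) 0; first by rewrite D0 mulr0 mulr_ge0// addr_ge0.
have {}D0 : 0 < nm D by rewrite lt_def D0.
suff : \det X ^+ 2 * nm D * nm D <= nm Y * ((r * q)%:R * nm (\adj X) ^+ 2) * nm D.
  by rewrite ler_pM2r// => h; rewrite (le_trans h)// ler_wpM2l// lerDl.
have colE (v : 'rV[R]_q) : \sum_c (v *m xi (tau c)) 0 0 ^+ 2 <=
    \sum_(1 <= t < N) (v *m xi t) 0 0 ^+ 2.
  rewrite -(big_map tau xpredT (fun t => (v *m xi t) 0 0 ^+ 2)).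
  apply: sum_subseq_le => //; last by move=> t; exact: sqr_ge0.
  - by rewrite map_inj_uniq// index_enum_uniq.
  - exact: iota_uniq.
  - by move=> t /mapP[c _ ->]; rewrite mem_index_iota.
have energy : sqF (D *m X) <= nm Y * nm D.
  have -> : sqF (D *m X) = \sum_i \sum_c (row i D *m xi (tau c)) 0 0 ^+ 2.
    apply: eq_bigr => i _; apply: eq_bigr => c _; congr (_ ^+ 2).
    by rewrite !mxE; apply: eq_bigr => k _; rewrite !mxE XE.
  apply: (@le_trans _ _ (\tr (Y *m D^T))); last first.
    by rewrite (le_trans (ler_norm _))// -(nm_tr D) normr_mxtrace_le.
  rewrite -DS /mxtrace; apply: ler_sum => i _; apply: le_trans (colE _) _.
  rewrite mulmx_sumr mulmx_suml summxE; apply: ler_sum => t _.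
  have -> : (D *m (xi t *m (xi t)^T) *m D^T) i i = ((D *m xi t) *m (D *m xi t)^T) i i.
    by rewrite trmx_mul !mulmxA.
  rewrite [leRHS]mxE big_ord1 expr2 ![(_^T) _ _]mxE.
  have -> : (row i D *m xi t) 0 0 = (D *m xi t) i 0; last by [].
  by rewrite !mxE; apply: eq_bigr => k _; rewrite !mxE.
have detD : `|\det X| * nm D <= nm (D *m X) * nm (\adj X).
  by rewrite -nmZ (le_trans _ (nmM _ _))// -mulmxA mul_mx_adj mul_mx_scalar.
apply: (@le_trans _ _ ((nm (D *m X) * nm (\adj X)) ^+ 2)).
  rewrite -mulrA -expr2 -(real_normK (num_real (\det X))) -exprMn.
  by rewrite lerXn2r ?nnegrE ?mulr_ge0 ?nm_ge0.
rewrite exprMn.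
have -> : nm Y * ((r * q)%:R * nm (\adj X) ^+ 2) * nm D =
   (r * q)%:R * (nm Y * nm D) * nm (\adj X) ^+ 2 by ring.
rewrite ler_wpM2r ?sqr_ge0// (le_trans (nm_sqr_le _))//.
by rewrite ler_wpM2l.
Qed.

End DeterminantBound.

Section NegativeMoments.
Context d (T : measurableType d) (R : realType) (P : probability T R).
Variables (n p q : nat) (A : 'M[R]_n) (F : 'M[R]_(n, p)).
Variables (Gx : 'M[R]_(q, n)) (Gu : 'M[R]_(q, p)).
Variable g : nat * 'I_p -> T -> R.
Hypothesis mg : forall i, measurable_fun [set: T] (g i).
Hypothesis lawg : forall i (E : set R), measurable E ->
  P (g i @^-1` E) = normal_prob 0 1 E.
Hypothesis indep_g : forall (s : seq (nat * 'I_p)) (E : _ -> set R), uniq s ->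
  (forall i, measurable (E i)) ->
  P (\bigcap_(i in [set` s]) (g i @^-1` E i)) =
  (\prod_(i <- s) P (g i @^-1` E i))%E.
Local Notation nu := (noise_vec g).
Local Notation x := (traj A F g).

Definition regressor om t : 'cV[R]_q := Gx *m x om t + Gu *m nu t om.

Variables (L : nat) (kap : R).

(* The coefficients of the noises [nu s, ..., nu (s + L)] in [c *m regressor om (s + L)]. *)
Definition fresh_coef (c : 'rV[R]_q) (r : 'I_L.+1) : 'rV[R]_p :=
  if (r < L)%N then c *m Gx *m A ^+ (L - r.+1) *m F else c *m Gu.

Hypothesis fresh_nondegenerate : forall (c : 'rV[R]_q) i,
  `|c 0 i| <= kap * \sum_r nm (fresh_coef c r).

Definition fresh_part c s om : R :=
  \sum_(r < L.+1) \sum_e fresh_coef c r 0 e * g ((s + r)%N, e) om.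

Lemma lin_traj_sum (v : nat -> 'cV[R]_n) k :
  lin_traj A v 0 k = \sum_(r < k) A ^+ (k - r.+1) *m v r.
Proof.
elim: k => [|k IH]; first by rewrite big_ord0.
rewrite big_ord_recr/= subnn expr0 mul1mx IH mulmx_sumr; congr (_ + _).
apply: eq_bigr => r _; rewrite mulmxA subSS; congr (_ *m _).
by rewrite -(subnSK (ltn_ord r)) exprS.
Qed.

Lemma regressor_fresh c s om : (c *m regressor om (s + L)%N) 0 0 =
  (c *m Gx *m A ^+ L *m x om s) 0 0 + fresh_part c s om.
Proof.
have dotE (b : 'rV[R]_p) t : (b *m nu t om) 0 0 = \sum_e b 0 e * g (t, e) om.
  by rewrite mxE; apply: eq_bigr => e _; rewrite mxE.
have -> : c *m regressor om (s + L)%N = c *m Gx *m A ^+ L *m x om s +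
    \sum_(r < L.+1) fresh_coef c r *m nu (s + r)%N om.
  rewrite /regressor traj_shift lin_traj_sum big_ord_recr/=.
  rewrite [fresh_coef c ord_max]/fresh_coef /= ltnn.
  rewrite !mulmxDr !mulmxA -!addrA; congr (_ + (_ + _)).
  rewrite mulmx_sumr; apply: eq_bigr => r _.
  by rewrite /fresh_coef /= ltn_ord !mulmxA.
rewrite mxE; congr (_ + _); rewrite /fresh_part summxE.
by apply: eq_bigr => r _; exact: dotE.
Qed.

Let kap1 : R := `|kap| * (L.+1 * p)%:R + 1.

Let kap1_gt0 : 0 < kap1.
Proof. by rewrite /kap1 ltr_pwDr// mulr_ge0. Qed.

(** Pigeonhole over the [L.+1 * p] coefficients; the summand 1 in [kap1] makes the contradiction
    strict. *)
Lemma exists_large_coef (c : 'rV[R]_q) i : c 0 i != 0 ->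
  exists r e, `|c 0 i| <= kap1 * `|fresh_coef c r 0 e|.
Proof.
move=> c0; apply: contrapT => none.
have small r e : kap1 * `|fresh_coef c r 0 e| < `|c 0 i|.
  by rewrite ltNge; apply/negP => h; apply: none; exists r, e.
have ci0 : 0 < `|c 0 i| by rewrite normr_gt0.
have sumE : \sum_r nm (fresh_coef c r) = \sum_r \sum_e `|fresh_coef c r 0 e|.
  by apply: eq_bigr => r _; rewrite /nm big_ord1.
have s0 : 0 <= \sum_r nm (fresh_coef c r) by rewrite sumr_ge0// => r _; exact: nm_ge0.
have h1 : kap1 * \sum_r nm (fresh_coef c r) <= (L.+1 * p)%:R * `|c 0 i|.
  rewrite sumE mulr_sumr.
  apply: (@le_trans _ _ (\sum_(r < L.+1) \sum_(e < p) `|c 0 i|)).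
    apply: ler_sum => r _; rewrite mulr_sumr; apply: ler_sum => e _.
    exact: ltW.
  by rewrite !sumr_const !card_ord -mulrnA mulr_natl mulnC.
have h2 : `|c 0 i| <= `|kap| * \sum_r nm (fresh_coef c r).
  by rewrite (le_trans (fresh_nondegenerate c i))// ler_wpM2r// ler_norm.
have h3 := ler_wpM2l (ltW kap1_gt0) h2.
have h4 := ler_wpM2l (normr_ge0 kap) h1.
have : kap1 * `|c 0 i| <= `|kap| * (L.+1 * p)%:R * `|c 0 i|.
  by rewrite (le_trans h3)// mulrCA -mulrA.
by rewrite ler_pM2r// /kap1 gerDl ler10.
Qed.

Let Cf : R := 9 * Num.sqrt kap1.

Let Cf0 : 0 < Cf.
Proof. by rewrite mulr_gt0// sqrtr_gt0. Qed.

(** One scalar noise whose coefficient is comparable to [c 0 i] is isolated; the other noises are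
    frozen and merged into the shift. The loss [kap1] in the coefficient becomes its square root in
    [Cf]. *)
Lemma invsqrt_fresh_part (c : 'rV[R]_q) i s a :
  (\int[P]_om invsqrt (a + fresh_part c s om)%R <= Cf%:E * invsqrt (c 0 i)%R)%E.
Proof.
have [c0|c0] := eqVneq (c 0 i) 0.
  by rewrite c0 /invsqrt eqxx gt0_muley ?leey// lte_fin.
have [r [e re]] := exists_large_coef c0.
set b := fresh_coef c r 0 e in re.
(* The isolated term is set to 0 rather than excluded, so that each summand is measurable with
   respect to the remaining coordinates. *)
pose term (re' : 'I_L.+1 * 'I_p) om : R := if re' == (r, e) then 0 else
  fresh_coef c re'.1 0 re'.2 * g ((s + re'.1)%N, re'.2) om.
pose rest om := \sum_re' term re' om.
have freshE om : a + fresh_part c s om = (a + rest om) + b * g ((s + r)%N, e) om.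
  have -> : rest om = \sum_(i0 | i0 != (r, e))
      fresh_coef c i0.1 0 i0.2 * g ((s + i0.1)%N, i0.2) om.
    rewrite /rest (bigD1 (r, e))//= /term eqxx add0r.
    by apply: eq_bigr => re' /negbTE ->.
  by rewrite /fresh_part pair_bigA/= (bigD1 (r, e))//= addrA addrAC.
pose J1 : set (nat * 'I_p) := [set k | k <> ((s + r)%N, e)].
pose J2 : set (nat * 'I_p) := [set ((s + r)%N, e)].
have J12 : J1 `&` J2 = set0.
  by apply/seteqP; split => // k [h ks]; exact: (h ks).
have mrest : measurable_wrt g J1 rest.
  apply: measurable_wrt_sum => -[r' e']; rewrite /term.
  case: (boolP ((r', e') == (r, e))) => [_|ne]; first exact: measurable_wrt_cst.
  apply: measurable_wrtM; first exact: measurable_wrt_cst.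
  apply: measurable_wrt_g => -[/addnI/val_inj rr ee].
  by rewrite rr ee eqxx in ne.
have mb : measurable_wrt g J2 (g ((s + r)%N, e)) by exact: measurable_wrt_g.
pose G (z : subT g J1 * subT g J2) : \bar R :=
  invsqrt ((a + rest z.1) + b * g ((s + r)%N, e) z.2).
have mG : measurable_fun setT G.
  apply: measurableT_comp; first exact: measurable_invsqrt.
  apply: measurable_funD.
    by apply: measurable_funD => //; exact: (measurableT_comp mrest measurable_fst).
  by apply: measurable_funM => //; exact: (measurableT_comp mb measurable_snd).
under eq_integral do rewrite freshE.
apply: (@le_trans _ _ (\int[P]_om cst (9%:E * invsqrt b) om)%E).
  apply: (decouple_le mg indep_g J12 mG) => //.
  - by move=> z; exact: invsqrt_ge0.
  - by move=> om; exact: (invsqrt_std_normal (mg ((s + r)%N, e)) (lawg _) (a + rest om) b).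
rewrite integral_cst//= probability_setT mule1 /Cf EFinM -muleA lee_wpmul2l//.
have -> : (Num.sqrt kap1)%:E = invsqrt kap1^-1.
  rewrite /invsqrt invr_eq0 gt_eqF// gtr0_norm ?invr_gt0//.
  by rewrite sqrtrV ?invrK// ltW.
rewrite -invsqrtM; apply: invsqrt_le.
by rewrite normrM gtr0_norm ?invr_gt0// mulrC ler_pdivrMr// mulrC.
Qed.

(** Here the coefficient row is random but determined before time [s]. Freezing the past reduces to
    a fixed row, the contribution of [x om s] being a shift. *)
Lemma invsqrt_regressor (c : T -> 'rV[R]_q) i s :
  (forall j, measurable_wrt g (past s) (fun om => c om 0 j)) ->
  (\int[P]_om invsqrt ((c om *m regressor om (s + L)%N) 0 0)%R <=
   Cf%:E * \int[P]_om invsqrt (c om 0 i)%R)%E.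
Proof.
move=> mc.
pose J2 : set (nat * 'I_p) := [set k | (s <= k.1)%N].
have J12 : past s `&` J2 = set0.
  by apply/seteqP; split => // k [+ h]; rewrite /past/= ltnNge h.
have mcM m (M : 'M[R]_(q, m)) j :
    measurable_wrt g (past s) (fun om => (c om *m M) 0 j).
  rewrite (_ : (fun _ => _) = (fun om => \sum_k c om 0 k * M k j)).
    apply: measurable_wrt_sum => k; apply: measurable_wrtM => //.
    exact: measurable_wrt_cst.
  by apply/funext => om; rewrite mxE.
have mfc r e : measurable_wrt g (past s) (fun om => fresh_coef (c om) r 0 e).
  rewrite (_ : (fun _ => _) = (fun om => (c om *m
      if (r < L)%N then Gx *m A ^+ (L - r.+1) *m F else Gu) 0 e)); first exact: mcM.
  by apply/funext => om; rewrite /fresh_coef; case: ifP => _ //; rewrite !mulmxA.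
pose a om := (c om *m Gx *m A ^+ L *m x om s) 0 0.
have ma : measurable_wrt g (past s) a.
  rewrite (_ : a = (fun om => \sum_k (c om *m (Gx *m A ^+ L)) 0 k * x om s k 0)).
    apply: measurable_wrt_sum => k; apply: measurable_wrtM => //.
    exact: traj_wrt.
  by apply/funext => om; rewrite /a mxE; apply: eq_bigr => k _; rewrite mulmxA.
pose G (z : subT g (past s) * subT g J2) : \bar R := invsqrt (a z.1 +
  \sum_(r < L.+1) \sum_e fresh_coef (c z.1) r 0 e * g ((s + r)%N, e) z.2).
have mG : measurable_fun setT G.
  apply: measurableT_comp; first exact: measurable_invsqrt.
  apply: measurable_funD; first exact: (measurableT_comp ma measurable_fst).
  apply: measurable_sum => r; apply: measurable_sum => e.
  apply: measurable_funM; first exact: (measurableT_comp (mfc r e) measurable_fst).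
  have mge : measurable_wrt g J2 (g ((s + r)%N, e)).
    by apply: measurable_wrt_g; rewrite /J2 /= leq_addr.
  exact: (measurableT_comp mge measurable_snd).
have mH : measurable_fun setT (fun om => invsqrt (c om 0 i)).
  apply: measurableT_comp; first exact: measurable_invsqrt.
  exact: (measurable_subT mg (mc i)).
rewrite -ge0_integralZl//; last 2 first.
- by move=> om _; exact: invsqrt_ge0.
- by rewrite lee_fin ltW.
have -> : (\int[P]_om invsqrt ((c om *m regressor om (s + L)%N) 0 0)%R =
    \int[P]_om invsqrt (a om + fresh_part (c om) s om)%R)%E.
  by apply: eq_integral => om _; congr invsqrt; exact: regressor_fresh.
apply: (decouple_le mg indep_g J12 mG) => //.
- by move=> z; exact: invsqrt_ge0.
- by apply: measurable_funeM.
- by move=> om; exact: (invsqrt_fresh_part (c om) i s (a om)).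
Qed.

(** The windows from [start j] to [start j + L] are disjoint and consecutive. They begin at time 1,
    like the sum defining the Gram matrix. *)
Definition start j := (j * L.+1).+1.

(** Columns are numbered consecutively across the blocks: column [c] of block [b] has number
    [b * q + c]. Those numbered below [m] are regressors at the ends of their windows, the others
    are still basis vectors. *)
Definition stage m b om : 'M[R]_q := \matrix_(i, c)
  if (b * q + c < m)%N then regressor om (start (b * q + c) + L)%N i 0 else (i == c)%:R.

Lemma regressor_wrt t s i : (t < s)%N ->
  measurable_wrt g (past s) (fun om => regressor om t i 0).
Proof.
move=> ts.
rewrite (_ : (fun _ => _) = (fun om => \sum_k Gx i k * x om t k 0 +
    \sum_e Gu i e * g (t, e) om)); last first.
  apply/funext => om; rewrite /regressor !mxE; congr (_ + _).
  by apply: eq_bigr => e _; rewrite mxE.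
apply: measurable_wrtD; apply: measurable_wrt_sum => k; apply: measurable_wrtM;
  try exact: measurable_wrt_cst.
- apply: (@measurable_wrtS _ _ _ _ _ (past t)); last exact: traj_wrt.
  by move=> -[u e]; rewrite /past/= => /ltn_trans; exact.
- exact: measurable_wrt_g.
Qed.

Lemma stage_wrt m b i c :
  measurable_wrt g (past (start m)) (fun om => stage m b om i c).
Proof.
case: (ltnP (b * q + c) m) => bm; last first.
  rewrite (_ : (fun _ => _) = fun=> (i == c)%:R); first exact: measurable_wrt_cst.
  by apply/funext => om; rewrite mxE ltnNge bm.
rewrite (_ : (fun _ => _) = (fun om => regressor om (start (b * q + c) + L)%N i 0)).
  by apply: regressor_wrt; rewrite /start addSn -addnS -mulSnr ltnS leq_mul2r bm orbT.
by apply/funext => om; rewrite mxE bm.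
Qed.

Definition stage_prod K m om : R := \prod_(b < K) \det (stage m b om).

(* Column [m] is replaced by a basis vector: expanding along it, the determinant is linear
   in the fresh regressor with a coefficient, a cofactor, that the past determines. *)
Lemma invsqrt_stage K m : (m <= K * q)%N ->
  (\int[P]_om invsqrt (stage_prod K m om) <= (Cf ^+ m)%:E)%E.
Proof.
elim: m => [|m IH] mK.
  rewrite expr0 [leLHS](_ : _ = \int[P]_om cst 1 om)%E.
    by rewrite integral_cst//= probability_setT mul1e.
  apply: eq_integral => om _; rewrite /stage_prod big1 ?invsqrt1// => b _.
  rewrite (_ : stage _ _ _ = 1%:M) ?det1//.
  by apply/matrixP => i c; rewrite !mxE.
have q0 : (0 < q)%N by move: mK; case: (q) => //; rewrite muln0.
have bK : (m %/ q < K)%N by rewrite ltn_divLR.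
pose b0 := Ordinal bK; pose c0 := Ordinal (ltn_pmod m q0).
have mE : m = (b0 * q + c0)%N by exact: divn_eq.
pose other om := \prod_(b < K | b != b0) \det (stage m b om).
pose c om : 'rV[R]_q := \row_i (other om * cofactor (stage m b0 om) i c0).
have same b c' om i : (b, c') != (b0, c0) -> stage m.+1 b om i c' = stage m b om i c'.
  move=> ne; rewrite !mxE ltnS leq_eqVlt; case: eqP => //= e.
  have eb : b = b0 by apply: ord_inj; rewrite /= -e divnMDl// divn_small// addn0.
  have ec : c' = c0 by apply: ord_inj; rewrite /= -e modnMDl modn_small.
  by rewrite eb ec eqxx in ne.
have cE om : (c om *m regressor om (start m + L)%N) 0 0 = stage_prod K m.+1 om.
  rewrite /stage_prod (bigD1 b0)//= (expand_det_col _ c0) mulr_suml mxE.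
  apply: eq_bigr => i _; rewrite !mxE -mE leqnn mulrC -mulrA; congr (_ * _).
  rewrite mulrC /other; congr (_ * _).
    rewrite /cofactor; congr (_ * _); congr determinant; apply/matrixP => k l;
      rewrite 2![LHS]mxE 2![RHS]mxE.
    by rewrite (same b0 _ om _ _)// xpair_eqE eqxx/= eq_sym neq_lift.
  apply: eq_bigr => b bb0; congr (\det _); apply/matrixP => k l.
  by rewrite (same b l om k)// xpair_eqE negb_and bb0.
(* While column [c0] is still a basis vector, its expansion retains the single cofactor at
   [(c0, c0)]: the previous stage is exactly one entry of the coefficient row. *)
have c0E om : c om 0 c0 = stage_prod K m om.
  rewrite /stage_prod (bigD1 b0)//= (expand_det_col _ c0) mxE mulrC; congr (_ * _).
  rewrite (bigD1 c0)//= big1 ?addr0 => [|i ic]; rewrite !mxE -mE ltnn.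
    by rewrite eqxx mul1r.
  by rewrite (negbTE ic) mul0r.
under eq_integral do rewrite -cE.
have Qc := @measurable_wrt_cst _ T R _ g (past (start m)).
have QD := @measurable_wrtD _ T R _ g (past (start m)).
have QM := @measurable_wrtM _ T R _ g (past (start m)).
apply: (le_trans (@invsqrt_regressor c c0 (start m) _)).
  move=> i; rewrite (_ : (fun _ => _) = (fun om => other om *
      cofactor (stage m b0 om) i c0)); last by apply/funext => om; rewrite mxE.
  apply: (QM other); last by apply: (closed_cofactor Qc QD QM) => k l; exact: stage_wrt.
  by apply: (closed_prod Qc QM) => b; apply: (closed_det Qc QD QM) => k l; exact: stage_wrt.
under eq_integral do rewrite c0E.
have -> : ((Cf ^+ m.+1)%:E = Cf%:E * (Cf ^+ m)%:E :> \bar R)%E by rewrite exprS EFinM.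
by apply: lee_wpmul2l; [rewrite lee_fin ltW|apply: IH; exact: ltnW].
Qed.

Lemma normr_fine_invsqrt (z : R) : z != 0 -> fine (invsqrt z) = (Num.sqrt `|z|)^-1.
Proof. by move=> z0; rewrite /invsqrt (negbTE z0). Qed.

(** With [h0] the square root of [|D|] one has [D ^+ 2 = h0 ^+ 4]. If the conclusion failed, the
    [k]-th powers would satisfy [t > y * a] and [h0 * t > y], hence
    [t * (h0 * t) ^+ 4 > y * a * y ^+ 4]. The number 5 is four factors for [D ^+ 2] plus one for
    [a]. *)
Lemma expr_le_quintic (t y a D : R) k : 0 <= t -> 0 <= y -> 1 <= a -> D != 0 ->
  D ^+ 2 * t ^+ (5 * k) <= y ^+ (5 * k) * a ->
  t ^+ k <= y ^+ k * (a + (Num.sqrt `|D|)^-1).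
Proof.
move=> t0 y0 a1 D0; rewrite mulnC !exprM.
move: (exprn_ge0 k t0) (exprn_ge0 k y0) => tk yk.
move: (t ^+ k) (y ^+ k) tk yk => {t0 y0 t} t {y} y t0 y0 h.
set h0 := Num.sqrt `|D|; have h0gt : 0 < h0 by rewrite sqrtr_gt0 normr_gt0.
have D2 : D ^+ 2 = h0 ^+ 4.
  by rewrite (exprM _ 2 2) sqr_sqrtr// real_normK// num_real.
rewrite leNgt; apply/negP => lt.
have ya : y * a < t by apply: le_lt_trans lt; rewrite mulrDr lerDl mulr_ge0// invr_ge0 ltW.
have yh : y < h0 * t.
  rewrite mulrC -ltr_pdivrMr//; apply: le_lt_trans lt.
  by rewrite mulrDr lerDr mulr_ge0//; lra.
have : (y * a) * y ^+ 4 < t * (h0 * t) ^+ 4.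
  apply: (@lt_le_trans _ _ (t * (h0 * t) ^+ 4)) => //.
  apply: ltr_pM => //; first by rewrite mulr_ge0//; lra.
    by rewrite exprn_ge0.
  by rewrite ltrXn2r.
apply/negP; rewrite -leNgt.
move: h; rewrite D2; clearbody h0 => h.
have -> : t * (h0 * t) ^+ 4 = h0 ^+ 4 * t ^+ 5 by ring.
by have -> : y * a * y ^+ 4 = y ^+ 5 * a by ring.
Qed.

Lemma all_moments_regressor t i : all_moments P (fun om => regressor om t i 0).
Proof.
rewrite (_ : (fun _ => _) = (fun om => \sum_k Gx i k * x om t k 0 +
    \sum_e Gu i e * g (t, e) om)); last first.
  apply/funext => om; rewrite /regressor !mxE; congr (_ + _).
  by apply: eq_bigr => e _; rewrite mxE.
apply: all_momentsD; apply: all_moments_sum => k _; apply: all_momentsZ.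
- exact: all_moments_traj.
- exact: all_moments_g.
Qed.

Definition gram_matrix N om : 'M[R]_q :=
  \sum_(1 <= t < N) regressor om t *m (regressor om t)^T.

(* Five independent blocks per power make the negative power of the determinants in
   [gram_bound] as small as the -1/2 available from [invsqrt_stage]. *)
Lemma negative_moments (r k : nat) : exists N0 (Z : T -> R),
  [/\ measurable_fun [set: T] Z, forall om, 0 <= Z om,
      (\int[P]_om (Z om)%:E < +oo)%E &
      {ae P, forall om, forall N (D Y : 'M[R]_(r, q)), (N0 <= N)%N ->
        D *m gram_matrix N om = Y -> nm D ^+ k <= nm Y ^+ k * Z om}].
Proof.
pose K := (5 * k)%N; pose M := (K * q)%N.
pose X b om := stage M b om.
pose a b om := (r * q)%:R * nm (\adj (X b om)) ^+ 2 + 1.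
have a1 b om : 1 <= a b om by rewrite lerDr mulr_ge0// sqr_ge0.
pose Aprod om := \prod_(b < K) a b om.
have Aprod1 om : 1 <= Aprod om.
  by rewrite /Aprod; elim/big_ind : _ => // u v u1 v1; rewrite mulr_ege1.
pose D0 om := stage_prod K M om.
pose h om : \bar R := invsqrt (D0 om).
have Qc c : all_moments P (fun=> c) by exact: all_moments_cst.
have QD (U V : T -> R) : all_moments P U -> all_moments P V ->
  all_moments P (fun om => U om + V om) by exact: all_momentsD.
have QM (U V : T -> R) : all_moments P U -> all_moments P V ->
  all_moments P (fun om => U om * V om) by exact: all_momentsM.
have aX b i j : all_moments P (fun om => X b om i j).
  rewrite /X /stage; case: (ltnP (b * q + j) M) => bj.
    rewrite (_ : (fun _ => _) = (fun om => regressor om (start (b * q + j) + L)%N i 0)).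
      exact: all_moments_regressor.
    by apply/funext => om; rewrite mxE bj.
  rewrite (_ : (fun _ => _) = fun=> (i == j)%:R)//.
  by apply/funext => om; rewrite mxE ltnNge bj.
have aA : all_moments P Aprod.
  apply: (closed_prod Qc QM) => b; apply: (QD _ _ _ (Qc 1)).
  apply: all_momentsZ; apply: all_momentsX.
  apply: (@bdd_moments_nm _ _ _ _ _ _ (fun=> (fun om => \adj (X b om)))) => i j.
  rewrite (_ : (fun _ _ => _) = (fun=> (fun om => cofactor (X b om) j i))); last first.
    by apply/funext => ?; apply/funext => om; rewrite mxE.
  exact: (closed_cofactor Qc QD QM).
have mD0 : measurable_fun setT D0.
  suff : all_moments P D0 by case=> /(_ 0%N).
  by apply: (closed_prod Qc QM) => b; exact: (closed_det Qc QD QM).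
have mh : measurable_fun setT h.
  by apply: measurableT_comp => //; exact: measurable_invsqrt.
have h0 om : (0 <= h om)%E by exact: invsqrt_ge0.
have hfin : (\int[P]_om h om < +oo)%E.
  by apply: le_lt_trans (@invsqrt_stage K M (leqnn _)) _; rewrite ltry.
have mA : measurable_fun setT Aprod by case: aA => /(_ 0%N).
have A0 om : 0 <= Aprod om by rewrite (le_trans _ (Aprod1 om)).
have fh0 om : 0 <= fine (h om) by rewrite fine_ge0.
have mfh : measurable_fun setT (fun om => fine (h om)).
  exact: measurableT_comp.
(* From this sample size on, every regressor used as a column occurs in the Gram matrix. *)
exists (start M + L)%N.+1, (fun om => Aprod om + fine (h om)); split.
- exact: measurable_funD.
- by move=> om; rewrite addr_ge0.
- under eq_integral do rewrite EFinD.
  rewrite ge0_integralD//; last 4 first.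
  + by move=> om _; rewrite lee_fin.
  + exact/measurable_EFinP.
  + by move=> om _; rewrite lee_fin.
  + exact/measurable_EFinP.
  apply: lte_add_pinfty; first by rewrite ExE// ltry.
  apply: le_lt_trans hfin; apply: ge0_le_integral => //.
  + by move=> om _; rewrite lee_fin.
  + exact/measurable_EFinP.
  + by move=> om _; case: (h om) (h0 om) => //= *; rewrite leey.
- have hae : P.-integrable setT h.
    apply/integrableP; split=> //.
    by under eq_integral do rewrite gee0_abs//.
  apply: filterS (integrable_ae measurableT hae) => om /(_ I) hom N D Y NN DS.
  (* Integrability makes [invsqrt] finite almost everywhere, which rules out a zero product of
     determinants. *)
  have D00 : D0 om != 0.
    by apply: contraTneq hom; rewrite /h => ->; rewrite /invsqrt eqxx.
  rewrite normr_fine_invsqrt//.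
  apply: expr_le_quintic => //; [exact: nm_ge0|exact: nm_ge0|].
  have each (b : 'I_K) : \det (X b om) ^+ 2 * nm D <= nm Y * a b om.
    apply: (@gram_bound _ _ _ (regressor om) N
      (fun c : 'I_q => start (b * q + c) + L)%N) => //.
    - move=> c1 c2 /eqP; rewrite eqn_add2r eqSS eqn_pmul2r// eqn_add2l => /eqP.
      exact: ord_inj.
    - move=> c; apply/andP; split; first by rewrite addSn.
      apply: leq_trans NN; rewrite ltnS leq_add2r /start ltnS leq_mul2r.
      apply/orP; right; apply: ltnW; rewrite /M.
      apply: leq_trans (_ : b.+1 * q <= _)%N; last by rewrite leq_mul2r ltn_ord orbT.
      by rewrite mulSn addnC ltn_add2r.
    - move=> i c; rewrite mxE /M.
      suff -> : (b * q + c < K * q)%N by [].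
      apply: leq_trans (_ : b.+1 * q <= _)%N; last by rewrite leq_mul2r ltn_ord orbT.
      by rewrite mulSn addnC ltn_add2r.
  have -> : D0 om ^+ 2 * nm D ^+ K = \prod_(b < K) (\det (X b om) ^+ 2 * nm D).
    by rewrite big_split/= prodr_const card_ord -prodrXl.
  have -> : nm Y ^+ (5 * k) * Aprod om = \prod_(b < K) (nm Y * a b om).
    by rewrite big_split/= prodr_const card_ord.
  apply: ler_prod => b _; rewrite each andbT.
  by rewrite mulr_ge0 ?sqr_ge0// nm_ge0.
Qed.

End NegativeMoments.

(** * Stationary covariance and the rate of least squares *)

Section StationaryCovariance.
Variable R : realType.

(** Quantitative duality: each basis vector is steered to from 0 by some input, and pairing [a] with
    the resulting sum expresses [a 0 i] through the rows [a A^k F]. The constant is the total size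
    of these inputs. *)
Lemma controllable_dual_bound n p (A : 'M[R]_n) (F : 'M[R]_(n, p)) :
  controllable A F -> exists (L : nat) (kap : R), 0 <= kap /\
    forall (a : 'rV[R]_n) i, `|a 0 i| <= kap * \sum_(k < L) nm (a *m A ^+ k *m F).
Proof.
move=> ctrl.
have /choice[f fE] : forall i : 'I_n, exists tv : nat * (nat -> 'cV[R]_p),
    lin_traj A (fun s => F *m tv.2 s) 0 tv.1 = delta_mx i 0.
  by move=> i; have [t [v tv]] := ctrl 0 (delta_mx i 0); exists (t, v).
pose L := \max_i (f i).1.
pose V i := \sum_(s < (f i).1) nm ((f i).2 s).
have V0 i : 0 <= V i by rewrite sumr_ge0// => s _; exact: nm_ge0.
exists L, (\sum_i V i); split=> [|a i]; first by rewrite sumr_ge0.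
have S0 : 0 <= \sum_(k < L) nm (a *m A ^+ k *m F).
  by rewrite sumr_ge0// => k _; exact: nm_ge0.
apply: (@le_trans _ _ (V i * \sum_(k < L) nm (a *m A ^+ k *m F))); last first.
  by rewrite ler_wpM2r// (bigD1 i)//= lerDl sumr_ge0.
have -> : a 0 i = (a *m lin_traj A (fun s => F *m (f i).2 s) 0 (f i).1) 0 0.
  rewrite fE mxE (bigD1 i)//= mxE !eqxx mulr1 big1 ?addr0// => j ji.
  by rewrite mxE (negbTE ji) mulr0.
rewrite lin_traj_sum mulmx_sumr (le_trans (le_nm_entry _ _ _))//.
rewrite (le_trans (nm_sum _ _ _))// mulr_suml; apply: ler_sum => s _.
rewrite !mulmxA (le_trans (nmM _ _))// mulrC ler_wpM2l ?nm_ge0//.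
have sL : ((f i).1 - s.+1 < L)%N.
  have lt : (0 < (f i).1)%N by rewrite (leq_trans _ (ltn_ord s)).
  apply: leq_trans (leq_bigmax i).
  by rewrite ltn_subrL.
by rewrite (bigD1 (Ordinal sL))//= lerDl sumr_ge0// => k _; exact: nm_ge0.
Qed.

Lemma le_small_eq0 (y C : R) : (forall e, 0 < e -> `|y| <= C * e) -> y = 0.
Proof.
move=> yC; apply/eqP; rewrite -normr_le0 leNgt; apply/negP => y0.
have C1 : 0 < `|C| + 1 by rewrite ltr_wpDl.
have := yC (`|y| / (2 * (`|C| + 1))) _; rewrite divr_gt0// ?mulr_gt0// => /(_ isT).
have : C * (`|y| / (2 * (`|C| + 1))) <= (`|C| + 1) * (`|y| / (2 * (`|C| + 1))).
  rewrite ler_wpM2r ?divr_ge0 ?mulr_ge0// ?ltW//.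
  by have := ler_norm C; lra.
have -> : (`|C| + 1) * (`|y| / (2 * (`|C| + 1))) = `|y| / 2.
  by field; rewrite gt_eqF.
by move: y0; lra.
Qed.

Variables (n p : nat) (A Sx : 'M[R]_n) (F : 'M[R]_(n, p)).
Hypothesis A_small : forall e : R, 0 < e -> exists N, forall k, (N <= k)%N -> nm (A ^+ k) <= e.
Hypothesis SxE : Sx = A *m Sx *m A^T + F *m F^T.

(** Iterating gives [D = A^k D (A^k)^T], which tends to 0. It yields the symmetry of [Sx], whose
    transpose solves the same equation. *)
Lemma lyapunov0 (D : 'M[R]_n) : D = A *m D *m A^T -> D = 0.
Proof.
move=> DE.
have DX k : D = A ^+ k *m D *m (A ^+ k)^T.
  elim: k => [|k IH]; first by rewrite expr0 mul1mx trmx1 mulmx1.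
  by rewrite exprSr trmx_mul {1}IH {1}DE !mulmxA.
apply/matrixP => i j; rewrite [RHS]mxE; apply: (@le_small_eq0 _ (nm D)) => e e0.
have [N /(_ N (leqnn _)) hN] : exists N, forall k, (N <= k)%N -> nm (A ^+ k) <= Num.min e 1.
  by apply: A_small; rewrite lt_min e0/=.
apply: (@le_trans _ _ (nm (A ^+ N *m D *m (A ^+ N)^T))).
  by rewrite -DX le_nm_entry.
rewrite (le_trans (nmM _ _))// nm_tr.
have N0 := nm_ge0 (A ^+ N); have D0 := nm_ge0 D.
have h1 : nm (A ^+ N) <= e by rewrite (le_trans hN)// ge_min lexx.
have h2 : nm (A ^+ N) <= 1 by rewrite (le_trans hN)// ge_min lexx orbT.
have h3 := nmM (A ^+ N) D.
have h4 : nm (A ^+ N) * nm D <= nm D by rewrite ler_piMl.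
by rewrite (le_trans (ler_wpM2r N0 (le_trans h3 h4)))// ler_wpM2l.
Qed.

Lemma stationary_cov_sym : Sx^T = Sx.
Proof.
apply/eqP; rewrite -subr_eq0; apply/eqP/lyapunov0.
have SxTE : Sx^T = A *m Sx^T *m A^T + F *m F^T.
  by rewrite {1}SxE raddfD/= !trmx_mul !trmxK !mulmxA.
rewrite {1}SxTE {2}SxE mulmxBr mulmxBl.
by rewrite opprD addrACA subrr addr0.
Qed.

Lemma stationary_cov_expand m : Sx =
  \sum_(k < m) (A ^+ k *m F) *m (A ^+ k *m F)^T + A ^+ m *m Sx *m (A ^+ m)^T.
Proof.
elim: m => [|m IH]; first by rewrite big_ord0 add0r expr0 mul1mx trmx1 mulmx1.
rewrite big_ord_recr/= {1}IH -addrA; congr (_ + _).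
rewrite {1}SxE mulmxDr mulmxDl addrC !trmx_mul !mulmxA; congr (_ + _).
by rewrite exprSr trmx_mul !mulmxA.
Qed.

(** For [a] in the kernel, [a Sx a^T = 0] is a sum of squares [|a A^k F| ^ 2] plus a tail containing
    [Sx]. The tail is bounded by its size, which tends to 0, so all the squares vanish and
    controllability gives [a = 0]. *)
Lemma stationary_cov_unit : controllable A F -> Sx \in unitmx.
Proof.
case/controllable_dual_bound => L [kap [kap0 dual]].
rewrite -row_free_unit -kermx_eq0; apply/rowV0P => a /sub_kermxP aS.
have zero k : a *m A ^+ k *m F = 0.
  apply: sqF_eq0; pose C := nm a ^+ 2 * nm Sx; apply: (@le_small_eq0 _ C) => e e0.
  have [N hN] : exists N, forall k, (N <= k)%N -> nm (A ^+ k) <= Num.min e 1.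
    by apply: A_small; rewrite lt_min e0/=.
  pose m := (N + k.+1)%N; have {}hN := hN m (leq_addr _ _).
  have h1 : nm (A ^+ m) <= e by rewrite (le_trans hN)// ge_min lexx.
  have h2 : nm (A ^+ m) <= 1 by rewrite (le_trans hN)// ge_min lexx orbT.
  have km : (k < m)%N by rewrite /m addnS ltnS leq_addl.
  have : \tr (a *m Sx *m a^T) = 0 by rewrite aS mul0mx mxtrace0.
  rewrite (stationary_cov_expand m) mulmxDr mulmxDl raddfD/= mulmx_sumr mulmx_suml.
  rewrite raddf_sum/=.
  have sE l : \tr (a *m (A ^+ l *m F *m (A ^+ l *m F)^T) *m a^T) =
      sqF (a *m A ^+ l *m F).
    by rewrite sqFE; congr mxtrace; rewrite !trmx_mul !mulmxA.
  under eq_bigr do rewrite sE.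
  rewrite (bigD1 (Ordinal km))//= => /eqP; rewrite -addrA addrC addr_eq0 => /eqP hs.
  have rest0 : 0 <= \sum_(i < m | i != Ordinal km) sqF (a *m A ^+ i *m F).
    by rewrite sumr_ge0// => i _; exact: sqF_ge0.
  rewrite ger0_norm ?sqF_ge0//.
  have : `|\tr (a *m (A ^+ m *m Sx *m (A ^+ m)^T) *m a^T)| <= C * e.
    rewrite /C -!mulmxA (le_trans (normr_mxtrace_le _ _))//.
    have -> : nm a ^+ 2 * nm Sx * e = nm a * (1 * (nm Sx * (e * nm a))) by ring.
    rewrite ler_wpM2l ?nm_ge0// (le_trans (nmM _ _))// ler_pM ?nm_ge0//.
    rewrite (le_trans (nmM _ _))// ler_wpM2l ?nm_ge0//.
    rewrite (le_trans (nmM _ _))// !nm_tr ler_wpM2r ?nm_ge0//.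
  rewrite ler_norml => /andP[+ _].
  have := sqF_ge0 (a *m A ^+ k *m F); lra.
apply/rowP => i; rewrite [RHS]mxE; apply/eqP; rewrite -normr_le0.
rewrite (le_trans (dual a i))// big1 ?mulr0// => k _.
by rewrite zero nm0.
Qed.

End StationaryCovariance.

Section GramDeviation.
Context d (T : measurableType d) (R : realType) (P : probability T R).
Variables (n p q : nat) (A : 'M[R]_n) (F : 'M[R]_(n, p)).
Variables (Gx : 'M[R]_(q, n)) (Gu : 'M[R]_(q, p)).
Variable g : nat * 'I_p -> T -> R.
Hypothesis mg : forall i, measurable_fun [set: T] (g i).
Hypothesis lawg : forall i (E : set R), measurable E ->
  P (g i @^-1` E) = normal_prob 0 1 E.
Hypothesis indep_g : forall (s : seq (nat * 'I_p)) (E : _ -> set R), uniq s ->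
  (forall i, measurable (E i)) ->
  P (\bigcap_(i in [set` s]) (g i @^-1` E i)) =
  (\prod_(i <- s) P (g i @^-1` E i))%E.
Hypothesis A_stable : forall e : R, 0 < e -> exists m, nm (A ^+ m.+1) <= e.
Variable Sx : 'M[R]_n.
Hypothesis Sx_stationary : Sx = A *m Sx *m A^T + F *m F^T.
Local Notation nu := (noise_vec g).
Local Notation x := (traj A F g).
Local Notation xi := (regressor A F Gx Gu g).
Local Notation cross := (cross_sum A F g).
Local Notation gram := (gram_matrix A F Gx Gu g).

(** One scalar dominating all fluctuations. The last summand accounts for time 0, which the
    martingale sums include and the Gram matrix omits. *)
Definition spread N om : R := nm (x om N) ^+ 2 + nm (cross N om)
  + nm (noise_dev g N om) + nm (nu 0 om) ^+ 2.

Lemma spread_ge0 N om : 0 <= spread N om.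
Proof. by rewrite !addr_ge0 ?sqr_ge0 ?nm_ge0. Qed.

Lemma bdd_moments_invsqrtn (X : nat -> T -> R) : bdd_moments P X ->
  bdd_moments P (fun N om => (Num.sqrt N%:R)^-1 * X N om).
Proof.
move=> bX; apply: bdd_momentsM => //; apply: (@bdd_moments_cst _ _ _ _ _ 1) => -[|N].
  by rewrite sqrtr0 invr0 normr0.
rewrite ger0_norm ?invr_ge0 ?sqrtr_ge0// invf_le1 ?sqrtr_gt0//.
by rewrite -[leLHS]sqrtr1 ler_wsqrtr// ler1n.
Qed.

Lemma bdd_moments_spread :
  bdd_moments P (fun N om => (Num.sqrt N%:R)^-1 * spread N om).
Proof.
rewrite (_ : (fun _ _ => _) = (fun N om =>
  (Num.sqrt N%:R)^-1 * (nm (x om N) ^+ 2) + (Num.sqrt N%:R)^-1 * nm (cross N om)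
  + (Num.sqrt N%:R)^-1 * nm (noise_dev g N om)
  + (Num.sqrt N%:R)^-1 * (nm (nu 0 om) ^+ 2))); last first.
  by apply/funext => N; apply/funext => om; rewrite /spread !mulrDr.
have bx : bdd_moments P (fun N om => nm (x om N)).
  apply: bdd_moments_nm => i j; rewrite ord1.
  exact: bdd_moments_traj.
have bn : bdd_moments P (fun N om => nm (nu 0 om)).
  apply: (@bdd_moments_nm _ _ _ _ _ _ (fun=> nu 0)) => i j.
  rewrite (_ : (fun _ _ => _) = (fun _ => g (0%N, i))); first exact: all_moments_g.
  by apply/funext => ?; apply/funext => om; rewrite mxE.
apply: bdd_momentsD; [apply: bdd_momentsD; [apply: bdd_momentsD|]|].
- by apply: bdd_moments_invsqrtn; exact: bdd_momentsX.
- exact: bdd_moments_cross_sum.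
- exact: bdd_moments_noise_dev.
- by apply: bdd_moments_invsqrtn; exact: bdd_momentsX.
Qed.

Definition regressor_cov := Gx *m Sx *m Gx^T + Gu *m Gu^T.

Let sum_nu N om : \sum_(0 <= t < N) nu t om *m (nu t om)^T =
  noise_dev g N om + N%:R *: 1%:M.
Proof.
rewrite /noise_dev sumrB sumr_const_nat subn0.
by rewrite scaler_nat subrK.
Qed.

Let xi0 om : xi om 0 = Gu *m nu 0 om.
Proof. by rewrite /regressor /traj /= mulmx0 add0r. Qed.

Lemma gram_dev N om : (0 < N)%N -> gram N om - N%:R *: regressor_cov =
  Gx *m state_dev A F g Sx N om *m Gx^T
  + (Gx *m cross N om *m Gu^T + (Gx *m cross N om *m Gu^T)^T)
  + Gu *m noise_dev g N om *m Gu^T - (Gu *m nu 0 om) *m (Gu *m nu 0 om)^T.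
Proof.
move=> N0.
have -> : gram N om = \sum_(0 <= t < N) xi om t *m (xi om t)^T -
    (Gu *m nu 0 om) *m (Gu *m nu 0 om)^T.
  by rewrite /gram_matrix [X in _ = X - _]big_ltn// xi0 addrAC subrr add0r.
have -> : \sum_(0 <= t < N) xi om t *m (xi om t)^T =
    Gx *m (\sum_(0 <= t < N) x om t *m (x om t)^T) *m Gx^T
    + (Gx *m cross N om *m Gu^T + (Gx *m cross N om *m Gu^T)^T)
    + Gu *m (\sum_(0 <= t < N) nu t om *m (nu t om)^T) *m Gu^T.
  rewrite !(mulmx_sumr, mulmx_suml) raddf_sum/= -!big_split/=.
  apply: eq_bigr => t _; rewrite /regressor.
  have -> : (Gx *m x om t + Gu *m nu t om)^T = (Gx *m x om t)^T + (Gu *m nu t om)^T.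
    by rewrite raddfD.
  rewrite mulmxDl !mulmxDr !trmx_mul !trmxK !mulmxA -!addrA; congr (_ + _).
rewrite sum_nu /state_dev /regressor_cov.
rewrite !(mulmxDr, mulmxDl, mulmxBr, mulmxBl, mulmxN, mulNmx) scalerDr -!scalemxAr -!scalemxAl.
rewrite mulmx1.
move: (Gx *m (\sum_(0 <= t < N) _) *m Gx^T) (Gx *m cross N om *m Gu^T).
move: (_ *m noise_dev g N om *m _) (Gx *m Sx *m Gx^T) (Gu *m Gu^T) => a b c.
move: (Gu *m nu 0 om *m _) => e f h.
by apply/matrixP => i j; rewrite !mxE; ring.
Qed.

Let spread_parts N om : [/\ nm (x om N) ^+ 2 + nm (cross N om) + nm (noise_dev g N om) <=
  spread N om,
  nm (cross N om) <= spread N om, nm (noise_dev g N om) <= spread N om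
  & nm (nu 0 om) ^+ 2 <= spread N om].
Proof.
have x0 := sqr_ge0 (nm (x om N)); have c0 := nm_ge0 (cross N om).
have v0 := nm_ge0 (noise_dev g N om); have u0 := sqr_ge0 (nm (nu 0 om)).
by split; rewrite /spread; move: x0 c0 v0 u0; lra.
Qed.

Let nmMM m0 m1 m2 m3 (L : 'M[R]_(m0, m1)) (M : 'M[R]_(m1, m2)) (K : 'M[R]_(m3, m2)) s :
  nm M <= s -> nm (L *m M *m K^T) <= nm L * nm K * s.
Proof.
move=> Ms; rewrite (le_trans (nmM _ _))// nm_tr mulrAC ler_wpM2r ?nm_ge0//.
by rewrite (le_trans (nmM _ _))// ler_wpM2l ?nm_ge0.
Qed.

Lemma nm_gram_dev_le : exists2 C : R, 0 <= C & forall N om, (0 < N)%N ->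
  nm (gram N om - N%:R *: regressor_cov) <= C * spread N om.
Proof.
have [C C0 hC] := nm_state_dev_le g A_stable Sx_stationary.
have gx := nm_ge0 Gx; have gu := nm_ge0 Gu.
exists (nm Gx * nm Gx * C + (nm Gx * nm Gu + nm Gx * nm Gu) + nm Gu * nm Gu + nm Gu * nm Gu).
  by rewrite !addr_ge0 ?mulr_ge0.
move=> N om N0; rewrite gram_dev//.
have [s1 s2 s3 s4] := spread_parts N om.
have h2 := nmMM Gx Gu s2.
rewrite (le_trans (nmB _ _))// [leRHS]mulrDl lerD//; last first.
  rewrite (le_trans (nmM _ _))// nm_tr -expr2.
  apply: (@le_trans _ _ ((nm Gu * nm (nu 0 om)) ^+ 2)).
    by rewrite lerXn2r ?nnegrE ?nm_ge0 ?nmM// mulr_ge0 ?nm_ge0.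
  by rewrite exprMn expr2 ler_wpM2l ?mulr_ge0.
rewrite (le_trans (nmD _ _))// [leRHS]mulrDl lerD//; last exact: nmMM.
rewrite (le_trans (nmD _ _))// [leRHS]mulrDl lerD//.
  rewrite -mulrA; apply: nmMM.
  by rewrite (le_trans (hC _ _))// ler_wpM2l.
by rewrite (le_trans (nmD _ _))// nm_tr mulrDl lerD.
Qed.

Variables (r : nat) (Ew : 'M[R]_(r, p)).
Hypothesis EwGu : Ew *m Gu^T = 0.

Definition noise_cross N om : 'M[R]_(r, q) :=
  \sum_(1 <= t < N) (Ew *m nu t om) *m (xi om t)^T.

Lemma nm_noise_cross_le : exists2 C : R, 0 <= C & forall N om, (0 < N)%N ->
  nm (noise_cross N om) <= C * spread N om.
Proof.
have gx := nm_ge0 Gx; have gu := nm_ge0 Gu; have ew := nm_ge0 Ew.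
exists (nm Ew * nm Gx + nm Ew * nm Gu + nm Ew * nm Gu).
  by rewrite !addr_ge0 ?mulr_ge0.
move=> N om N0.
have -> : noise_cross N om = Ew *m (cross N om)^T *m Gx^T
    + Ew *m noise_dev g N om *m Gu^T - (Ew *m nu 0 om) *m (Gu *m nu 0 om)^T.
  have -> : noise_cross N om = \sum_(0 <= t < N) (Ew *m nu t om) *m (xi om t)^T
      - (Ew *m nu 0 om) *m (Gu *m nu 0 om)^T.
    by rewrite /noise_cross [X in _ = X - _]big_ltn// xi0 addrAC subrr add0r.
  congr (_ - _).
  (* The mean [N%:R *: 1%:M] of the noise products is annihilated by [EwGu], so that the cross term
     is pure fluctuation. *)
  have -> : Ew *m noise_dev g N om *m Gu^T =
      Ew *m (\sum_(0 <= t < N) nu t om *m (nu t om)^T) *m Gu^T.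
    rewrite sum_nu mulmxDr mulmxDl -scalemxAr -scalemxAl mulmx1 EwGu scaler0.
    by rewrite addr0.
  rewrite raddf_sum/= !(mulmx_sumr, mulmx_suml) -big_split/=.
  apply: eq_bigr => t _; rewrite /regressor.
  have -> : (Gx *m x om t + Gu *m nu t om)^T = (Gx *m x om t)^T + (Gu *m nu t om)^T.
    by rewrite raddfD.
  by rewrite mulmxDr !trmx_mul !trmxK !mulmxA.
have [s1 s2 s3 s4] := spread_parts N om.
rewrite (le_trans (nmB _ _))// [leRHS]mulrDl lerD//; last first.
  rewrite (le_trans (nmM _ _))// nm_tr.
  apply: (@le_trans _ _ (nm Ew * nm (nu 0 om) * (nm Gu * nm (nu 0 om)))).
    by rewrite ler_pM ?nm_ge0 ?nmM.
  by rewrite mulrACA -expr2 ler_wpM2l ?mulr_ge0.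
rewrite (le_trans (nmD _ _))// [leRHS]mulrDl lerD//; last exact: nmMM.
by apply: nmMM; rewrite nm_tr.
Qed.

End GramDeviation.

(** Separates a factor with all moments from one that is merely integrable: [b * z] could not be
    integrated, [b + z] can. *)
Lemma pow_le_add_of_sqr (R : realDomainType) (u b z : R) :
  0 <= b -> 0 <= z -> u ^+ 2 <= b * z -> u <= b + z.
Proof.
move=> b0 z0 h; rewrite leNgt; apply/negP => lt.
have : (b + z) ^+ 2 < u ^+ 2 by rewrite ltrXn2r// ?nnegrE; lra.
apply/negP; rewrite -leNgt (le_trans h)// sqrrD.
have := sqr_ge0 b; have := sqr_ge0 z; have := mulr_ge0 b0 z0; lra.
Qed.

(* [r] stands for [sqrt N] and [V] for the normalised spread: on the event that the
   Gram matrix is ill-conditioned the spread is large, which pays for [Z]. *)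
Lemma rate_dichotomy (R : realFieldType) (r t V a C eta Z : R) k :
  0 < r -> 0 <= t -> 0 <= V -> 0 <= a -> 0 <= C -> 0 < eta -> 0 <= Z ->
  (C * (r * V) <= eta * r ^+ 2 -> r * t <= a * V) ->
  t ^+ (2 * k) <= (C * (r * V)) ^+ (2 * k) * Z ->
  (r * t) ^+ k <= a ^+ k * V ^+ k + C ^+ (6 * k) / eta ^+ (4 * k) * V ^+ (6 * k) + Z.
Proof.
move=> r0 t0 V0 a0 C0 eta0 Z0 good bad.
have b0 : 0 <= C ^+ (6 * k) / eta ^+ (4 * k) * V ^+ (6 * k).
  by rewrite mulr_ge0 ?divr_ge0 ?exprn_ge0// ltW.
have [/good h|h] := leP (C * (r * V)) (eta * r ^+ 2).
  rewrite -addrA (le_trans (_ : _ <= a ^+ k * V ^+ k))// -?exprMn.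
    by rewrite lerXn2r ?nnegrE ?mulr_ge0// ltW.
  by rewrite lerDl addr_ge0.
have {good}h1 : 1 <= C * V / (eta * r).
  rewrite ler_pdivlMr ?mulr_gt0// mul1r -(ler_pM2r r0).
  by move: h; rewrite expr2 => /ltW; rewrite mulrA (mulrC C) -!mulrA => h; lra.
rewrite -addrA (le_trans (pow_le_add_of_sqr b0 Z0 _))//; last first.
  by rewrite lerDr mulr_ge0 ?exprn_ge0.
have rt : 0 <= r ^+ (2 * k) by rewrite exprn_ge0// ltW.
rewrite -exprM mulnC exprMn.
apply: (@le_trans _ _ (r ^+ (2 * k) * ((C * (r * V)) ^+ (2 * k) * Z))).
  by rewrite ler_wpM2l.
rewrite [leLHS]mulrA ler_wpM2r//.
have CV : 0 <= C * V / (eta * r) by rewrite (le_trans _ h1).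
(* The power [4 * k] of [h1] is the one that cancels [r ^+ (2 * k) * r ^+ (2 * k)]; it produces the
   exponents [6 * k] and [4 * k] of the statement. *)
apply: (@le_trans _ _ (r ^+ (2 * k) * (C * (r * V)) ^+ (2 * k) * (C * V / (eta * r)) ^+ (4 * k))).
  have r1 := ltW r0.
  by rewrite ler_peMr ?mulr_ge0 ?exprn_ge0 ?mulr_ge0// ?exprn_ege1.
rewrite le_eqVlt; apply/orP; left; apply/eqP.
have -> : (4 * k = 2 * k + 2 * k)%N by rewrite -mulnDl.
have -> : (6 * k = 2 * k + 2 * k + 2 * k)%N by rewrite -!mulnDl.
move: (2 * k)%N => m; rewrite -exprVn invfM !exprMn !exprD.
have rr : r ^+ m * r^-1 ^+ m = 1 by rewrite -exprMn divff ?gt_eqF// expr1n.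
move: rr.
move: (r ^+ _) (r^-1 ^+ _) (C ^+ _) (V ^+ _) (eta^-1 ^+ _) => x y c v e xy.
transitivity ((x * y) ^+ 2 * (c ^+ 3 * v ^+ 3 * e ^+ 2)); first by ring.
by rewrite xy; ring.
Qed.

Lemma absorb_half (R : realFieldType) (t v e x s C : R) :
  t * x ^+ 2 * (e * s) <= t * x ^+ 2 * 2^-1 ->
  x ^+ 2 * t <= (C * (x * v) + t * (e * x ^+ 2)) * s ->
  x * (x * t) <= x * (2 * s * C * v).
Proof.
rewrite expr2 => e1 e2.
have : x * (x * t) <= C * (x * v) * s + t * (x * x) / 2.
  rewrite [leLHS]mulrA (le_trans e2)// mulrDl lerD2l (le_trans _ e1)//.
  by rewrite le_eqVlt; apply/orP; left; apply/eqP; ring.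
have -> : x * (2 * s * C * v) = 2 * (C * (x * v) * s) by ring.
have -> : x * (x * t) = t * (x * x) by ring.
lra.
Qed.

Section LeastSquaresRate.
Context d (T : measurableType d) (R : realType) (P : probability T R).
Variables (n p q : nat) (A : 'M[R]_n) (F : 'M[R]_(n, p)).
Variables (Gx : 'M[R]_(q, n)) (Gu : 'M[R]_(q, p)).
Variable g : nat * 'I_p -> T -> R.
Hypothesis mg : forall i, measurable_fun [set: T] (g i).
Hypothesis lawg : forall i (E : set R), measurable E ->
  P (g i @^-1` E) = normal_prob 0 1 E.
Hypothesis indep_g : forall (s : seq (nat * 'I_p)) (E : _ -> set R), uniq s ->
  (forall i, measurable (E i)) ->
  P (\bigcap_(i in [set` s]) (g i @^-1` E i)) =
  (\prod_(i <- s) P (g i @^-1` E i))%E.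
Hypothesis A_stable : forall e : R, 0 < e -> exists m, nm (A ^+ m.+1) <= e.
Variable Sx : 'M[R]_n.
Hypothesis Sx_stationary : Sx = A *m Sx *m A^T + F *m F^T.
Variables (L : nat) (kap : R).
Hypothesis nondegenerate : forall (c : 'rV[R]_q) i,
  `|c 0 i| <= kap * \sum_(r < L.+1) nm (fresh_coef A F Gx Gu c r).
Local Notation Sigma := (regressor_cov Gx Gu Sx).
Hypothesis Sigma_unit : Sigma \in unitmx.
Variables (r : nat) (D Y : nat -> T -> 'M[R]_(r, q)) (CY : R).
Hypothesis mD : forall N i j, measurable_fun [set: T] (fun om => D N om i j).
Hypothesis YC : forall N om, (0 < N)%N -> nm (Y N om) <= CY * spread A F g N om.
Hypothesis normal_eq : forall N,
  {ae P, forall om, D N om *m gram_matrix A F Gx Gu g N om = Y N om}.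

Lemma least_squares_rate :
  bdd_moments P (fun N om => Num.sqrt N%:R * nm (D N om)).
Proof.
have [C0 C00 hC0] := nm_gram_dev_le Gx Gu g A_stable Sx_stationary.
pose C := C0 + `|CY|.
have C_ge0 : 0 <= C by rewrite addr_ge0.
pose s := nm (invmx Sigma); have s0 : 0 <= s by exact: nm_ge0.
(* Chosen so that [eta * s <= 1/2]: when the Gram matrix is within [eta * N] of its mean, the error
   term containing [D] is absorbed. *)
pose eta := (2 * (s + 1))^-1.
have eta0 : 0 < eta by rewrite invr_gt0 mulr_gt0// ltr_wpDl.
pose a := 2 * s * C; have a0 : 0 <= a by rewrite !mulr_ge0.
pose V N om := (Num.sqrt N%:R)^-1 * spread A F g N om.
have [mV bV] : bdd_moments P V by exact: bdd_moments_spread.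
have V0 N om : 0 <= V N om by rewrite mulr_ge0 ?invr_ge0 ?sqrtr_ge0 ?spread_ge0.
have mnD N : measurable_fun setT (fun om => Num.sqrt N%:R * nm (D N om)).
  apply: measurable_funM => //; apply: measurable_sum => i; apply: measurable_sum => j.
  by apply: measurableT_comp => //; exact: normr_measurable.
split=> // k.
(* The doubled exponent provides the square required by [pow_le_add_of_sqr]. *)
have [N0 [Z [mZ Z0 Zfin Zae]]] := negative_moments mg lawg indep_g nondegenerate r (2 * k).
have [B1 [N1 hB1]] := bV k; have [B2 [N2 hB2]] := bV (6 * k)%N.
pose b := C ^+ (6 * k) / eta ^+ (4 * k).
have b0 : 0 <= b by rewrite divr_ge0 ?exprn_ge0// ltW.
exists (a ^+ k * B1 + b * B2 + fine (\int[P]_om (Z om)%:E)), (maxn 1 (maxn N0 (maxn N1 N2))) => N.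
rewrite !geq_max => /and4P[N_gt0 NN0 NN1 NN2].
set rN : R := Num.sqrt N%:R; have rN0 : 0 < rN by rewrite sqrtr_gt0 ltr0n.
have rN2 : rN ^+ 2 = N%:R by rewrite sqr_sqrtr// ler0n.
have VE om : spread A F g N om = rN * V N om.
  by rewrite /V -/rN mulrA divff ?mul1r// gt_eqF.
have key : {ae P, forall om, (`|rN * nm (D N om)| ^+ k)%:E <=
    (a ^+ k * `|V N om| ^+ k + b * `|V N om| ^+ (6 * k) + Z om)%:E}%E.
  apply: filterS2 (normal_eq N) Zae => om eqN /(_ N (D N om) (Y N om) NN0 eqN) hZ.
  rewrite lee_fin !ger0_norm ?mulr_ge0 ?nm_ge0 ?(ltW rN0)//.
  have hY : nm (Y N om) <= C * (rN * V N om).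
    rewrite -VE (le_trans (YC om N_gt0))// ler_wpM2r ?spread_ge0//.
    by rewrite (le_trans (ler_norm _))// lerDr.
  have hE := hC0 N om N_gt0.
  have {}hE : nm (gram_matrix A F Gx Gu g N om - N%:R *: Sigma) <= C * (rN * V N om).
    by rewrite -VE (le_trans hE)// ler_wpM2r ?spread_ge0// lerDl.
  apply: rate_dichotomy => //; first exact: nm_ge0.
  - move=> good.
    have eqD : N%:R *: D N om = (Y N om - D N om *m (gram_matrix A F Gx Gu g N om - N%:R *: Sigma))
        *m invmx Sigma.
      rewrite mulmxBr eqN opprB addrC subrK -scalemxAr -scalemxAl.
      by rewrite -mulmxA mulmxV// mulmx1.
    have t0 := nm_ge0 (D N om).
    have : rN ^+ 2 * nm (D N om) <= (C * (rN * V N om) + nm (D N om) * (eta * rN ^+ 2)) * s.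
      rewrite rN2 -[X in X * _](ger0_norm (ler0n _ _)) -nmZ eqD (le_trans (nmM _ _))//.
      rewrite ler_wpM2r// (le_trans (nmB _ _))// lerD// (le_trans (nmM _ _))//.
      by rewrite ler_wpM2l// (le_trans hE)// -rN2.
    have es : eta * s <= 2^-1.
      rewrite /eta invfM -mulrA ler_piMr ?invr_ge0// mulrC ler_pdivrMr ?mul1r ?ltr_wpDl//.
      by rewrite lerDl.
    have : nm (D N om) * rN ^+ 2 * (eta * s) <= nm (D N om) * rN ^+ 2 * 2^-1.
      by rewrite ler_wpM2l// mulr_ge0// exprn_ge0// ltW.
    move=> e1 e2.
    rewrite -(ler_pM2l rN0) /a.
    exact: absorb_half e1 e2.
  - apply: le_trans hZ _; rewrite ler_wpM2r//.
    have CV0 : 0 <= C * (rN * V N om).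
      by apply: mulr_ge0 => //; apply: mulr_ge0; [exact: ltW|exact: V0].
    by apply: lerXn2r => //; rewrite nnegrE nm_ge0.
  - exact: spread_ge0.
have mint : measurable_fun setT (fun om => (a ^+ k * `|V N om| ^+ k + b * `|V N om| ^+ (6 * k)
  + Z om)%:E).
  apply/measurable_EFinP; apply: measurable_funD => //; apply: measurable_funD;
    apply: measurable_funM => //;
  by apply: measurable_funX; apply: measurableT_comp (mV N); exact: normr_measurable.
have mVk j : measurable_fun [set: T] (fun om => (`|V N om| ^+ j)%:E).
  exact: measurable_moment.
have Vk0 j om : (0 <= (`|V N om| ^+ j)%:E)%E by rewrite lee_fin exprn_ge0.
apply: (@le_trans _ _ (\int[P]_om (a ^+ k * `|V N om| ^+ k + b * `|V N om| ^+ (6 * k) + Z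
  om)%:E)%E).
  apply: ae_ge0_le_integral => //.
  - exact: measurable_moment (mnD N).
  - by move=> om _; rewrite lee_fin; apply: addr_ge0 => //; apply: addr_ge0;
      apply: mulr_ge0 => //; exact: exprn_ge0.
  - by apply: filterS key => om h _.
have ak0 : (0 <= a ^+ k)%R by rewrite exprn_ge0.
under eq_integral do rewrite !EFinD !EFinM.
have mZE : measurable_fun setT (fun om => (Z om)%:E) by exact/measurable_EFinP.
rewrite ge0_integralD//; last 3 first.
- by move=> om _; rewrite adde_ge0// mule_ge0.
- by apply: emeasurable_funD; apply: measurable_funeM.
- by move=> om _; rewrite lee_fin.
rewrite ge0_integralD//; last 4 first.
- by move=> om _; rewrite mule_ge0.
- exact: measurable_funeM.
- by move=> om _; rewrite mule_ge0.
- exact: measurable_funeM.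
rewrite !ge0_integralZl_EFin//.
rewrite !EFinD fineK; last first.
  by rewrite ge0_fin_numE// integral_ge0// => om _; rewrite lee_fin.
rewrite !EFinM; apply: leeD => //; apply: leeD; apply: lee_wpmul2l => //.
- exact: hB1.
- exact: hB2.
Qed.

End LeastSquaresRate.

(** * Rollout of a perturbed predictor *)

Section NormalEquations.
Variable R : realType.
Variables dx du : nat.

Lemma sqF_subZ m n (M N : 'M[R]_(m, n)) s :
  sqF (M - s *: N) = sqF M - 2 * s * \tr (M *m N^T) + s ^+ 2 * sqF N.
Proof.
have trB : (M - s *: N)^T = M^T - s *: N^T by rewrite raddfB/= linearZ.
rewrite !sqFE trB mulmxBl !mulmxBr -!(scalemxAl, scalemxAr) !raddfB/= !mxtraceZ.
have -> : \tr (N *m M^T) = \tr (M *m N^T).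
  by rewrite -(mxtrace_tr (N *m M^T)) trmx_mul trmxK.
by ring.
Qed.

(** With [C] the correlation of residuals and regressors, moving [G] by [s *: C] changes the cost by
    [- 2 * s * sqF C + s ^+ 2 * q]. The choice [s = sqF C / (q + 1)], which also covers [q = 0],
    would lower the cost unless [C = 0]. *)
Lemma ls_normal_equations (x : nat -> 'cV[R]_dx) (u : nat -> 'cV[R]_du) N G :
  let xi t := col_mx (x t) (u t) in
  is_least_squares x u N G ->
  G *m \sum_(1 <= t < N) xi t *m (xi t)^T = \sum_(1 <= t < N) x t.+1 *m (xi t)^T.
Proof.
move=> xi lsG.
pose e t := x t.+1 - G *m xi t.
pose C := \sum_(1 <= t < N) e t *m (xi t)^T.
suff C0 : sqF C = 0.
  have := sqF_eq0 C0; rewrite /C /e.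
  under eq_bigr do rewrite mulmxBl.
  rewrite sumrB => /eqP; rewrite subr_eq0 => /eqP ->.
  by rewrite mulmx_sumr; apply: eq_bigr => t _; rewrite mulmxA.
pose q := \sum_(1 <= t < N) sqF (C *m xi t).
have q0 : 0 <= q by rewrite sumr_ge0// => t _; exact: sqF_ge0.
have costE s : ls_cost x u N (G + s *: C) =
    ls_cost x u N G - 2 * s * sqF C + s ^+ 2 * q.
  rewrite /ls_cost; under [LHS]eq_bigr => t _.
    rewrite normF_sqr mulmxDl opprD addrA -scalemxAl sqF_subZ; over.
  rewrite /= big_split/= sumrB -mulr_sumr; congr (_ - _ + _); last by rewrite mulr_sumr.
    by under [RHS]eq_bigr do rewrite normF_sqr.
  congr (_ * _); rewrite sqFE {1}/C mulmx_suml raddf_sum/=.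
  by apply: eq_bigr => t _; rewrite trmx_mul mulmxA.
have c0 := sqF_ge0 C; apply/eqP; rewrite eq_le c0 andbT leNgt; apply/negP => c1.
have q1 : 0 < q + 1 by rewrite ltr_wpDl.
have := lsG (G + (sqF C / (q + 1)) *: C); rewrite costE.
have : (sqF C / (q + 1)) ^+ 2 * q <= sqF C / (q + 1) * sqF C.
  have sC0 : 0 <= sqF C / (q + 1) by rewrite divr_ge0// ltW.
  rewrite expr2 -mulrA ler_wpM2l// mulrAC ler_pdivrMr// ler_wpM2l//.
  by rewrite lerDl.
have : 0 < sqF C / (q + 1) * sqF C by rewrite mulr_gt0// divr_gt0.
lra.
Qed.

End NormalEquations.

Section BlockAlgebra.
Variable R : realType.

Lemma blockrow_mul_tr m p n1 n2 (f : 'I_m -> 'M[R]_(n1, p)) (h : 'I_m -> 'M[R]_(n2, p)) :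
  blockrow f *m (blockrow h)^T = \sum_j f j *m (h j)^T.
Proof.
apply/matrixP => a b; rewrite summxE mxE.
under [RHS]eq_bigr do rewrite mxE.
rewrite pair_bigA/=.
rewrite (reindex (fun jk : 'I_m * 'I_p => mxtens_index jk))/=.
  by apply: eq_bigr => -[j k] _; rewrite !mxE mxtens_indexK.
exists (@mxtens_unindex m p) => [i _|i _]; first exact: mxtens_indexK.
exact: mxtens_unindexK.
Qed.

Lemma blockcol_mul m p n q (f : 'I_m -> 'M[R]_(p, n)) (M : 'M[R]_(n, q)) :
  blockcol f *m M = blockcol (fun i => f i *m M).
Proof. by apply/matrixP => a b; rewrite !mxE; apply: eq_bigr => k _; rewrite mxE. Qed.

Lemma mul_blockrow m p n q (f : 'I_m -> 'M[R]_(n, p)) (M : 'M[R]_(q, n)) :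
  M *m blockrow f = blockrow (fun i => M *m f i).
Proof. by apply/matrixP => a b; rewrite !mxE; apply: eq_bigr => k _; rewrite mxE. Qed.

Lemma sqF_blockcol m p n (f : 'I_m -> 'M[R]_(p, n)) :
  sqF (blockcol f) = \sum_i sqF (f i).
Proof.
rewrite /sqF [RHS]pair_bigA/= (reindex (fun jk : 'I_m * 'I_p => mxtens_index jk))/=.
  by apply: eq_bigr => -[j k] _; apply: eq_bigr => l _; rewrite mxE mxtens_indexK.
exists (@mxtens_unindex m p) => [i _|i _]; first exact: mxtens_indexK.
exact: mxtens_unindexK.
Qed.

Lemma tr_blockcol_mul m p n (f h : 'I_m -> 'M[R]_(p, n)) :
  \tr (blockcol f *m (blockcol h)^T) = \sum_i \tr (f i *m (h i)^T).
Proof.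
rewrite /mxtrace [RHS]pair_bigA/= (reindex (fun jk : 'I_m * 'I_p => mxtens_index jk))/=.
  apply: eq_bigr => -[j k] _; rewrite !mxE; apply: eq_bigr => l _.
  by rewrite !mxE mxtens_indexK.
exists (@mxtens_unindex m p) => [i _|i _]; first exact: mxtens_indexK.
exact: mxtens_unindexK.
Qed.

Lemma blockrow_mul_tens m p n (f : 'I_m -> 'M[R]_(n, p)) (M : 'M[R]_m) :
  blockrow f *m (M *t 1%:M) = blockrow (fun j => \sum_i M i j *: f i).
Proof.
apply/matrixP => a b; rewrite mxE [RHS]mxE summxE.
rewrite (reindex (fun jk : 'I_m * 'I_p => mxtens_index jk)); last first.
  exists (@mxtens_unindex m p) => [i _|i _]; first exact: mxtens_indexK.
  exact: mxtens_unindexK.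
transitivity (\sum_j \sum_k blockrow f a (mxtens_index (j, k)) *
  (M *t 1%:M) (mxtens_index (j, k)) b).
  by rewrite pair_bigA; apply: eq_bigr => -[j k].
apply: eq_bigr => j _; rewrite (bigD1 (mxtens_unindex b).2)//= big1 ?addr0.
  by rewrite !mxE !mxtens_indexK eqxx mulr1 mulrC.
by move=> k /negbTE kb; rewrite !mxE !mxtens_indexK/= kb !mulr0.
Qed.

End BlockAlgebra.

Section Rollout.
Variable R : realType.
Variables dx du H : nat.

(** The prediction [k] steps ahead as a function of [z_t]. Unlike in [rollout], the index is the
    horizon itself, and the projection onto [x_t] at [k = 0] starts the recursion [pred_rowS]. *)
Definition pred_row (Gy : 'M[R]_dx) (Gu : 'M[R]_(dx, du)) k : 'M[R]_(dx, dx + H * du) :=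
  row_mx (Gy ^+ k) (blockrow (fun j : 'I_H =>
    if (j < k)%N then Gy ^+ (k - j.+1) *m Gu else 0)).

Definition input_row k : 'M[R]_(du, dx + H * du) :=
  row_mx 0 (blockrow (fun j : 'I_H => if j == k :> nat then 1%:M else 0)).

Lemma rolloutE Gy Gu :
  rollout H Gy Gu = blockcol (fun i : 'I_H => pred_row Gy Gu i.+1).
Proof. by []. Qed.

Lemma pred_rowS Gy Gu k :
  pred_row Gy Gu k.+1 = Gy *m pred_row Gy Gu k + Gu *m input_row k.
Proof.
rewrite /pred_row /input_row !mul_mx_row mulmx0 add_row_mx addr0 exprS.
congr row_mx; rewrite !mul_blockrow.
transitivity (blockrow (fun j : 'I_H =>
    Gy *m (if (j < k)%N then Gy ^+ (k - j.+1) *m Gu else 0) +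
    Gu *m (if j == k :> nat then 1%:M else 0))); last first.
  by apply/matrixP => a b; rewrite !mxE.
congr blockrow; apply/funext => j; rewrite ltnS leq_eqVlt; case: eqP => [->|_] /=.
  by rewrite ltnn subSS subnn expr0 mul1mx mulmx0 mulmx1 add0r.
case: ltnP => jk; last by rewrite !mulmx0 addr0.
by rewrite mulmx0 addr0 subSS mulmxA -(subnSK jk) exprS.
Qed.

Variables (A : 'M[R]_dx) (B : 'M[R]_(dx, du)).

Definition regressor_row k := col_mx (pred_row A B k) (input_row k).

(** The derivative of the [k]-step predictor at [[A B]] in the direction [D]: an error made at step
    [l], on the noise-free regressor of that step, is propagated by [A]. *)
Definition linear_error (D : 'M[R]_(dx, dx + du)) k : 'M[R]_(dx, dx + H * du) :=
  \sum_(l < k) A ^+ (k - l.+1) *m D *m regressor_row l.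

Lemma linear_errorS D k :
  linear_error D k.+1 = A *m linear_error D k + D *m regressor_row k.
Proof.
rewrite /linear_error big_ord_recr/= subnn expr0 mul1mx mulmx_sumr; congr (_ + _).
apply: eq_bigr => l _; rewrite !mulmxA subSS; congr (_ *m _ *m _).
by rewrite -(subnSK (ltn_ord l)) exprS.
Qed.

Lemma pred_row_error (G : 'M[R]_(dx, dx + du)) k (D := G - row_mx A B)
    (delta := fun k => pred_row (lsubmx G) (rsubmx G) k - pred_row A B k) :
  delta k.+1 = A *m delta k + D *m regressor_row k + lsubmx D *m delta k.
Proof.
rewrite /delta !pred_rowS /D.
have -> : lsubmx (G - row_mx A B) = lsubmx G - A by rewrite raddfB/= row_mxKl.
have -> : (G - row_mx A B) *m regressor_row k =
    lsubmx G *m pred_row A B k + rsubmx G *m input_row k -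
    (A *m pred_row A B k + B *m input_row k).
  by rewrite mulmxBl /regressor_row mul_row_col -{1}[G]hsubmxK mul_row_col.
move: (lsubmx G) (rsubmx G) (pred_row A B k) (input_row k) => Gy Gu f v.
move: (pred_row Gy Gu k) => h; rewrite !(mulmxBl, mulmxBr).
move: (Gy *m h) (Gu *m v) (A *m h) (Gy *m f) (B *m v) (A *m f) => a b c e l o.
by apply/matrixP => i j; rewrite !mxE; ring.
Qed.

Lemma nm_lsubmx m n1 n2 (M : 'M[R]_(m, n1 + n2)) : nm (lsubmx M) <= nm M.
Proof.
rewrite /nm; apply: ler_sum => i _; rewrite big_split_ord/=.
under [X in X <= _]eq_bigr do rewrite mxE.
by rewrite lerDl sumr_ge0.
Qed.

Lemma nm_linear_error_le k : exists2 C, 0 <= C &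
  forall D, nm (linear_error D k) <= C * nm D.
Proof.
exists (\sum_(l < k) nm (A ^+ (k - l.+1)) * nm (regressor_row l)).
  by rewrite sumr_ge0// => l _; rewrite mulr_ge0 ?nm_ge0.
move=> D; rewrite (le_trans (nm_sum _ _ _))// mulr_suml; apply: ler_sum => l _.
rewrite mulrAC (le_trans (nmM _ _))// ler_wpM2r ?nm_ge0//.
exact: nmM.
Qed.

(** The recursion [pred_row_error] has the second-order term [lsubmx D *m delta k], so a first-order
    bound on [delta] is carried along in the induction. As [D] need not be small, powers of
    [1 + nm D] are kept. *)
Lemma rollout_expansion k : exists2 C, 0 <= C &
  forall (G : 'M[R]_(dx, dx + du)) (D := G - row_mx A B),
    nm (pred_row (lsubmx G) (rsubmx G) k - pred_row A B k - linear_error D k)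
    <= C * (nm D ^+ 2 * (1 + nm D) ^+ k).
Proof.
suff [C [E [C0 E0 hCE]]] : exists C E, [/\ 0 <= C, 0 <= E &
    forall (G : 'M[R]_(dx, dx + du)) (D := G - row_mx A B),
    nm (pred_row (lsubmx G) (rsubmx G) k - pred_row A B k) <= E * (nm D * (1 + nm D) ^+ k) /\
    nm (pred_row (lsubmx G) (rsubmx G) k - pred_row A B k - linear_error D k)
      <= C * (nm D ^+ 2 * (1 + nm D) ^+ k)].
  by exists C => // G; have [_] := hCE G.
elim: k => [|k [C [E [C0 E0 IH]]]].
  exists 0, 0; split=> // G D; have -> : pred_row (lsubmx G) (rsubmx G) 0 = pred_row A B 0.
    rewrite /pred_row !expr0; congr row_mx.
  by rewrite subrr /linear_error big_ord0 subr0 nm0 !mul0r.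
have A0 := nm_ge0 A; pose r := nm (regressor_row k); have r0 : 0 <= r by exact: nm_ge0.
exists (nm A * C + E), (nm A * E + r + E); split; rewrite ?addr_ge0 ?mulr_ge0// => G D.
have [h1 h2] := IH G; rewrite -/D in h1 h2.
have t0 := nm_ge0 D; have p1 : 1 <= (1 + nm D) ^+ k by rewrite exprn_ege1// lerDl.
have p0 : 0 <= (1 + nm D) ^+ k by rewrite (le_trans _ p1).
have dE := @pred_row_error G k; rewrite -/D in dE; cbv beta in dE.
have hl : nm (lsubmx D *m (pred_row (lsubmx G) (rsubmx G) k - pred_row A B k)) <=
    nm D * (E * (nm D * (1 + nm D) ^+ k)).
  by rewrite (le_trans (nmM _ _))// ler_pM ?nm_ge0 ?nm_lsubmx.
split.
  rewrite dE (le_trans (nmD _ _))// (le_trans (lerD (nmD _ _) (lexx _)))//.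
  rewrite (le_trans (lerD (lerD (nmM _ _) (nmM _ _)) hl))// -/r.
  rewrite (le_trans (lerD (lerD (ler_wpM2l A0 h1) (lexx _)) (lexx _)))// [(1 + nm D) ^+ k.+1]exprS.
  move: (nm D) (nm A) ((1 + nm D) ^+ k) A0 t0 p1 p0 => t a y A0 t0 p1 p0.
  have ty : 0 <= t * y by rewrite mulr_ge0.
  have q1 : 0 <= a * E * (t * (t * y)) by rewrite !mulr_ge0.
  have q2 : r * t <= r * (t * y) by rewrite ler_wpM2l// ler_peMr.
  have q3 : 0 <= r * (t * (t * y)) by rewrite !mulr_ge0.
  have q4 : 0 <= E * (t * y) by rewrite mulr_ge0.
  have -> : (a * E + r + E) * (t * ((1 + t) * y)) =
    a * (E * (t * y)) + r * (t * y) + t * (E * (t * y)) +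
    (a * E * (t * (t * y)) + r * (t * (t * y)) + E * (t * y)) by ring.
  lra.
rewrite dE linear_errorS.
have -> : A *m (pred_row (lsubmx G) (rsubmx G) k - pred_row A B k) + D *m regressor_row k +
   lsubmx D *m (pred_row (lsubmx G) (rsubmx G) k - pred_row A B k) -
   (A *m linear_error D k + D *m regressor_row k) =
   A *m (pred_row (lsubmx G) (rsubmx G) k - pred_row A B k - linear_error D k) +
   lsubmx D *m (pred_row (lsubmx G) (rsubmx G) k - pred_row A B k).
  rewrite (mulmxBr A _ (linear_error D k)).
  move: (A *m _) (D *m _) (lsubmx D *m _) (A *m linear_error D k) => a b c e.
  by apply/matrixP => i j; rewrite !mxE; ring.
rewrite (le_trans (nmD _ _))// (le_trans (lerD (nmM _ _) hl))//.
rewrite (le_trans (lerD (ler_wpM2l A0 h2) (lexx _)))// [(1 + nm D) ^+ k.+1]exprS.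
move: (nm D) (nm A) ((1 + nm D) ^+ k) A0 t0 p1 p0 => t a y A0 t0 p1 p0.
have q1 : 0 <= (a * C + E) * (t ^+ 3 * y).
  by rewrite mulr_ge0 ?addr_ge0 ?mulr_ge0// exprn_ge0.
have -> : (a * C + E) * (t ^+ 2 * ((1 + t) * y)) =
  a * (C * (t ^+ 2 * y)) + t * (E * (t * y)) + (a * C + E) * (t ^+ 3 * y) by ring.
by rewrite lerDl.
Qed.

End Rollout.

(** * Origin of the trace formula *)

Section LimitTrace.
Variable R : realType.
Variables (dx du H : nat) (A : 'M[R]_dx) (B : 'M[R]_(dx, du)) (Bw Sx : 'M[R]_dx).
Hypothesis Sx_stationary : is_stationary_cov A B Bw Sx.
Hypothesis Sx_sym : Sx^T = Sx.

Definition z_cov : 'M[R]_(dx + H * du) := block_mx Sx 0 0 1%:M.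
Local Notation phi := (pred_row H A B).
Local Notation psi := (regressor_row H A B).
Local Notation inp := (input_row R dx du H).

Lemma z_cov_row_mul m1 m2 (a : 'M[R]_(m1, dx)) (f : 'I_H -> 'M[R]_(m1, du))
    (b : 'M[R]_(m2, dx)) (h : 'I_H -> 'M[R]_(m2, du)) :
  row_mx a (blockrow f) *m z_cov *m (row_mx b (blockrow h))^T =
  a *m Sx *m b^T + \sum_j f j *m (h j)^T.
Proof.
rewrite /z_cov mul_row_block !mulmx0 addr0 add0r mulmx1 tr_row_mx mul_row_col.
by rewrite blockrow_mul_tr.
Qed.

Lemma z_cov_input (i j : 'I_H) :
  inp i *m z_cov *m (inp j)^T = (i == j)%:R%:M.
Proof.
rewrite z_cov_row_mul !mul0mx add0r (bigD1 i)//= eqxx mul1mx big1 ?addr0.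
  rewrite -val_eqE /=; case: eqP => _; rewrite ?trmx1 ?trmx0//.
  by apply/matrixP => a b; rewrite !mxE mul0rn.
by move=> k; rewrite -val_eqE /= => /negbTE ->; rewrite mul0mx.
Qed.

Lemma z_cov_input_pred s k : (k <= s)%N -> inp s *m z_cov *m (phi k)^T = 0.
Proof.
move=> ks; rewrite z_cov_row_mul !mul0mx add0r big1// => j _.
case: eqP => [->|_]; last by rewrite mul0mx.
by rewrite ltnNge ks trmx0 mulmx0.
Qed.

Lemma z_cov_sym : z_cov^T = z_cov.
Proof. by rewrite /z_cov tr_block_mx !trmx0 trmx1 Sx_sym. Qed.

Definition noise_gram k := \sum_(0 <= l < k) (A ^+ l *m Bw *m Bw^T *m (A ^+ l)^T).

(** In the stationary regime [x_{t+k}] is the noise-free prediction plus an uncorrelated noise term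
    of covariance [noise_gram k], and its total covariance is still [Sx]. *)
Lemma z_cov_pred k : (k <= H)%N -> phi k *m z_cov *m (phi k)^T = Sx - noise_gram k.
Proof.
elim: k => [|k IH] kH.
  rewrite z_cov_row_mul expr0 mul1mx trmx1 mulmx1 /noise_gram big_geq// subr0.
  by rewrite big1 ?addr0// => j _; rewrite mul0mx.
have eS : (phi k.+1)^T = (phi k)^T *m A^T + (inp k)^T *m B^T.
  by rewrite pred_rowS raddfD/= !trmx_mul.
have pi : phi k *m z_cov *m (inp k)^T = 0.
  have := congr1 trmx (z_cov_input_pred (leqnn k)).
  by rewrite !trmx_mul trmxK z_cov_sym trmx0 mulmxA.
have -> : phi k.+1 *m z_cov *m (phi k.+1)^T =
    A *m (phi k *m z_cov *m (phi k)^T) *m A^T + B *m (inp k *m z_cov *m (phi k)^T) *m A^T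
    + (A *m (phi k *m z_cov *m (inp k)^T) *m B^T + B *m (inp k *m z_cov *m (inp k)^T) *m B^T).
  by rewrite eS pred_rowS !(mulmxDl, mulmxDr) !mulmxA.
rewrite IH ?(ltnW kH)// pi z_cov_input_pred//.
rewrite (z_cov_input (Ordinal kH) (Ordinal kH)) eqxx !mulmx0 !mul0mx addr0 add0r mulmx1.
rewrite mulmxBr mulmxBl [X in _ = X - _]Sx_stationary.
have -> : noise_gram k.+1 = Bw *m Bw^T + A *m noise_gram k *m A^T.
  rewrite /noise_gram big_nat_recl// expr0 mul1mx trmx1 mulmx1; congr (_ + _).
  rewrite mulmx_sumr mulmx_suml; apply: eq_bigr => l _.
  by rewrite exprS trmx_mul !mulmxA.
move: (A *m Sx *m A^T) (_ *m noise_gram k *m _) (B *m _) (Bw *m _) => a b c e.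
by apply/matrixP => i j; rewrite !mxE; ring.
Qed.

Lemma z_cov_pred_shift k m : (k <= H)%N ->
  phi (k + m) *m z_cov *m (phi k)^T = A ^+ m *m (Sx - noise_gram k).
Proof.
move=> kH; elim: m => [|m IH]; first by rewrite addn0 expr0 mul1mx z_cov_pred.
have -> : phi (k + m.+1) *m z_cov *m (phi k)^T =
    A *m (phi (k + m) *m z_cov *m (phi k)^T) + B *m (inp (k + m) *m z_cov *m (phi k)^T).
  by rewrite addnS pred_rowS !mulmxDl !mulmxA.
by rewrite IH z_cov_input_pred ?leq_addr// mulmx0 addr0 mulmxA exprS.
Qed.

Lemma noise_gram_sym k : (noise_gram k)^T = noise_gram k.
Proof.
rewrite /noise_gram raddf_sum/=; apply: eq_bigr => l _.
by rewrite !trmx_mul !trmxK !mulmxA.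
Qed.

Hypothesis Sx_unit : Sx \in unitmx.

Lemma M_SS_entry (i j : 'I_H) : M_SS H A Bw Sx i j =
  \tr (invmx Sx *m (Sx - noise_gram (minn i j)) *m (A ^+ (maxn i j - minn i j))^T).
Proof. by rewrite mxE; congr mxtrace; rewrite mulmxBr mulVmx. Qed.

(** The state block yields the entry of [M_SS]. The input block contributes [du] on the diagonal
    only, since inputs at different times are uncorrelated. *)
Lemma limit_trace (i j : 'I_H) :
  \tr (block_mx (invmx Sx) 0 0 1%:M *m (psi i *m z_cov *m (psi j)^T)) =
  (M_SS H A Bw Sx + du%:R%:M) i j.
Proof.
have e : psi i *m z_cov *m (psi j)^T = block_mx (phi i *m z_cov *m (phi j)^T)
    (phi i *m z_cov *m (inp j)^T) (inp i *m z_cov *m (phi j)^T)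
    (inp i *m z_cov *m (inp j)^T).
  by rewrite /regressor_row mul_col_mx tr_col_mx mul_col_row.
rewrite e mulmx_block !mul0mx !add0r !addr0 !mul1mx mxtrace_block z_cov_input.
rewrite [RHS]mxE mxtrace_scalar [X in _ = _ + X]mxE; congr (_ + _); last first.
  by case: (i == j); rewrite ?mul0rn ?mulr1n ?mulr0n.
rewrite M_SS_entry; case: (leqP i j) => ij.
  have -> : phi i *m z_cov *m (phi j)^T = ((phi (i + (j - i))) *m z_cov *m (phi i)^T)^T.
    by rewrite subnKC// !trmx_mul trmxK z_cov_sym mulmxA.
  rewrite z_cov_pred_shift ?(ltnW (ltn_ord _))// trmx_mul mulmxA.
  congr (\tr (_ *m _ *m _)).
  by rewrite raddfB/= Sx_sym noise_gram_sym.
rewrite -{1}(subnKC (ltnW ij)) z_cov_pred_shift ?(ltnW (ltn_ord _))//.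
rewrite -mxtrace_tr !trmx_mul raddfB/= Sx_sym noise_gram_sym trmx_inv Sx_sym.
by rewrite mxtrace_mulC mulmxA.
Qed.

Lemma Gamma_trace (M : 'M[R]_H) :
  \tr (Gamma_w H A Bw *m (M *t 1%:M) *m (Gamma_w H A Bw)^T) =
  \sum_(i < H) \sum_(j < H | (j < i.+1)%N) \sum_(l < H | (l < i.+1)%N)
    \tr (A ^+ (i - j) *m Bw *m (A ^+ (i - l) *m Bw)^T) * M j l.
Proof.
rewrite {1}/Gamma_w blockcol_mul tr_blockcol_mul; apply: eq_bigr => i _.
rewrite blockrow_mul_tens blockrow_mul_tr raddf_sum/=.
transitivity (\sum_(l < H) \sum_(j < H) if (j < i.+1)%N && (l < i.+1)%N then
    \tr (A ^+ (i - j) *m Bw *m (A ^+ (i - l) *m Bw)^T) * M j l else 0).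
  apply: eq_bigr => l _; rewrite mulmx_suml [LHS]raddf_sum/=; apply: eq_bigr => j _.
  rewrite -scalemxAl mxtraceZ !ltnS mulrC.
  by do 2 case: ifP => _ //=; rewrite ?trmx0 ?mulmx0 ?mul0mx ?mxtrace0 ?mul0r.
rewrite exchange_big/= [RHS]big_mkcond/=; apply: eq_bigr => j _.
by case: ifP => _ /=; [rewrite [RHS]big_mkcond|rewrite big1].
Qed.

End LimitTrace.

(** * Second moments and the limit *)

Section SecondMoments.
Context d (T : measurableType d) (R : realType) (P : probability T R).
Variables (dx du : nat) (A : 'M[R]_dx) (B : 'M[R]_(dx, du)) (Bw : 'M[R]_dx).
Variable g : nat * 'I_(dx + du) -> T -> R.
Hypothesis mg : forall i, measurable_fun [set: T] (g i).
Hypothesis lawg : forall i (E : set R), measurable E ->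
  P (g i @^-1` E) = normal_prob 0 1 E.
Hypothesis indep_g : forall (s : seq (nat * 'I_(dx + du))) (E : _ -> set R), uniq s ->
  (forall i, measurable (E i)) ->
  P (\bigcap_(i in [set` s]) (g i @^-1` E i)) =
  (\prod_(i <- s) P (g i @^-1` E i))%E.

(** The noise vector stacks [w] above [u], whereas the regressor stacks [x] above [u]. These
    selectors write the regressor as a linear image of state and noise, and [noise_sel] extracts
    [w]. *)
Definition state_sel : 'M[R]_(dx + du, dx) := col_mx 1%:M 0.
Definition input_sel : 'M[R]_(dx + du) := block_mx 0 0 0 1%:M.
Definition noise_sel : 'M[R]_(dx, dx + du) := row_mx 1%:M 0.

Local Notation F := (row_mx Bw B).
Local Notation nu := (noise_vec g).
Local Notation x := (traj A F g).
Local Notation xi := (regressor A F state_sel input_sel g).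
Local Notation gram := (gram_matrix A F state_sel input_sel g).
Local Notation cross := (noise_cross A F state_sel input_sel g noise_sel).

Lemma noise_sel_input_sel : noise_sel *m input_sel^T = 0.
Proof.
by rewrite /noise_sel /input_sel tr_block_mx mul_row_block !trmx0 !(mul1mx, mul0mx, mulmx0)
  !addr0 row_mx0.
Qed.

Lemma regressorE om t : xi om t = col_mx (x om t) (dsubmx (nu t om)).
Proof.
rewrite /regressor; have -> : input_sel *m nu t om = col_mx 0 (dsubmx (nu t om)).
  rewrite -{1}[nu t om]vsubmxK mul_block_col.
  by rewrite !mul0mx !add0r mul1mx.
by rewrite mul_col_mx mul1mx mul0mx add_col_mx addr0 add0r.
Qed.

Lemma noise_sel_vec om t : noise_sel *m nu t om = usubmx (nu t om).
Proof.
by rewrite -{1}[nu t om]vsubmxK mul_row_col mul1mx mul0mx addr0.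
Qed.

Lemma state_wrt_compl t s e i : (t <= s)%N ->
  measurable_wrt g [set k | k <> (s, e)] (fun om => x om t i 0).
Proof.
move=> ts; apply: (@measurable_wrtS _ _ _ _ _ (past t)); last exact: traj_wrt.
by move=> -[t' e'] /=; rewrite /past/= => t't [t's _]; rewrite t's ltnNge ts in t't.
Qed.

(** Even at [t = s] the regressor contains only the input part of the noise, so it does not involve
    a coordinate of [w] at time [s]. *)
Lemma regressor_wrt_compl t s a b : (t <= s)%N ->
  measurable_wrt g [set k | k <> (s, lshift du a)] (fun om => xi om t b 0).
Proof.
move=> ts; rewrite -(splitK b); case: (fintype.split b) => j /=.
  rewrite (_ : (fun _ => _) = (fun om => x om t j 0)); first exact: state_wrt_compl.
  by apply/funext => om; rewrite regressorE col_mxEu.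
rewrite (_ : (fun _ => _) = g (t, rshift dx j)).
  by apply: measurable_wrt_g => e; have /eqP := congr1 snd e; rewrite /= eq_rlshift.
by apply/funext => om; rewrite regressorE col_mxEd !mxE.
Qed.

Let disj (i : nat * 'I_(dx + du)) : [set k | k <> i] `&` [set i] = set0.
Proof. by apply/seteqP; split => // k [h ki]; exact: h. Qed.

Let ag := all_moments_g mg lawg.

Lemma Ex_mul_noise0 X i : measurable_wrt g [set k | k <> i] X -> all_moments P X ->
  Ex P (fun om => X om * g i om) = 0.
Proof.
move=> mX aX; have mi : measurable_wrt g [set i] (g i) by exact: measurable_wrt_g.
by rewrite (Ex_indep mg indep_g (disj i) mX mi)// (Ex_std_normal (mg i) (lawg i)) mulr0.
Qed.

Lemma Ex_mul_noise_sqr X i : measurable_wrt g [set k | k <> i] X -> all_moments P X ->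
  Ex P (fun om => X om * g i om ^+ 2) = Ex P X.
Proof.
move=> mX aX.
have mi : measurable_wrt g [set i] (fun om => g i om ^+ 2).
  by apply: measurable_wrtX; exact: measurable_wrt_g.
rewrite (Ex_indep mg indep_g (disj i) mX mi)//; last exact: all_momentsX.
by rewrite (Ex_sqr_std_normal (mg i) (lawg i)) mulr1.
Qed.

Lemma Ex_noise_noise i j : Ex P (fun om => g i om * g j om) = (i == j)%:R.
Proof.
case: eqVneq => [->|/eqP ij]; last by apply: Ex_mul_noise0 => //; exact: measurable_wrt_g.
by rewrite -(Ex_sqr_std_normal (mg j) (lawg j)); congr Ex; apply/funext => om; rewrite expr2.
Qed.

Lemma all_moments_xi t b : all_moments P (fun om => xi om t b 0).
Proof. exact: all_moments_regressor. Qed.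

(** Orthogonality of martingale differences: for distinct indices, the noise coordinate at the later
    time, either one at equal times, is centred and independent of the remaining factors. *)
Lemma Ex_cross_term t s a a' b b' :
  Ex P (fun om => (g (t, lshift du a) om * xi om t b 0) *
                  (g (s, lshift du a') om * xi om s b' 0)) =
  ((t == s) && (a == a'))%:R * Ex P (fun om => xi om t b 0 * xi om s b' 0).
Proof.
have off t1 s1 a1 a2 b1 b2 : (t1 <= s1)%N -> (t1, a1) <> (s1, a2) ->
    Ex P (fun om => (g (t1, lshift du a1) om * xi om t1 b1 0) *
                    (g (s1, lshift du a2) om * xi om s1 b2 0)) = 0.
  move=> ts ne.
  rewrite (_ : (fun _ => _) = (fun om => (g (t1, lshift du a1) om * xi om t1 b1 0
      * xi om s1 b2 0) * g (s1, lshift du a2) om)); last first.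
    by apply/funext => om; rewrite -[RHS]mulrA; congr (_ * _); rewrite mulrC.
  apply: Ex_mul_noise0; last by do !apply: all_momentsM => //; exact: all_moments_xi.
  apply: measurable_wrtM; last exact: regressor_wrt_compl.
  apply: measurable_wrtM; last exact: regressor_wrt_compl.
  apply: measurable_wrt_g => e; apply: ne.
  by rewrite (congr1 fst e : t1 = s1) (lshift_inj (congr1 snd e)).
have [/andP[/eqP <- /eqP <-]|] := boolP ((t == s) && (a == a')).
  rewrite mul1r -(@Ex_mul_noise_sqr (fun om => xi om t b 0 * xi om t b' 0) (t, lshift du a)).
  - by congr Ex; apply/funext => om; ring.
  - by apply: measurable_wrtM; exact: regressor_wrt_compl.
  - by apply: all_momentsM; exact: all_moments_xi.
move=> ne; rewrite mul0r.
have {}ne : (t, a) <> (s, a') by case=> e1 e2; rewrite e1 e2 !eqxx in ne.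
have [ts|st] := leqP t s; first exact: off.
rewrite (_ : (fun _ => _) = (fun om => (g (s, lshift du a') om * xi om s b' 0) *
    (g (t, lshift du a) om * xi om t b 0))); last by apply/funext => om; rewrite mulrC.
by apply: off; [exact: ltnW|move=> e; apply: ne].
Qed.

Lemma cross_entry N om a b : cross N om a b =
  \sum_(1 <= t < N) g (t, lshift du a) om * xi om t b 0.
Proof.
rewrite /noise_cross summxE; apply: eq_bigr => t _.
by rewrite noise_sel_vec mxE big_ord1 !mxE.
Qed.

Lemma gram_entry N om b b' : gram N om b b' =
  \sum_(1 <= t < N) xi om t b 0 * xi om t b' 0.
Proof.
rewrite /gram_matrix summxE; apply: eq_bigr => t _.
by rewrite mxE big_ord1 [_^T _ _]mxE.
Qed.

Lemma all_moments_gram N b b' : all_moments P (fun om => gram N om b b').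
Proof.
rewrite (_ : (fun _ => _) = (fun om => \sum_(1 <= t < N) xi om t b 0 * xi om t b' 0)).
  by apply: all_moments_sum => t _; apply: all_momentsM; exact: all_moments_xi.
by apply/funext => om; rewrite gram_entry.
Qed.

Lemma all_moments_cross N a b : all_moments P (fun om => cross N om a b).
Proof.
rewrite (_ : (fun _ => _) = (fun om => \sum_(1 <= t < N) g (t, lshift du a) om * xi om t b 0)).
  by apply: all_moments_sum => t _; apply: all_momentsM => //; exact: all_moments_xi.
by apply/funext => om; rewrite cross_entry.
Qed.

Lemma Ex_cross_cross N a a' b b' :
  Ex P (fun om => cross N om a b * cross N om a' b') =
  (a == a')%:R * Ex P (fun om => gram N om b b').
Proof.
have aM t a1 b1 : all_moments P (fun om => g (t, lshift du a1) om * xi om t b1 0).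
  by apply: all_momentsM => //; exact: all_moments_xi.
transitivity (\sum_(1 <= t < N) \sum_(1 <= s < N)
   Ex P (fun om => (g (t, lshift du a) om * xi om t b 0) *
                  (g (s, lshift du a') om * xi om s b' 0))).
  rewrite (_ : (fun _ => _) = (fun om => \sum_(1 <= t < N) \sum_(1 <= s < N)
    ((g (t, lshift du a) om * xi om t b 0) * (g (s, lshift du a') om * xi om s b' 0)))).
    rewrite Ex_sum; last first.
      by move=> t _; apply: all_moments_sum => s _; exact: all_momentsM.
    by apply: eq_bigr => t _; rewrite Ex_sum// => s _; exact: all_momentsM.
  apply/funext => om; rewrite !cross_entry mulr_suml; apply: eq_bigr => t _.
  by rewrite mulr_sumr.
have -> : Ex P (fun om => gram N om b b') = \sum_(1 <= t < N) Ex P (fun om =>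
    xi om t b 0 * xi om t b' 0).
  rewrite -Ex_sum; last by move=> t _; apply: all_momentsM; exact: all_moments_xi.
  by congr Ex; apply/funext => om; rewrite gram_entry.
rewrite mulr_sumr; apply: eq_big_nat => t tN.
rewrite (bigD1_seq t)/= ?mem_index_iota ?iota_uniq// Ex_cross_term eqxx/=.
rewrite big1 ?addr0// => s st; rewrite Ex_cross_term.
by rewrite eq_sym (negbTE st) mul0r.
Qed.

(** The noise is isotropic: the expectation of [M K M^T] is a multiple of the identity, so [G]
    enters through its trace alone. The identity is exact for every [N]; only the mean of the Gram
    matrix remains to converge. *)
Lemma Ex_quadratic_cross N (G : 'M[R]_dx) (K : 'M[R]_(dx + du)) :
  Ex P (fun om => \tr (G *m (cross N om *m K *m (cross N om)^T))) =
  \tr G * \sum_b \sum_b' K b b' * Ex P (fun om => gram N om b b').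
Proof.
have aCC a a' b b' : all_moments P (fun om => cross N om a b * cross N om a' b').
  by apply: all_momentsM; exact: all_moments_cross.
rewrite (_ : (fun _ => _) = (fun om => \sum_a \sum_a' \sum_b \sum_b'
    G a a' * K b b' * (cross N om a' b * cross N om a b'))); last first.
  apply/funext => om; apply: eq_bigr => a _; rewrite mxE; apply: eq_bigr => a' _.
  rewrite mxE mulr_sumr exchange_big/=; apply: eq_bigr => b' _.
  rewrite mxE mulr_suml mulr_sumr; apply: eq_bigr => b _.
  by rewrite !mxE; ring.
rewrite Ex_sum; last first.
  by move=> a _; do !(apply: all_moments_sum => ? _); exact: all_momentsZ.
rewrite /mxtrace mulr_suml; apply: eq_bigr => a _.
rewrite Ex_sum; last first.
  by move=> a' _; do !(apply: all_moments_sum => ? _); exact: all_momentsZ.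
have inner a' : Ex P (fun om => \sum_b \sum_b' G a a' * K b b' *
    (cross N om a' b * cross N om a b')) =
    (a' == a)%:R * (G a a' * \sum_b \sum_b' K b b' * Ex P (fun om => gram N om b b')).
  rewrite Ex_sum; last by move=> b _; apply: all_moments_sum => ? _; exact: all_momentsZ.
  rewrite !mulr_sumr; apply: eq_bigr => b _.
  rewrite Ex_sum; last by move=> b' _; exact: all_momentsZ.
  rewrite !mulr_sumr; apply: eq_bigr => b' _.
  by rewrite ExZ// Ex_cross_cross; ring.
under eq_bigr do rewrite inner.
move: (\sum_b \sum_b' _) => s; rewrite (bigD1 a)//= eqxx mul1r big1 ?addr0// => a' /negbTE ->.
by rewrite mul0r.
Qed.

End SecondMoments.

Section ScaledExpectation.
Context d (T : measurableType d) (R : realType) (P : probability T R).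

Lemma cvg_invsqrtn : (fun N : nat => (Num.sqrt N%:R)^-1 : R) @ \oo --> (0 : R).
Proof.
apply/cvgrPdist_le => e e0; near=> N.
have N0 : e^-1 ^+ 2 <= N%:R by near: N; exact: nbhs_infty_ger.
have h : e^-1 <= Num.sqrt N%:R.
  have <- : Num.sqrt (e^-1 ^+ 2) = e^-1 by rewrite sqrtr_sqr ger0_norm// invr_ge0 ltW.
  exact: ler_wsqrtr.
rewrite sub0r normrN ger0_norm ?invr_ge0 ?sqrtr_ge0//.
have h0 : 0 < Num.sqrt N%:R :> R by rewrite (lt_le_trans _ h)// invr_gt0.
by rewrite -[leRHS]invrK lef_pV2 ?posrE ?invr_gt0.
Unshelve. all: by end_near. Qed.

Lemma invn_sqrt (N : nat) : (N%:R^-1 : R) = (Num.sqrt N%:R)^-1 * (Num.sqrt N%:R)^-1.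
Proof. by rewrite -invfM -expr2 sqr_sqrtr. Qed.

Lemma cvg_invn : (fun N : nat => N%:R^-1 : R) @ \oo --> (0 : R).
Proof.
rewrite -(mulr0 (0 : R)) (_ : (fun _ => _) = (fun N : nat => (Num.sqrt N%:R)^-1 * (Num.sqrt
  N%:R)^-1)).
  by apply: cvgM; exact: cvg_invsqrtn.
by apply/funext => N; exact: invn_sqrt.
Qed.

Lemma cvg_succn_ratio : (fun N : nat => N%:R^-1 * N.+1%:R : R) @ \oo --> (1 : R).
Proof.
have h : (fun N : nat => 1 + N%:R^-1 : R) @ \oo --> (1 + 0 : R).
  by apply: cvgD; [exact: cvg_cst|exact: cvg_invn].
rewrite addr0 in h; apply: cvg_trans h; apply: near_eq_cvg; near=> N.
have N0 : (0 < N)%N by near: N; exact: nbhs_infty_gt.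
by rewrite -[N.+1%:R]natr1 mulrDr mulr1 mulVf// pnatr_eq0 -lt0n.
Unshelve. all: by end_near. Qed.

Lemma cvg_Ex_scaled (X : nat -> T -> R) : (forall N, all_moments P (X N)) ->
  bdd_moments P (fun N om => (Num.sqrt N%:R)^-1 * X N om) ->
  (fun N => N%:R^-1 * Ex P (X N)) @ \oo --> 0.
Proof.
move=> aX [_ /(_ 1%N)[C [N0 hC]]].
have bound N : (N0 <= N)%N -> `|N%:R^-1 * Ex P (X N)| <= C * (Num.sqrt N%:R)^-1.
  move=> NN; set r := (Num.sqrt N%:R)^-1.
  have r0 : 0 <= r by rewrite invr_ge0 sqrtr_ge0.
  have aY : all_moments P (fun om => r * X N om) by exact: all_momentsZ.
  have aYn : all_moments P (fun om => `|r * X N om|) by exact: bdd_moments_norm.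
  have h1 : Ex P (fun om => `|r * X N om|) <= C.
    rewrite -lee_fin -ExE//; have := hC _ NN.
    by under eq_integral do rewrite expr1.
  have h2 : `|Ex P (fun om => r * X N om)| <= C.
    rewrite ler_norml lerNl; apply/andP; split.
      rewrite -ExN//; apply: le_trans h1; apply: Ex_le => //; first exact: all_momentsN.
      by move=> om; rewrite -normrN ler_norm.
    by apply: le_trans h1; apply: Ex_le => // om; rewrite ler_norm.
  rewrite invn_sqrt -/r -mulrA -ExZ// normrM mulrC (ger0_norm r0).
  by rewrite ler_wpM2r.
have lim0 : (fun N : nat => C * (Num.sqrt N%:R)^-1) @ \oo --> (C * 0 : R).
  by apply: cvgMr; exact: cvg_invsqrtn.
rewrite mulr0 in lim0; apply/cvgrPdist_le => e e0.
have /cvgrPdist_le/(_ e e0) := lim0; apply: filterS2 (nbhs_infty_ge N0) => N NN.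
rewrite !sub0r !normrN => h; rewrite (le_trans (bound _ NN))// (le_trans _ h)//.
exact: ler_norm.
Qed.

End ScaledExpectation.

Section LimitCovariance.
Context d (T : measurableType d) (R : realType) (P : probability T R).
Variables (dx du : nat) (A : 'M[R]_dx) (B : 'M[R]_(dx, du)) (Bw : 'M[R]_dx).
Variable g : nat * 'I_(dx + du) -> T -> R.
Hypothesis mg : forall i, measurable_fun [set: T] (g i).
Hypothesis lawg : forall i (E : set R), measurable E ->
  P (g i @^-1` E) = normal_prob 0 1 E.
Hypothesis indep_g : forall (s : seq (nat * 'I_(dx + du))) (E : _ -> set R), uniq s ->
  (forall i, measurable (E i)) ->
  P (\bigcap_(i in [set` s]) (g i @^-1` E i)) =
  (\prod_(i <- s) P (g i @^-1` E i))%E.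
Local Notation F := (row_mx Bw B).
Local Notation nu := (noise_vec g).
Local Notation x := (traj A F g).
Local Notation Gx := (state_sel R dx du).
Local Notation Gu := (input_sel R dx du).
Local Notation xi := (regressor A F Gx Gu g).
Local Notation gram := (gram_matrix A F Gx Gu g).
Local Notation cross := (noise_cross A F Gx Gu g (noise_sel R dx du)).
Hypothesis A_stable : forall e : R, 0 < e -> exists m, nm (A ^+ m.+1) <= e.
Variable Sx : 'M[R]_dx.
Hypothesis Sx_stationary : Sx = A *m Sx *m A^T + F *m F^T.

Lemma regressor_covE : regressor_cov Gx Gu Sx = block_mx Sx 0 0 1%:M.
Proof.
rewrite /regressor_cov /state_sel /input_sel mul_col_mx mul1mx mul0mx tr_col_mx mul_col_row.
rewrite trmx1 !trmx0 !mulmx0 !mul0mx mulmx1 tr_block_mx !trmx0 trmx1 mulmx_block.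
by rewrite !mulmx0 !mul0mx !mulmx1 !add0r add_block_mx !addr0 !add0r.
Qed.

Lemma cvg_gram b b' : (fun N => N%:R^-1 * Ex P (fun om => gram N om b b')) @ \oo -->
  regressor_cov Gx Gu Sx b b'.
Proof.
have aG N : all_moments P (fun om => gram N om b b') by exact: all_moments_gram.
set c := regressor_cov Gx Gu Sx b b'.
pose X (N : nat) om := gram N om b b' + - (N%:R * c).
have aX N : all_moments P (X N).
  by apply: all_momentsD => //; exact: all_moments_cst.
have lim0 : (fun N => N%:R^-1 * Ex P (X N)) @ \oo --> 0.
  apply: cvg_Ex_scaled => //.
  have [C C0 hC] := nm_gram_dev_le Gx Gu g A_stable Sx_stationary.
  have bs : bdd_moments P (fun N om => C * ((Num.sqrt N%:R)^-1 * spread A F g N om)).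
    by apply: bdd_momentsZ; exact: bdd_moments_spread.
  apply: (@le_bdd_moments _ _ _ _ _ _ 1%N bs) => [N|N N0].
    by case: (all_momentsZ (Num.sqrt N%:R)^-1 (aX N)) => /(_ 0%N).
  apply: aeW => om /=; have s0 := spread_ge0 A F g N om.
  rewrite normrM mulrCA normrM ler_wpM2l//.
  rewrite [leRHS]ger0_norm ?mulr_ge0// (le_trans _ (hC _ _ N0))//.
  apply: le_trans (le_nm_entry _ b b'); rewrite /X /c.
  by rewrite 2![in leRHS]mxE [in leRHS]mxE.
have : (fun N => N%:R^-1 * Ex P (X N) + c) @ \oo --> 0 + c.
  by apply: cvgD => //; exact: cvg_cst.
rewrite add0r; apply: cvg_trans; apply: near_eq_cvg; near=> N.
have N0 : (0 < N)%N by near: N; exact: nbhs_infty_gt.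
rewrite /X ExD//; last exact: all_moments_cst.
by rewrite Ex_cst mulrDr mulrN mulrA mulVf ?mul1r ?subrK// pnatr_eq0 -lt0n.
Unshelve. all: by end_near. Qed.

Definition z_traj H om t : 'cV[R]_(dx + H * du) :=
  col_mx (x om t) (blockcol (fun k : 'I_H => dsubmx (nu (t + k)%N om))).

Lemma all_moments_state t i : all_moments P (fun om => x om t i 0).
Proof. exact: all_moments_traj. Qed.

Let ag := all_moments_g mg lawg.

Definition z_index H t (q : 'I_(H * du)) : nat * 'I_(dx + du) :=
  ((t + (mxtens_unindex q).1)%N, rshift dx (mxtens_unindex q).2).

Lemma z_traj_l H om t i : z_traj H om t (lshift _ i) 0 = x om t i 0.
Proof. by rewrite /z_traj col_mxEu. Qed.

Lemma z_traj_r H om t q : z_traj H om t (rshift _ q) 0 = g (z_index t q) om.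
Proof. by rewrite /z_traj col_mxEd !mxE. Qed.

Lemma z_index_inj H t : injective (@z_index H t).
Proof.
move=> q1 q2 e; apply: (can_inj (@mxtens_unindexK H du)).
have e1 := congr1 fst e; have e2 := rshift_inj (congr1 snd e).
move: e1 => /addnI /ord_inj; move: e2.
by case: (mxtens_unindex q1) (mxtens_unindex q2) => a b [a' b'] /= -> ->.
Qed.

Lemma all_moments_z H t i : all_moments P (fun om => z_traj H om t i 0).
Proof.
rewrite -(splitK i); case: (fintype.split i) => j /=.
  by under eq_fun do rewrite z_traj_l; exact: all_moments_state.
by under eq_fun do rewrite z_traj_r.
Qed.

Lemma Ex_zz H t i j : Ex P (fun om => z_traj H om t i 0 * z_traj H om t j 0) =
  block_mx (\matrix_(a, b) Ex P (fun om => x om t a 0 * x om t b 0)) 0 0 1%:M i j.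
Proof.
have xg a e s : (t <= s)%N -> Ex P (fun om => x om t a 0 * g (s, e) om) = 0.
  move=> ts; apply: (Ex_mul_noise0 mg lawg indep_g) => //; last exact: all_moments_state.
  exact: state_wrt_compl.
rewrite -(splitK i) -(splitK j).
case: (fintype.split i) (fintype.split j) => a [b|b] /=.
- by rewrite block_mxEul mxE; congr Ex; apply/funext => om; rewrite !z_traj_l.
- rewrite block_mxEur mxE.
  rewrite (_ : (fun _ => _) = (fun om => x om t a 0 * g (z_index t b) om)).
    by apply: xg; rewrite leq_addr.
  by apply/funext => om; rewrite z_traj_l z_traj_r.
- rewrite block_mxEdl mxE.
  rewrite (_ : (fun _ => _) = (fun om => x om t b 0 * g (z_index t a) om)).
    by apply: xg; rewrite leq_addr.
  by apply/funext => om; rewrite z_traj_l z_traj_r mulrC.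
- rewrite block_mxEdr mxE.
  rewrite (_ : (fun _ => _) = (fun om => g (z_index t a) om * g (z_index t b) om)).
    by rewrite (Ex_noise_noise mg lawg indep_g) (inj_eq (@z_index_inj H t)).
  by apply/funext => om; rewrite !z_traj_r.
Qed.

(** Time 0 contributes nothing since the initial state is 0, so the [S.+1] terms form a block of
    [gram S.+1]; the weight [1/S] costs a ratio tending to 1. *)
Lemma cvg_state_cov i j :
  (fun S : nat => S%:R^-1 * \sum_(0 <= t < S.+1) Ex P (fun om => x om t i 0 * x om t j 0)) @ \oo
  --> Sx i j.
Proof.
have h := @cvg_gram (lshift du i) (lshift du j).
rewrite regressor_covE block_mxEul in h.
have {}h : (fun N => N.+1%:R^-1 * Ex P (fun om => gram N.+1 om (lshift du i) (lshift du j))) @ \oo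
    --> Sx i j by rewrite (cvg_shiftS (fun N => N%:R^-1 * Ex P (fun om =>
      gram N om (lshift du i) (lshift du j)))).
have h1 : (fun N : nat => (N%:R^-1 * N.+1%:R) * (N.+1%:R^-1 *
    Ex P (fun om => gram N.+1 om (lshift du i) (lshift du j)))) @ \oo --> 1 * Sx i j.
  by apply: cvgM => //; exact: cvg_succn_ratio.
rewrite mul1r in h1.
apply: cvg_trans h1; apply: near_eq_cvg; near=> S.
rewrite /= -mulrA; congr (_ * _); rewrite mulrA divff ?mul1r ?pnatr_eq0//.
rewrite big_ltn// (_ : Ex P (fun om => x om 0 i 0 * x om 0 j 0) = 0) ?add0r; last first.
  by rewrite -(@Ex_cst _ T R P 0); congr Ex; apply/funext => om; rewrite [x om 0 i 0]mxE mul0r.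
rewrite -Ex_sum; last by move=> t _; apply: all_momentsM; exact: all_moments_state.
congr Ex; apply/funext => om; rewrite gram_entry; apply: eq_bigr => t _.
by rewrite !regressorE !col_mxEu.
Unshelve. all: by end_near. Qed.

Lemma Sigma_zE H : Sigma_z P (fun om t => z_traj H om t) = z_cov du H Sx.
Proof.
apply/matrixP => i j; rewrite mxE; apply: cvg_lim => //.
rewrite (_ : (fun _ => _) = (fun S : nat => S%:R^-1 * \sum_(0 <= t < S.+1)
    Ex P (fun om => z_traj H om t i 0 * z_traj H om t j 0))); last first.
  apply/funext => S; rewrite -Ex_sum; last first.
    by move=> t _; apply: all_momentsM; exact: all_moments_z.
  have aS : all_moments P (fun om => \sum_(0 <= t < S.+1)
      z_traj H om t i 0 * z_traj H om t j 0).
    by apply: all_moments_sum => t _; apply: all_momentsM; exact: all_moments_z.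
  have e om : (S%:R^-1 *: \sum_(0 <= t < S.+1) (z_traj H om t *m (z_traj H om t)^T)) i j =
     S%:R^-1 * \sum_(0 <= t < S.+1) z_traj H om t i 0 * z_traj H om t j 0.
    rewrite mxE summxE; congr (_ * _); apply: eq_bigr => t _.
    by rewrite mxE big_ord1 [_^T _ _]mxE.
  rewrite -ExZ// -[RHS]/(fine (Ex P (fun om => S%:R^-1 *
    \sum_(0 <= t < S.+1) z_traj H om t i 0 * z_traj H om t j 0))%:E).
  rewrite -ExE; last exact: all_momentsZ.
  by rewrite unlock; congr fine; apply: eq_integral => om _; rewrite e.
under eq_fun do (under eq_bigr do rewrite Ex_zz).
rewrite /z_cov -(splitK i) -(splitK j).
have cst (c : R) : (fun S : nat => S%:R^-1 * \sum_(0 <= t < S.+1) c) @ \oo --> c.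
  rewrite -[X in _ --> X]mul1r (_ : (fun _ => _) = (fun S : nat => (S%:R^-1 * S.+1%:R) * c)).
    by apply: cvgMl; exact: cvg_succn_ratio.
  by apply/funext => S; rewrite sumr_const_nat subn0 -[c *+ _]mulr_natl mulrA.
case: (fintype.split i) (fintype.split j) => a [b|b] /=.
- rewrite block_mxEul; under eq_fun do (under eq_bigr do rewrite block_mxEul mxE).
  exact: cvg_state_cov.
- by rewrite block_mxEur; under eq_fun do (under eq_bigr do rewrite block_mxEur); exact: cst.
- by rewrite block_mxEdl; under eq_fun do (under eq_bigr do rewrite block_mxEdl); exact: cst.
- by rewrite block_mxEdr; under eq_fun do (under eq_bigr do rewrite block_mxEdr); exact: cst.
Qed.

End LimitCovariance.

(** * The rollout error and its quadratic part *)

Section ErrorExpansion.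
Variable R : realType.
Variables (dx du H : nat) (A : 'M[R]_dx) (B : 'M[R]_(dx, du)).
Variable S : 'M[R]_(dx + H * du).
Local Notation lin := (linear_error H A B).

Definition rollout_error (G : 'M[R]_(dx, dx + du)) : R :=
  sqF ((rollout H (lsubmx G) (rsubmx G) - rollout H A B) *m S).

Definition quadratic_error (D : 'M[R]_(dx, dx + du)) : R :=
  \sum_(i < H) sqF (lin D i.+1 *m S).

Lemma rollout_errorE G : rollout_error G = \sum_(i < H)
  sqF ((pred_row H (lsubmx G) (rsubmx G) i.+1 - pred_row H A B i.+1) *m S).
Proof.
rewrite /rollout_error !rolloutE -sqF_blockcol -blockcol_mul; congr (sqF (_ *m _)).
by apply/matrixP => a b; rewrite !mxE.
Qed.

Lemma linear_errorD D E k : lin (D + E) k = lin D k + lin E k.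
Proof.
rewrite /linear_error -big_split/=; apply: eq_bigr => l _.
by rewrite mulmxDr mulmxDl.
Qed.

Lemma linear_error_uniform : exists2 a, 0 <= a &
  forall (i : 'I_H) D, nm (lin D i.+1 *m S) <= a * nm D.
Proof.
have /choice[f fP] : forall i : 'I_H, exists C, 0 <= C /\ forall D, nm (lin D i.+1) <= C * nm D.
  by move=> i; have [C C0 hC] := nm_linear_error_le H A B i.+1; exists C.
have s0 := nm_ge0 S.
exists ((\sum_i f i) * nm S).
  by rewrite mulr_ge0// sumr_ge0// => i _; exact: (fP i).1.
move=> i D; rewrite (le_trans (nmM _ _))// mulrAC ler_wpM2r//.
rewrite (le_trans ((fP i).2 D))// ler_wpM2r ?nm_ge0//.
by rewrite (bigD1 i)//= lerDl sumr_ge0// => j _; exact: (fP j).1.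
Qed.

Lemma remainder_uniform : exists2 b, 0 <= b &
  forall (i : 'I_H) (G D : 'M[R]_(dx, dx + du)), D = G - row_mx A B ->
  nm ((pred_row H (lsubmx G) (rsubmx G) i.+1 - pred_row H A B i.+1 - lin D i.+1) *m S)
  <= b * (nm D ^+ 2 * (1 + nm D) ^+ H).
Proof.
have /choice[f fP] : forall i : 'I_H, exists C, 0 <= C /\
    forall (G D : 'M[R]_(dx, dx + du)), D = G - row_mx A B ->
    nm (pred_row H (lsubmx G) (rsubmx G) i.+1 - pred_row H A B i.+1 - lin D i.+1)
    <= C * (nm D ^+ 2 * (1 + nm D) ^+ i.+1).
  by move=> i; have [C C0 hC] := rollout_expansion H A B i.+1; exists C; split=> // G D ->;
    exact: hC.
have s0 := nm_ge0 S.
exists ((\sum_i f i) * nm S).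
  by rewrite mulr_ge0// sumr_ge0// => i _; exact: (fP i).1.
move=> i G D DE; rewrite (le_trans (nmM _ _))// mulrAC ler_wpM2r//.
have D0 := nm_ge0 D.
rewrite (le_trans ((fP i).2 G D DE))//; apply: ler_pM.
- exact: (fP i).1.
- by rewrite mulr_ge0 ?sqr_ge0// exprn_ge0// addr_ge0.
- by rewrite (bigD1 i)//= lerDl sumr_ge0// => j _; exact: (fP j).1.
- by rewrite ler_wpM2l ?sqr_ge0// ler_weXn2l ?lerDl// ltn_ord.
Qed.

(** Linear part times remainder is cubic in [nm D], the squared remainder is quartic. The latter is
    brought to degree three by [nm D <= 1 + nm D], hence the extra factor beyond [2 * H]. *)
Lemma quadratic_expansion : exists2 C, 0 <= C &
  forall (G D : 'M[R]_(dx, dx + du)), D = G - row_mx A B ->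
  `|rollout_error G - quadratic_error D| <= C * (nm D ^+ 3 * (1 + nm D) ^+ (2 * H).+1).
Proof.
have [a a0 ha] := linear_error_uniform; have [b b0 hb] := remainder_uniform.
exists (H%:R * (2 * a * b + b ^+ 2)).
  by rewrite mulr_ge0// addr_ge0 ?mulr_ge0 ?sqr_ge0.
move=> G D DE; rewrite rollout_errorE /quadratic_error -sumrB (le_trans (ler_norm_sum _ _ _))//.
rewrite -[X in X%:R](card_ord H) -mulrA mulr_natl -sumr_const; apply: ler_sum => i _.
pose rho := (pred_row H (lsubmx G) (rsubmx G) i.+1 - pred_row H A B i.+1 - lin D i.+1) *m S.
have -> : (pred_row H (lsubmx G) (rsubmx G) i.+1 - pred_row H A B i.+1) *m S =
    lin D i.+1 *m S + rho.
  by rewrite /rho -mulmxDl [lin D i.+1 + _]addrC subrK.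
rewrite (le_trans (sqFD_dist _ _))//.
have h1 := ha i D; have h2 : nm rho <= _ := hb i G D DE.
have n1 := nm_ge0 (lin D i.+1 *m S); have n2 := nm_ge0 rho.
have t0 := nm_ge0 D; have p0 : 1 <= (1 + nm D) ^+ H by rewrite exprn_ege1// lerDl.
apply: (@le_trans _ _ (2 * ((a * nm D) * (b * (nm D ^+ 2 * (1 + nm D) ^+ H)))
    + (b * (nm D ^+ 2 * (1 + nm D) ^+ H)) ^+ 2)).
  apply: lerD; first by rewrite ler_wpM2l// ler_pM.
  by rewrite lerXn2r ?nnegrE// (le_trans n2).
rewrite [(1 + nm D) ^+ (2 * H).+1]exprS [(2 * H)%N]mulnC (exprM _ H 2).
move: (nm D) ((1 + nm D) ^+ H) t0 p0 => t y t0 p0.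
have y0 : 0 <= y by rewrite (le_trans _ p0).
have yy : y <= y ^+ 2 by rewrite expr2 ler_peMl.
have q1 : a * b * t ^+ 3 * y <= a * b * t ^+ 3 * y ^+ 2.
  by rewrite ler_wpM2l// !mulr_ge0// exprn_ge0.
have q2 : 0 <= a * b * (t ^+ 4 * y ^+ 2) by rewrite !mulr_ge0// exprn_ge0.
have q3 : 0 <= b ^+ 2 * (t ^+ 3 * y ^+ 2) by rewrite mulr_ge0 ?sqr_ge0// mulr_ge0 ?exprn_ge0.
have -> : 2 * (a * t * (b * (t ^+ 2 * y))) + (b * (t ^+ 2 * y)) ^+ 2 =
  2 * (a * b * t ^+ 3 * y) + b ^+ 2 * t ^+ 4 * y ^+ 2 by ring.
have -> : (2 * a * b + b ^+ 2) * (t ^+ 3 * ((1 + t) * y ^+ 2)) =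
  2 * (a * b * t ^+ 3 * y ^+ 2) + 2 * (a * b * (t ^+ 4 * y ^+ 2)) +
  b ^+ 2 * (t ^+ 3 * y ^+ 2) + b ^+ 2 * t ^+ 4 * y ^+ 2 by ring.
lra.
Qed.

Lemma quadratic_error_dist : exists2 C, 0 <= C &
  forall D E, `|quadratic_error (D + E) - quadratic_error D| <=
    C * (2 * (nm D * nm E) + nm E ^+ 2).
Proof.
have [a a0 ha] := linear_error_uniform.
exists (H%:R * a ^+ 2); first by rewrite mulr_ge0// sqr_ge0.
move=> D E; rewrite /quadratic_error -sumrB (le_trans (ler_norm_sum _ _ _))//.
rewrite -[X in X%:R](card_ord H) -mulrA mulr_natl -sumr_const; apply: ler_sum => i _.
rewrite linear_errorD mulmxDl (le_trans (sqFD_dist _ _))//.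
have h1 := ha i D; have h2 := ha i E.
have n1 := nm_ge0 (lin D i.+1 *m S); have n2 := nm_ge0 (lin E i.+1 *m S).
have -> : a ^+ 2 * (2 * (nm D * nm E) + nm E ^+ 2) =
  2 * ((a * nm D) * (a * nm E)) + (a * nm E) ^+ 2 by ring.
apply: lerD; first by rewrite ler_wpM2l// ler_pM.
by rewrite lerXn2r ?nnegrE// (le_trans n2).
Qed.

(** Here [r] is [sqrt N], [t] the size of [D], [q] that of its leading part, [e] that of their
    difference and [V] the normalised spread. After multiplication by [N] everything is [1 / r]
    times a power of a quantity with bounded moments. *)
Lemma error_rate_arith (r t V C1 C2 c e q : R) m : 1 <= r -> 0 <= t -> 0 <= V ->
  0 <= C1 -> 0 <= C2 -> 0 <= c -> 0 <= e -> 0 <= q ->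
  q <= c * V / r -> e <= c * (t * V) / r ->
  r ^+ 2 * (C1 * (t ^+ 3 * (1 + t) ^+ m) + C2 * (2 * (q * e) + e ^+ 2)) <=
  (C1 + C2 * (3 * c ^+ 2)) * (r^-1 * (1 + r * t + V) ^+ (m + 4)).
Proof.
move=> r1 t0 V0 C10 C20 c0 e0 q0 qle ele.
have r0 : 0 < r by rewrite (lt_le_trans _ r1).
have rE : r * r^-1 = 1 by rewrite divff// gt_eqF.
have i0 : 0 <= r^-1 by rewrite invr_ge0 ltW.
have i1 : r^-1 <= 1 by rewrite invf_le1.
pose s := r * t; have s0 : 0 <= s by rewrite mulr_ge0// ltW.
have tE : t = s * r^-1 by rewrite /s mulrAC rE mul1r.
have ts : t <= s by rewrite tE ler_piMr.
pose y := 1 + s + V.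
have y1 : 1 <= y by rewrite /y -addrA lerDl addr_ge0.
have sy : s <= y by rewrite /y; lra.
have Vy : V <= y by rewrite /y; lra.
have ty : 1 + t <= y by rewrite /y; lra.
have y0 : 0 <= y by rewrite (le_trans _ y1).
have ym : 1 <= y ^+ m by rewrite exprn_ege1.
have ym0 : 0 <= y ^+ m by rewrite (le_trans _ ym).
rewrite -/s -/y [leLHS]mulrDr [leRHS]mulrDl; apply: lerD.
  have -> : r ^+ 2 * (C1 * (t ^+ 3 * (1 + t) ^+ m)) =
      C1 * (r^-1 * (s ^+ 3 * (1 + t) ^+ m)).
    transitivity ((r * r^-1) ^+ 2 * (C1 * (r^-1 * (s ^+ 3 * (1 + t) ^+ m)))).
      by rewrite {1}tE; ring.
    by rewrite rE expr1n mul1r.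
  rewrite ler_wpM2l// ler_wpM2l// exprD mulrC ler_pM ?exprn_ge0 ?addr_ge0//.
    by rewrite lerXn2r ?nnegrE ?addr_ge0.
  rewrite (exprS y) (le_trans (_ : _ <= y ^+ 3))//; first by rewrite lerXn2r ?nnegrE.
  by rewrite ler_peMl// exprn_ge0.
have V1 : 0 <= c * V / r by rewrite mulr_ge0 ?mulr_ge0.
have s1 : 0 <= c * (t * V) / r by rewrite mulr_ge0 ?mulr_ge0.
apply: (@le_trans _ _ (r ^+ 2 * (C2 * (2 * ((c * V / r) * (c * (t * V) / r)) + (c * (t * V) /
  r) ^+ 2)))).
  rewrite ler_wpM2l ?sqr_ge0// ler_wpM2l//; apply: lerD.
    by rewrite ler_wpM2l// ler_pM.
  by rewrite lerXn2r ?nnegrE.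
have -> : r ^+ 2 * (C2 * (2 * ((c * V / r) * (c * (t * V) / r)) + (c * (t * V) / r) ^+ 2)) =
    C2 * c ^+ 2 * (r^-1 * (2 * (V * (s * V)) + r^-1 * (s * V) ^+ 2)).
  transitivity ((r * r^-1) ^+ 2 * (C2 * c ^+ 2 * (r^-1 * (2 * (V * (s * V)) + r^-1 * (s * V) ^+
    2)))).
    by rewrite {1 2}tE; ring.
  by rewrite rE expr1n mul1r.
rewrite -[leRHS]mulrA -[leLHS]mulrA ler_wpM2l//.
have -> : 3 * c ^+ 2 * (r^-1 * y ^+ (m + 4)) = c ^+ 2 * (r^-1 * (3 * y ^+ (m + 4))) by ring.
rewrite ler_wpM2l ?sqr_ge0// ler_wpM2l//.
have y4 : y ^+ 4 <= y ^+ (m + 4) by rewrite exprD ler_peMl// exprn_ge0.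
have sV : s * V <= y * y by rewrite ler_pM.
have sV0 : 0 <= s * V by rewrite mulr_ge0.
have h1 : V * (s * V) <= y ^+ 4.
  rewrite (_ : y ^+ 4 = (y * y) * (y * y)); last by ring.
  by rewrite ler_pM// (le_trans Vy)// ler_peMl.
have h2 : r^-1 * (s * V) ^+ 2 <= y ^+ 4.
  rewrite (_ : y ^+ 4 = 1 * (y * y) ^+ 2); last by ring.
  by rewrite ler_pM ?sqr_ge0// lerXn2r ?nnegrE// mulr_ge0.
lra.
Qed.

End ErrorExpansion.

Lemma cvg_sum_seq (R : realType) (I : Type) (s : seq I) (Q : pred I)
    (f : I -> nat -> R) (l : I -> R) :
  (forall i, Q i -> f i @ \oo --> l i) ->
  (fun N => \sum_(i <- s | Q i) f i N) @ \oo --> \sum_(i <- s | Q i) l i.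
Proof.
move=> fl; elim: s => [|i s IH].
  rewrite big_nil (_ : (fun _ => _) = fun=> 0); first exact: cvg_cst.
  by apply/funext => N; rewrite big_nil.
rewrite big_cons; under eq_fun do rewrite big_cons.
by case: ifP => // Qi; apply: cvgD => //; exact: fl.
Qed.

Lemma quadratic_error_expand (R : realType) dx du H (A : 'M[R]_dx) (B : 'M[R]_(dx, du))
    (Bw : 'M[R]_dx) (S : 'M[R]_(dx + H * du)) (M : 'M[R]_(dx, dx + du))
    (V : 'M[R]_(dx + du)) c
    (L := fun (i l : 'I_H) => A ^+ (i - l) *m Bw)
    (K := fun (l : 'I_H) => V *m regressor_row H A B l *m S) :
  quadratic_error A B S (c *: (Bw *m M *m V)) =
  c ^+ 2 * \sum_(i < H) \sum_(l < H | (l < i.+1)%N) \sum_(k < H | (k < i.+1)%N)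
    \tr (((L i k)^T *m L i l) *m (M *m (K l *m (K k)^T) *m M^T)).
Proof.
rewrite /quadratic_error mulr_sumr; apply: eq_bigr => i _.
have -> : linear_error H A B (c *: (Bw *m M *m V)) i.+1 *m S =
    c *: \sum_(l < H | (l < i.+1)%N) L i l *m M *m K l.
  have iH := ltn_ord i; rewrite /linear_error mulmx_suml.
  rewrite (big_ord_widen_cond H xpredT (fun l => A ^+ (i.+1 - l.+1) *m
    (c *: (Bw *m M *m V)) *m regressor_row H A B l *m S))//=.
  rewrite scaler_sumr; apply: eq_bigr => l _.
  by rewrite /L /K subSS -!(scalemxAr, scalemxAl) !mulmxA.
rewrite sqFE linearZ/= -scalemxAl -scalemxAr scalerA mxtraceZ -expr2; congr (_ * _).
rewrite mulmx_suml raddf_sum/=; apply: eq_bigr => l _.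
rewrite raddf_sum/= mulmx_sumr raddf_sum/=; apply: eq_bigr => k _.
move: (L i l) (L i k) (K l) (K k) => L1 L2 K1 K2.
transitivity (\tr (L1 *m (M *m (K1 *m K2^T) *m M^T) *m L2^T)).
  by rewrite !trmx_mul !mulmxA.
by rewrite mxtrace_mulC !mulmxA.
Qed.

Section LimitQuadratic.
Context d (T : measurableType d) (R : realType) (P : probability T R).
Variables (dx du : nat) (A : 'M[R]_dx) (B : 'M[R]_(dx, du)) (Bw : 'M[R]_dx).
Variable g : nat * 'I_(dx + du) -> T -> R.
Hypothesis mg : forall i, measurable_fun [set: T] (g i).
Hypothesis lawg : forall i (E : set R), measurable E ->
  P (g i @^-1` E) = normal_prob 0 1 E.
Hypothesis indep_g : forall (s : seq (nat * 'I_(dx + du))) (E : _ -> set R), uniq s ->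
  (forall i, measurable (E i)) ->
  P (\bigcap_(i in [set` s]) (g i @^-1` E i)) =
  (\prod_(i <- s) P (g i @^-1` E i))%E.
Local Notation F := (row_mx Bw B).
Local Notation nu := (noise_vec g).
Local Notation x := (traj A F g).
Local Notation Gx := (state_sel R dx du).
Local Notation Gu := (input_sel R dx du).
Local Notation xi := (regressor A F Gx Gu g).
Local Notation gram := (gram_matrix A F Gx Gu g).
Local Notation cross := (noise_cross A F Gx Gu g (noise_sel R dx du)).
Hypothesis A_stable : forall e : R, 0 < e -> exists m, nm (A ^+ m.+1) <= e.
Variable Sx : 'M[R]_dx.
Hypothesis Sx_stationary : Sx = A *m Sx *m A^T + F *m F^T.
Hypothesis Sx_stat : is_stationary_cov A B Bw Sx.
Hypothesis Sx_sym : Sx^T = Sx.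
Hypothesis Sx_unit : Sx \in unitmx.
Variables (H : nat) (S : 'M[R]_(dx + H * du)).
Hypothesis S_sym : S^T = S.
Hypothesis SS : S *m S = z_cov du H Sx.
Local Notation Sigma := (regressor_cov Gx Gu Sx).

Lemma regressor_cov_inv :
  Sigma \in unitmx /\ invmx Sigma = block_mx (invmx Sx) 0 0 1%:M.
Proof.
have e : Sigma *m block_mx (invmx Sx) 0 0 1%:M = 1%:M.
  rewrite regressor_covE mulmx_block mulmxV// !mulmx0 !mul0mx mulmx1 !addr0 add0r.
  by rewrite -scalar_mx_block.
have [U _] := mulmx1_unit e; split=> //.
by rewrite -[RHS]mul1mx -(mulVmx U) -mulmxA e mulmx1.
Qed.

Definition leading_error N om : 'M[R]_(dx, dx + du) :=
  N%:R^-1 *: (Bw *m cross N om *m invmx Sigma).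

Let L (i l : 'I_H) := A ^+ (i - l) *m Bw.
Let K (l : 'I_H) := invmx Sigma *m regressor_row H A B l *m S.

Let quadE N om : quadratic_error A B S (leading_error N om) =
  N%:R^-1 ^+ 2 * \sum_(i < H) \sum_(l < H | (l < i.+1)%N) \sum_(k < H | (k < i.+1)%N)
    \tr (((L i k)^T *m L i l) *m (cross N om *m (K l *m (K k)^T) *m (cross N om)^T)).
Proof. exact: quadratic_error_expand. Qed.

Let all_moments_term N G K' : all_moments P (fun om =>
  \tr (G *m (cross N om *m K' *m (cross N om)^T))).
Proof.
rewrite (_ : (fun _ => _) = (fun om => \sum_a \sum_a' \sum_b' \sum_b
    (G a a' * K' b b') * (cross N om a' b * cross N om a b'))).
  do 4 (apply: all_moments_sum => ? _); apply: all_momentsZ.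
  by apply: all_momentsM; exact: all_moments_cross.
apply/funext => om; apply: eq_bigr => a _; rewrite mxE; apply: eq_bigr => a' _.
rewrite mxE mulr_sumr; apply: eq_bigr => b' _.
rewrite mxE mulr_suml mulr_sumr; apply: eq_bigr => b _.
by rewrite !mxE; ring.
Qed.

Lemma all_moments_leading N :
  all_moments P (fun om => quadratic_error A B S (leading_error N om)).
Proof.
under eq_fun do rewrite quadE.
by apply: all_momentsZ; do 3 (apply: all_moments_sum => ? _).
Qed.

(** [Sigma] cancels one of the two factors [invmx Sigma], and [S *m S] is [z_cov]; what is left is
    [limit_trace]. *)
Let limit_entry (i l k : 'I_H) :
  \tr ((L i k)^T *m L i l) * (\sum_b \sum_b' (K l *m (K k)^T) b b' * Sigma b b') =
  \tr (L i l *m (L i k)^T) * (M_SS H A Bw Sx + du%:R%:M) l k.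
Proof.
rewrite mxtrace_mulC; congr (_ * _).
have [Su Si] := regressor_cov_inv.
have -> : \sum_b \sum_b' (K l *m (K k)^T) b b' * Sigma b b' =
    \tr (K l *m (K k)^T *m Sigma^T).
  by apply: eq_bigr => b _; rewrite mxE; apply: eq_bigr => b' _; rewrite [Sigma^T _ _]mxE.
rewrite -(@limit_trace _ _ _ _ A B Bw Sx Sx_stat Sx_sym Sx_unit l k) -Si -SS /K.
rewrite !trmx_mul S_sym -!mulmxA.
have -> : (invmx Sigma)^T *m Sigma^T = 1%:M by rewrite -trmx_mul mulmxV// trmx1.
by rewrite mulmx1 !mulmxA.
Qed.

Lemma cvg_Ex_quadratic :
  (fun N => N%:R * Ex P (fun om => quadratic_error A B S (leading_error N om))) @ \oo -->
  \tr (Gamma_w H A Bw *m ((M_SS H A Bw Sx + (du%:R)%:M) *t 1%:M) *m (Gamma_w H A Bw)^T).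
Proof.
rewrite Gamma_trace.
have h : (fun N => \sum_(i < H) \sum_(l < H | (l < i.+1)%N) \sum_(k < H | (k < i.+1)%N)
    \tr ((L i k)^T *m L i l) * (\sum_b \sum_b' (K l *m (K k)^T) b b' *
      (N%:R^-1 * Ex P (fun om => gram N om b b')))) @ \oo -->
  \sum_(i < H) \sum_(l < H | (l < i.+1)%N) \sum_(k < H | (k < i.+1)%N)
    \tr ((L i k)^T *m L i l) * (\sum_b \sum_b' (K l *m (K k)^T) b b' * Sigma b b').
  apply: cvg_sum_seq => i _; apply: cvg_sum_seq => l _; apply: cvg_sum_seq => k _.
  apply: cvgMr; apply: cvg_sum_seq => b _; apply: cvg_sum_seq => b' _.
  by apply: cvgMr; exact: cvg_gram.
under [X in _ --> X]eq_bigr do (under eq_bigr do (under eq_bigr do rewrite -limit_entry)).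
apply: cvg_trans h; apply: near_eq_cvg; near=> N.
have N0 : (0 < N)%N by near: N; exact: nbhs_infty_gt.
pose q om := \sum_(i < H) \sum_(l < H | (l < i.+1)%N) \sum_(k < H | (k < i.+1)%N)
    \tr (((L i k)^T *m L i l) *m (cross N om *m (K l *m (K k)^T) *m (cross N om)^T)).
have -> : Ex P (fun om => quadratic_error A B S (leading_error N om)) =
    N%:R^-1 ^+ 2 * Ex P q.
  rewrite -ExZ; last by do 3 (apply: all_moments_sum => ? _).
  by congr Ex; apply/funext => om; exact: quadE.
have -> : N%:R * (N%:R^-1 ^+ 2 * Ex P q) = N%:R^-1 * Ex P q.
  by rewrite expr2 !mulrA divff ?mul1r// pnatr_eq0 -lt0n.
rewrite Ex_sum; last by move=> i _; do 2 (apply: all_moments_sum => ? _).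
rewrite mulr_sumr; apply: eq_bigr => i _.
rewrite Ex_sum; last by move=> l _; apply: all_moments_sum => ? _.
rewrite mulr_sumr; apply: eq_bigr => l _.
rewrite Ex_sum// mulr_sumr; apply: eq_bigr => k _.
rewrite Ex_quadratic_cross// mulrCA; congr (_ * _).
rewrite mulr_sumr; apply: eq_bigr => b _; rewrite mulr_sumr; apply: eq_bigr => b' _.
by rewrite mulrCA.
Unshelve. all: by end_near. Qed.

End LimitQuadratic.

Section MeasurableMatrices.
Context d (T : measurableType d) (R : realType).

Lemma measurable_mx_cst m n (M : 'M[R]_(m, n)) : measurable_mx (fun _ : T => M).
Proof. by move=> i j; exact: measurable_cst. Qed.

Lemma measurable_mxD m n (X Y : T -> 'M[R]_(m, n)) : measurable_mx X ->
  measurable_mx Y -> measurable_mx (fun om => X om + Y om).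
Proof.
move=> mX mY i j; rewrite (_ : (fun _ => _) = (fun om => X om i j + Y om i j)).
  exact: measurable_funD.
by apply/funext => om; rewrite mxE.
Qed.

Lemma measurable_mxM m n p (X : T -> 'M[R]_(m, n)) (Y : T -> 'M[R]_(n, p)) :
  measurable_mx X -> measurable_mx Y -> measurable_mx (fun om => X om *m Y om).
Proof.
move=> mX mY i j; rewrite (_ : (fun _ => _) = (fun om => \sum_k X om i k * Y om k j)).
  by apply: measurable_sum => k; exact: measurable_funM.
by apply/funext => om; rewrite mxE.
Qed.

Lemma measurable_rollout_error dx du H (A : 'M[R]_dx) (B : 'M[R]_(dx, du))
    (S : 'M[R]_(dx + H * du)) (G : T -> 'M[R]_(dx, dx + du)) :
  measurable_mx G -> measurable_fun [set: T] (fun om => rollout_error A B S (G om)).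
Proof.
move=> mG; under eq_fun do rewrite rollout_errorE.
have ml : measurable_mx (fun om => lsubmx (G om)).
  move=> i j; rewrite (_ : (fun _ => _) = (fun om => G om i (lshift du j))) //.
  by apply/funext => om; rewrite mxE.
have mr : measurable_mx (fun om => rsubmx (G om)).
  move=> i j; rewrite (_ : (fun _ => _) = (fun om => G om i (rshift dx j))) //.
  by apply/funext => om; rewrite mxE.
have mp k : measurable_mx (fun om => pred_row H (lsubmx (G om)) (rsubmx (G om)) k).
  elim: k => [|k IH].
    rewrite (_ : (fun _ => _) = (fun=> pred_row H (0 : 'M[R]_dx) (0 : 'M[R]_(dx, du)) 0%N)).
      exact: measurable_mx_cst.
    by apply/funext => om; rewrite /pred_row !expr0.
  rewrite (_ : (fun _ => _) = (fun om =>
    lsubmx (G om) *m pred_row H (lsubmx (G om)) (rsubmx (G om)) k +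
    rsubmx (G om) *m input_row R dx du H k)).
    by apply: measurable_mxD; apply: measurable_mxM => //; exact: measurable_mx_cst.
  by apply/funext => om; exact: pred_rowS.
apply: measurable_sum => i; apply: measurable_sum => a; apply: measurable_sum => b.
apply: measurable_funX.
suff : measurable_mx (fun om => (pred_row H (lsubmx (G om)) (rsubmx (G om)) i.+1 +
  (- pred_row H A B i.+1)) *m S) by exact.
apply: measurable_mxM; last exact: measurable_mx_cst.
by apply: measurable_mxD => //; exact: measurable_mx_cst.
Qed.

End MeasurableMatrices.

Section MainLimit.
Context d (T : measurableType d) (R : realType) (P : probability T R).
Variables (dx du : nat) (A : 'M[R]_dx) (B : 'M[R]_(dx, du)) (Bw : 'M[R]_dx).
Variable g : nat * 'I_(dx + du) -> T -> R.
Hypothesis mg : forall i, measurable_fun [set: T] (g i).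
Hypothesis lawg : forall i (E : set R), measurable E ->
  P (g i @^-1` E) = normal_prob 0 1 E.
Hypothesis indep_g : forall (s : seq (nat * 'I_(dx + du))) (E : _ -> set R), uniq s ->
  (forall i, measurable (E i)) ->
  P (\bigcap_(i in [set` s]) (g i @^-1` E i)) =
  (\prod_(i <- s) P (g i @^-1` E i))%E.
Local Notation F := (row_mx Bw B).
Local Notation nu := (noise_vec g).
Local Notation x := (traj A F g).
Local Notation Gx := (state_sel R dx du).
Local Notation Gu := (input_sel R dx du).
Local Notation xi := (regressor A F Gx Gu g).
Local Notation gram := (gram_matrix A F Gx Gu g).
Local Notation cross := (noise_cross A F Gx Gu g (noise_sel R dx du)).
Hypothesis A_stable : forall e : R, 0 < e -> exists m, nm (A ^+ m.+1) <= e.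
Variable Sx : 'M[R]_dx.
Hypothesis Sx_stationary : Sx = A *m Sx *m A^T + F *m F^T.
Hypothesis Sx_stat : is_stationary_cov A B Bw Sx.
Hypothesis Sx_sym : Sx^T = Sx.
Hypothesis Sx_unit : Sx \in unitmx.
Variables (H : nat) (S : 'M[R]_(dx + H * du)).
Hypothesis S_sym : S^T = S.
Hypothesis SS : S *m S = z_cov du H Sx.
Local Notation Sigma := (regressor_cov Gx Gu Sx).
Variables (L : nat) (kap : R).
Hypothesis nondegenerate : forall (c : 'rV[R]_(dx + du)) i,
  `|c 0 i| <= kap * \sum_(r < L.+1) nm (fresh_coef A F Gx Gu c r).
Variable G : nat -> T -> 'M[R]_(dx, dx + du).
Hypothesis mG : forall N, measurable_mx (G N).
Hypothesis normal_eq : forall N, {ae P, forall om,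
  (G N om - row_mx A B) *m gram N om = Bw *m cross N om}.

Let D N om := G N om - row_mx A B.
Let r (N : nat) : R := Num.sqrt N%:R.
Let y N om := 1 + r N * nm (D N om) + (r N)^-1 * spread A F g N om.

Let cross_le : exists2 C : R, 0 <= C & forall N om, (0 < N)%N ->
  nm (Bw *m cross N om) <= C * spread A F g N om.
Proof.
have [C C0 hC] := nm_noise_cross_le A F Gx g (noise_sel_input_sel R dx du).
exists (nm Bw * C); first by rewrite mulr_ge0// nm_ge0.
move=> N om N0; rewrite (le_trans (nmM _ _))// -mulrA ler_wpM2l ?nm_ge0//.
exact: hC.
Qed.

Let bdd_y : bdd_moments P y.
Proof.
have [CY CY0 hCY] := cross_le.
apply: bdd_momentsD; last exact: bdd_moments_spread.
apply: bdd_momentsD; first exact: (@bdd_moments_cst _ _ _ _ (fun=> 1) `|1|).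
apply: (@least_squares_rate _ _ _ P _ _ _ A F Gx Gu g mg lawg indep_g A_stable Sx
  Sx_stationary L kap nondegenerate (regressor_cov_inv du Sx_unit).1 _ D
  (fun N om => Bw *m cross N om) CY).
- move=> N i j; rewrite (_ : (fun _ => _) = (fun om => G N om i j + - row_mx A B i j)).
    by apply: measurable_funD => //; exact: mG.
  by apply/funext => om; rewrite !mxE.
- exact: hCY.
- exact: normal_eq.
Qed.

Let X N om : R := N%:R * rollout_error A B S (G N om) -
  N%:R * quadratic_error A B S (leading_error A B Bw g Sx N om).

(** By the normal equations the difference between [D] and its leading part is
    [- N^-1 D (gram - N Sigma) Sigma^-1], a product of two fluctuations and hence of order
    [1 / N]. *)
Let X_bound : exists C, forall N, (0 < N)%N -> {ae P, forall om,
  `|X N om| <= (r N)^-1 * (C * y N om ^+ ((2 * H).+1 + 4))}.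
Proof.
have [C1 C10 hC1] := quadratic_expansion A B S.
have [C2 C20 hC2] := quadratic_error_dist A B S.
have [CY CY0 hCY] := cross_le.
have [C0 C00 hC0] := nm_gram_dev_le Gx Gu g A_stable Sx_stationary.
have [Su _] := regressor_cov_inv du Sx_unit.
pose s := nm (invmx Sigma); have s0 : 0 <= s by exact: nm_ge0.
pose c := (C0 + CY) * s.
have c0 : 0 <= c by rewrite mulr_ge0// addr_ge0.
exists (C1 + C2 * (3 * c ^+ 2)) => N N0.
apply: filterS (normal_eq N) => om eqN.
have rE : r N ^+ 2 = N%:R by rewrite sqr_sqrtr.
have r1 : 1 <= r N by rewrite -[leLHS]sqrtr1 ler_wsqrtr// ler1n.
have r0 : 0 < r N by rewrite (lt_le_trans _ r1).
set V := (r N)^-1 * spread A F g N om.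
have V0 : 0 <= V by rewrite mulr_ge0 ?invr_ge0 ?(ltW r0)// spread_ge0.
have VE : spread A F g N om = r N * V by rewrite /V mulrA divff ?mul1r// gt_eqF.
set Q := leading_error A B Bw g Sx N om.
pose E := D N om - Q.
have t0 := nm_ge0 (D N om).
have Nr : N%:R^-1 = (r N)^-1 * (r N)^-1 :> R by exact: invn_sqrt.
have irr : (r N)^-1 * r N = 1 by rewrite mulVf// gt_eqF.
have hQ : nm Q <= c * V / r N.
  rewrite /Q /leading_error nmZ ger0_norm ?invr_ge0//.
  apply: (@le_trans _ _ (N%:R^-1 * (CY * (r N * V) * s))).
    rewrite ler_wpM2l ?invr_ge0// (le_trans (nmM _ _))// ler_wpM2r//.
    by rewrite -VE hCY.
  have -> : N%:R^-1 * (CY * (r N * V) * s) = CY * s * V * (r N)^-1.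
    transitivity ((r N)^-1 * r N * (CY * s * V * (r N)^-1)); last by rewrite irr mul1r.
    by rewrite Nr; ring.
  by rewrite ler_wpM2r ?invr_ge0 ?(ltW r0)// ler_wpM2r// /c ler_wpM2r// lerDr.
have hE : nm E <= c * (nm (D N om) * V) / r N.
  have EE : E = - (N%:R^-1 *: (D N om *m (gram N om - N%:R *: Sigma) *m invmx Sigma)).
    rewrite /E /Q /leading_error mulmxBr mulmxBl eqN -scalemxAr -scalemxAl.
    rewrite -(mulmxA (D N om)) mulmxV// mulmx1 scalerBr scalerA mulVf ?pnatr_eq0 -?lt0n//.
    by rewrite scale1r opprB.
  rewrite EE nmN nmZ ger0_norm ?invr_ge0//.
  apply: (@le_trans _ _ (N%:R^-1 * (nm (D N om) * (C0 * (r N * V)) * s))).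
    rewrite ler_wpM2l ?invr_ge0// (le_trans (nmM _ _))// ler_wpM2r//.
    rewrite (le_trans (nmM _ _))// ler_wpM2l// -VE.
    exact: hC0.
  have -> : N%:R^-1 * (nm (D N om) * (C0 * (r N * V)) * s) =
      C0 * s * (nm (D N om) * V) * (r N)^-1.
    transitivity ((r N)^-1 * r N * (C0 * s * (nm (D N om) * V) * (r N)^-1)).
      by rewrite Nr; ring.
    by rewrite irr mul1r.
  have Cs : C0 * s <= c by rewrite /c ler_wpM2r// lerDl.
  have tV0 : 0 <= nm (D N om) * V by exact: mulr_ge0.
  have ir0 : 0 <= (r N)^-1 by rewrite invr_ge0 ltW.
  exact: (ler_wpM2r ir0 (ler_wpM2r tV0 Cs)).
have arith := @error_rate_arith R (r N) (nm (D N om)) V C1 C2 c (nm E) (nm Q) (2 * H).+1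
  r1 t0 V0 C10 C20 c0 (nm_ge0 _) (nm_ge0 _) hQ hE.
rewrite mulrCA; apply: le_trans arith.
rewrite /X -mulrBr normrM ger0_norm// -rE ler_wpM2l ?sqr_ge0//.
have -> : rollout_error A B S (G N om) - quadratic_error A B S Q =
    (rollout_error A B S (G N om) - quadratic_error A B S (D N om)) +
    (quadratic_error A B S (Q + E) - quadratic_error A B S Q).
  by rewrite /E [Q + _]addrC subrK addrA subrK.
by rewrite (le_trans (ler_normD _ _))// lerD// hC1.
Qed.

Let mX N : measurable_fun [set: T] (X N).
Proof.
apply: measurable_funB; apply: measurable_funM => //.
  exact: measurable_rollout_error (mG N).
have : all_moments P (fun om => quadratic_error A B S (leading_error A B Bw g Sx N om)).
  exact: all_moments_leading.
by case=> /(_ 0%N).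
Qed.

Let X_integral : exists C : R, exists N0, forall N, (N0 <= N)%N ->
  (\int[P]_om `|(X N om)%:E| <= ((r N)^-1 * C)%:E)%E.
Proof.
have [C hC] := X_bound.
have [mB bB] : bdd_moments P (fun N om => C * y N om ^+ ((2 * H).+1 + 4)).
  by apply: bdd_momentsZ; exact: bdd_momentsX.
have [Cb [N0 hCb]] := bB 1%N.
exists Cb, (maxn 1 N0) => N; rewrite geq_max => /andP[N1 NN0].
have ir0 : 0 <= (r N)^-1 by rewrite invr_ge0 sqrtr_ge0.
apply: (@le_trans _ _ (\int[P]_om ((r N)^-1%:E * (`|C * y N om ^+ ((2 * H).+1 + 4)| ^+ 1)%:E))%E).
  apply: ae_ge0_le_integral => //.
  - by apply: measurableT_comp => //; exact/measurable_EFinP.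
  - by move=> om _; rewrite mule_ge0// lee_fin.
  - by apply: measurable_funeM; exact: measurable_moment (mB N).
  - apply: filterS (hC N N1) => om h _; rewrite -EFinM lee_fin expr1 (le_trans h)//.
    by rewrite ler_wpM2l// ler_norm.
rewrite ge0_integralZl_EFin//; last exact: measurable_moment (mB N).
by rewrite EFinM lee_wpmul2l ?lee_fin//; exact: hCb.
Qed.

(** The rollout error is known to be integrable only for large [N], as the sum of the integrable
    difference [X N] and the leading part. Hence the extended-real expectation is identified with a
    real one from [N0] on. *)
Lemma cvg_rollout_error :
  (fun N : nat => (N%:R%:E * 'E_P[fun om => rollout_error A B S (G N om)])%E) @ \oo -->
  (\tr (Gamma_w H A Bw *m ((M_SS H A Bw Sx + (du%:R)%:M) *t 1%:M)
      *m (Gamma_w H A Bw)^T))%:E.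
Proof.
have [C [N0 hC]] := X_integral.
pose q N := Ex P (fun om => quadratic_error A B S (leading_error A B Bw g Sx N om)).
have aq N : all_moments P (fun om => N%:R * quadratic_error A B S (leading_error A B Bw g Sx N om)).
  by apply: all_momentsZ; exact: all_moments_leading.
have iX N : (N0 <= N)%N -> P.-integrable setT (fun om => (X N om)%:E).
  move=> NN; apply/integrableP; split; first exact/measurable_EFinP.
  by apply: le_lt_trans (hC N NN) _; rewrite ltry.
pose a N := fine (\int[P]_om (X N om)%:E).
have aE N : (N0 <= N)%N -> (\int[P]_om (X N om)%:E = (a N)%:E)%E.
  by move=> NN; rewrite fineK//; apply: integrable_fin_num => //; exact: iX.
have a_le N : (N0 <= N)%N -> `|a N| <= C * (r N)^-1.
  move=> NN; rewrite -lee_fin mulrC; apply: le_trans (hC N NN).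
  by rewrite -abse_EFin -aE//; apply: le_abse_integral => //; exact/measurable_EFinP.
have a_lim : a @ \oo --> 0.
  have lim0 : (fun N : nat => C * (r N)^-1) @ \oo --> (C * 0 : R).
    by apply: cvgMr; exact: cvg_invsqrtn.
  rewrite mulr0 in lim0; apply/cvgrPdist_le => e e0.
  have /cvgrPdist_le/(_ e e0) := lim0; apply: filterS2 (nbhs_infty_ge N0) => N NN.
  rewrite !sub0r !normrN => h; rewrite (le_trans (a_le _ NN))// (le_trans _ h)//.
  exact: ler_norm.
set l := \tr _.
have lim : (fun N => a N + N%:R * q N) @ \oo --> (0 + l : R).
  by apply: cvgD => //; exact: cvg_Ex_quadratic.
rewrite add0r in lim.
have {}lim : (fun N => (a N + N%:R * q N)%:E) @ \oo --> l%:E.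
  by apply: cvg_EFin; [exact: nearW|exact: lim].
apply: cvg_trans lim; apply: near_eq_cvg; near=> N.
have NN : (N0 <= N)%N by near: N; exact: nbhs_infty_ge.
have mR : measurable_fun setT (fun om => rollout_error A B S (G N om)).
  exact: measurable_rollout_error (mG N).
rewrite unlock -ge0_integralZl_EFin//; last 2 first.
- by move=> om _; rewrite lee_fin sqF_ge0.
- exact/measurable_EFinP.
rewrite (eq_integral (fun om => ((X N om)%:E +
    (N%:R * quadratic_error A B S (leading_error A B Bw g Sx N om))%:E)%E)); last first.
  by move=> om _; rewrite -EFinD /X subrK.
rewrite integralD//; [|exact: iX|exact: all_moments_integrable].
by rewrite aE// ExE// -EFinD ExZ//; exact: all_moments_leading.
Unshelve. all: by end_near. Qed.

End MainLimit.

(** The proof orders the driving noise as [w] then [u], the hypothesis has [B] before [Bw]. *)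
Lemma controllable_swap (R : realType) n m1 m2 (A : 'M[R]_n) (B1 : 'M[R]_(n, m1))
    (B2 : 'M[R]_(n, m2)) :
  controllable A (row_mx B1 B2) -> controllable A (row_mx B2 B1).
Proof.
move=> ctrl x0 x1; have [t [v <-]] := ctrl x0 x1.
exists t, (fun s => col_mx (dsubmx (v s)) (usubmx (v s))).
congr (lin_traj A _ x0 t); apply/funext => s.
by rewrite mul_row_col addrC -mul_row_col vsubmxK.
Qed.

(** State coordinates of [c] are recovered from the first [L] coefficients by controllability,
    listed in reverse order; input coordinates are read off the last coefficient. The constant
    [kap + 1] serves both cases. *)
Lemma fresh_coef_bound (R : realType) dx du (A : 'M[R]_dx) (F : 'M[R]_(dx, dx + du)) :
  controllable A F -> exists (L : nat) (kap : R), forall (c : 'rV[R]_(dx + du)) i,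
    `|c 0 i| <= kap * \sum_(r < L.+1)
      nm (fresh_coef A F (state_sel R dx du) (input_sel R dx du) c r).
Proof.
case/controllable_dual_bound => L [kap [kap0 dual]]; exists L, (kap + 1) => c i.
pose fc (r : 'I_L.+1) := fresh_coef A F (state_sel R dx du) (input_sel R dx du) c r.
have fc0 (r : 'I_L.+1) : 0 <= nm (fc r) by exact: nm_ge0.
have k1 : 0 <= kap + 1 by rewrite addr_ge0.
have cx : c *m state_sel R dx du = lsubmx c.
  by rewrite -{1}[c]hsubmxK mul_row_col mulmx1 mulmx0 addr0.
have cu : c *m input_sel R dx du = row_mx 0 (rsubmx c).
  by rewrite -{1}[c]hsubmxK mul_row_block !mulmx0 mulmx1 addr0 add0r.
rewrite (_ : \sum_(r < L.+1) _ = \sum_r nm (fc r))// big_ord_recr/= -(splitK i).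
 case: (fintype.split i) => j /=.
  have -> : c 0 (lshift du j) = lsubmx c 0 j by rewrite mxE.
  have -> : \sum_(r < L) nm (fc (widen_ord (leqnSn L) r)) =
      \sum_(k < L) nm (lsubmx c *m A ^+ k *m F).
    rewrite [RHS](reindex_inj rev_ord_inj)/=; apply: eq_bigr => r _.
    by rewrite /fc /fresh_coef /= ltn_ord cx.
  have s0 : 0 <= \sum_(k < L) nm (lsubmx c *m A ^+ k *m F).
    by rewrite sumr_ge0// => k _; exact: nm_ge0.
  rewrite (le_trans (dual _ j))// ler_pM//; first by rewrite lerDl.
  by rewrite lerDl.
have -> : c 0 (rshift dx j) = fc ord_max 0 (rshift dx j).
  by rewrite /fc /fresh_coef /= ltnn cu row_mxEr mxE.
rewrite (le_trans (le_nm_entry _ _ _))// -[leLHS]mul1r ler_pM//; first by rewrite lerDr.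
by rewrite lerDr sumr_ge0.
Qed.

Theorem proposition2 (R : realType) (d : measure_display)
  (T : measurableType d) (P : probability T R) (dx du H : nat)
  (A : 'M[R]_dx) (B : 'M[R]_(dx, du)) (Bw : 'M[R]_dx)
  (u : nat -> T -> 'cV[R]_du) (w : nat -> T -> 'cV[R]_dx)
  (x : T -> nat -> 'cV[R]_dx) (z : T -> nat -> 'cV[R]_(dx + H * du))
  (Sx : 'M[R]_dx) (Sz_half : 'M[R]_(dx + H * du))
  (Ghat : nat -> T -> 'M[R]_(dx, dx + du)) :
  (0 < H)%N ->
  spectral_radius A < 1 ->
  controllable A (row_mx B Bw) ->
  iid_std_normal P w ->
  iid_std_normal P u ->
  independent_pair P (sigma_seq w) (sigma_seq u) ->
  (forall om, x om = state A B Bw (u ^~ om) (w ^~ om)) ->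
  (forall om, z om = zvec H (x om) (u ^~ om)) ->
  is_stationary_cov A B Bw Sx ->
  is_psd_sqrt Sz_half (Sigma_z P z) ->
  (forall N, measurable_mx (Ghat N)) ->
  (forall N, {ae P, forall om,
     is_least_squares (x om) (u ^~ om) N (Ghat N om)}) ->
  (fun N : nat => (N%:R%:E * 'E_P[fun om =>
     (normF ((rollout H (lsubmx (Ghat N om)) (rsubmx (Ghat N om))
             - rollout H A B) *m Sz_half) ^+ 2)%R])%E) @ \oo
  --> (\tr (Gamma_w H A Bw *m ((M_SS H A Bw Sx + (du%:R)%:M) *t 1%:M)
            *m (Gamma_w H A Bw)^T))%:E.
Proof.
move=> _ rhoA ctrl iidw iidu wu xE zE Sx_stat [S_sym _ SS] mG lsG.
pose g := noise w u; pose F := row_mx Bw B.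
have mg : forall i, measurable_fun setT (g i) := measurable_noise iidw iidu.
have lawg := noise_law iidw iidu.
have indep_g := noise_indep iidw iidu wu.
have A_stable := spectral_radius_pow_small rhoA.
have Sx_F : Sx = A *m Sx *m A^T + F *m F^T.
  by rewrite {1}Sx_stat tr_row_mx mul_row_col -addrA [B *m _ + _]addrC.
have ctrlF := controllable_swap ctrl.
have A_small := spectral_radius_expr_small rhoA.
have Sx_sym := stationary_cov_sym A_small Sx_F.
have Sx_unit := stationary_cov_unit A_small Sx_F ctrlF.
have [L [kap nondeg]] := fresh_coef_bound ctrlF.
have nuE t om : noise_vec g t om = col_mx (w t om) (u t om).
  by apply/colP => e; rewrite mxE.
have trajE om t : traj A F g om t = x om t.
  rewrite xE /state /traj; congr (lin_traj A _ 0 t); apply/funext => s.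
  by rewrite nuE mul_row_col addrC.
have zE' : z = (fun om t => z_traj A B Bw g H om t).
  apply/funext => om; apply/funext => t; rewrite zE /zvec /z_traj trajE.
  by congr (col_mx _ (blockcol _)); apply/funext => k; rewrite nuE col_mxKd.
have {}SS : Sz_half *m Sz_half = z_cov du H Sx.
  by rewrite SS zE'; exact: Sigma_zE.
have normal_eq N : {ae P, forall om, (Ghat N om - row_mx A B) *m
    gram_matrix A F (state_sel R dx du) (input_sel R dx du) g N om =
    Bw *m noise_cross A F (state_sel R dx du) (input_sel R dx du) g (noise_sel R dx du) N om}.
  (* Subtracting [row_mx A B] times the Gram matrix from the normal equations replaces each
     [x_{t+1}] by its noise term [Bw *m w t om]. *)
  apply: filterS (lsG N) => om /ls_normal_equations eqN.
  have xiE t : regressor A F (state_sel R dx du) (input_sel R dx du) g om t =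
      col_mx (x om t) (u t om) by rewrite regressorE trajE nuE col_mxKd.
  rewrite /gram_matrix; under eq_bigr do rewrite xiE.
  rewrite mulmxBl eqN mulmx_sumr -sumrB /noise_cross mulmx_sumr; apply: eq_bigr => t _.
  rewrite xiE noise_sel_vec nuE col_mxKu !mulmxA -mulmxBl; congr (_ *m _).
  have xS : x om t.+1 = A *m x om t + (B *m u t om + Bw *m w t om) by rewrite xE.
  by rewrite xS mul_row_col addrA [LHS]addrC addKr.
rewrite (_ : (fun N : nat => _) = (fun N : nat =>
    (N%:R%:E * 'E_P[fun om => rollout_error A B Sz_half (Ghat N om)])%E)); last first.
  apply/funext => N; congr (_ * 'E_P[_])%E; apply/funext => om.
  exact: normF_sqr.
exact: (cvg_rollout_error mg lawg indep_g A_stable Sx_F Sx_stat Sx_sym Sx_unit S_sym SS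
  nondeg mG normal_eq).
Qed.
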